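(* Let \[ \psi: [0,1] \times T^2 \to T^2, \qquad (t,(x,y)) \mapsto \psi_t(x,y) \] be a $\mathbb{Z}/2$-equivariant smooth isotopy through area-preserving maps (which necessarily fixes the four fixed points of the hyperelliptic involution). Let an integer $r \geq 0$ be given. Then for any $\epsilon > 0$, there is a $\mathbb{Z}/2$-equivariant map \[ \phi: [0,1] \times T^2 \to T^2, \qquad (t,(x,y)) \mapsto \phi_t(x,y), \] which is an isotopy that is continuous in $t$ and smooth in $(x,y)$, such that: \begin{enumerate} \item[(i)] If $d$ denotes the Euclidean metric on $T^2$, then for all $t \in [0,1]$ we have \[ \sup_{(x,y) \in T^2} d(\psi_t(x,y),\phi_t(x,y)) + \sum_{l=1}^{r} \| D^{(l)}\psi_t- D^{(l)} \phi_t\|_\infty < \epsilon. \] \item[(ii)] There is a partition $0=t_0 < t_1 < \dots < t_{n+1}=1$ and a $\mathbb{Z}/2$-equivariant shearing isotopy $(\zeta^{(i)}_s)_{s\in[0,1]}$ for each $i=0,\dots,n$ such that for any $t_i \leq t \leq t_{i+1}$ we have \[ \phi_t = \zeta^{(i)}_{t-t_i} \circ \phi_{t_i} \] on all of $T^2$. \end{enumerate} In other words, the smooth isotopy $(\psi_t)$ can be $C^r$-approximated by isotopies $(\phi_t)$ which are piecewise (in the coordinate $t$) isotopies through shearings.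
   Context: $T^2=\mathbb{R}^2/2\pi\mathbb{Z}^2$ with its standard area form, and $\mathbb{Z}/2$ acts on $T^2$ by the hyperelliptic involution $(x,y)\mapsto(-x,-y)$; equivariance of an isotopy means that each time-$t$ map commutes with this involution. Isotopies start at the identity map. $D^{(l)}$ denotes the $l$-th derivative in the $(x,y)$ variables (using the standard parallelization of $T^2$), and $\|\cdot\|_\infty$ is the supremum over $T^2$ of the pointwise operator norm. A shearing isotopy $(\zeta_s)$ on $T^2$ is an isotopy through area-preserving maps of the form \[ \zeta_s\colon (x,y) \mapsto (x,y) + s f(w\cdot(x,y))\, v, \] where $v,w\in\mathbb{Z}^2$ are orthogonal vectors with $w$ nonzero, $f:\mathbb{R}\to\mathbb{R}$ is a (smooth) $2\pi$-periodic function, and $\cdot$ is the standard inner product on $\mathbb{R}^2$. *)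

(* Defs.v *)
From HB Require Import structures.
From mathcomp Require Import all_boot all_order all_algebra.
From mathcomp Require Import generic_quotient ring_quotient.
From mathcomp Require Import all_classical all_reals all_analysis.

Set Implicit Arguments.
Unset Strict Implicit.
Unset Printing Implicit Defensive.

Import Order.TTheory GRing.Theory Num.Theory.
Import numFieldNormedType.Exports.

Local Open Scope classical_set_scope.
Local Open Scope ring_scope.
Local Open Scope quotient_scope.

(* 2 pi Z^2 *)
Definition lattice (R : realType) : {pred 'rV[R]_2} :=
  fun u => [forall i, u 0 i / (2 * pi) \is a Num.int].

Arguments lattice : clear implicits.

Section LatticeClosed.
Variable R : realType.

Fact lattice_zmod_closed : zmod_closed (lattice R).
Proof.
split=> [|u v /forallP hu /forallP hv]; apply/forallP => i.
  by rewrite mxE mul0r rpred0.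
by rewrite !mxE mulrBl rpredB.
Qed.

HB.instance Definition _ :=
  GRing.isZmodClosed.Build 'rV[R]_2 (lattice R) lattice_zmod_closed.

End LatticeClosed.

(* R^2 / 2 pi Z^2, as an additive group carrying the quotient topology; the
   hyperelliptic involution is the group opposite. *)
Definition torus (R : realType) : Type :=
  quotient_topology (Quotient.quot (lattice R)).

HB.instance Definition _ (R : realType) := Topological.on (torus R).
HB.instance Definition _ (R : realType) := Quotient.on (torus R).
HB.instance Definition _ (R : realType) :=
  GRing.Zmodule.copy (torus R) (Quotient.quot (lattice R)).

Definition tproj (R : realType) (u : 'rV[R]_2) : torus R := \pi_(torus R) u.

(* The chart of the torus centred at 0: the representative in [-pi, pi[^2. *)
Definition tlog (R : realType) (x : torus R) : 'rV[R]_2 :=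
  xget 0 [set u | tproj u = x /\ forall i, - pi <= u 0 i < pi].

Section Calculus.
Variables (R : realType) (V W : normedModType R).

(* D^(l) F (x) (v_1, ..., v_l) *)
Fixpoint iterD (vs : seq V) (F : V -> W) : V -> W :=
  if vs is v :: vs' then 'D_v (iterD vs' F) else F.

(* C^infinity on U, meant for U open *)
Definition smooth_on (U : set V) (F : V -> W) : Prop :=
  forall (vs : seq V) (x : V), U x -> differentiable (iterD vs F) x.

(* F, of which only the values on A matter, extends to a C^infinity map on a
   neighbourhood of a; A need not be open. *)
Definition smooth_at (A : set V) (F : V -> W) (a : V) : Prop :=
  exists (U : set V) (G : V -> W),
    [/\ open U, U a, smooth_on U G & forall x, U x -> A x -> G x = F x].

End Calculus.

Section TorusMaps.
Variable R : realType.
Local Notation E := 'rV[R]_2.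
Local Notation T := (torus R).

(* The expression of f near a in the chart of the torus centred at f a. Changes of
   charts are translations, so the derivatives of [in_chart f a] at a are those of f
   in the standard parallelization. *)
Definition in_chart (V : Type) (f : V -> T) (a : V) : V -> E :=
  fun x => tlog (f x - f a).

Definition torus_smooth (V : normedModType R) (A : set V) (f : V -> T) : Prop :=
  forall a, A a -> smooth_at A (in_chart f a) a.

Definition diffeo (f : T -> T) : Prop :=
  torus_smooth setT (f \o @tproj R) /\
  exists g : T -> T,
    [/\ cancel f g, cancel g f & torus_smooth setT (g \o @tproj R)].

(* f^*(dx /\ dy) = dx /\ dy *)
Definition area_preserving (f : T -> T) : Prop :=
  forall p : E, \det ('J (in_chart (f \o @tproj R) p) p) = 1.

(* The Z/2-action is generated by x |-> - x. *)
Definition equivariant (f : T -> T) : Prop := forall x, f (- x) = - f x.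

(* Time-dependent maps are total in time; only times in [0, 1] matter. *)
Definition isotopy (f : R -> T -> T) : Prop :=
  [/\ f 0 = id,
      forall t, 0 <= t <= 1 -> diffeo (f t) &
      {within [set z | 0 <= z.1 <= 1],
        continuous (fun z : R * T => f z.1 z.2)}].

Definition smooth_isotopy (f : R -> T -> T) : Prop :=
  isotopy f /\
  @torus_smooth (R * E)%type [set z | 0 <= z.1 <= 1]
    (fun z => f z.1 (tproj z.2)).

Definition dot (R' : pzRingType) (u v : 'rV[R']_2) : R' :=
  \sum_i u 0 i * v 0 i.

Definition of_int (w : 'rV[int]_2) : E := map_mx intr w.

Definition shearing_isotopy (zeta : R -> T -> T) : Prop :=
  [/\ smooth_isotopy zeta,
      forall s, 0 <= s <= 1 -> area_preserving (zeta s) &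
      exists (v w : 'rV[int]_2) (f : R -> R),
        [/\ dot v w = 0, w != 0, smooth_on setT f,
            forall x, f (x + 2 * pi) = f x &
            forall (s : R) (p : E), 0 <= s <= 1 ->
              zeta s (tproj p) =
              tproj (p + (s * f (dot (of_int w) p)) *: of_int v)]].

Definition enorm (u : E) : R := Num.sqrt (dot u u).

(* The quotient of the Euclidean metric *)
Definition tdist (x y : T) : R := inf [set enorm u | u in [set u | tproj u = x - y]].

Definition opnorm (l : nat) (A : seq E -> E) : \bar R :=
  ereal_sup [set (enorm (A vs))%:E |
             vs in [set vs : l.-tuple E | forall i, enorm (tnth vs i) <= 1]].

Definition Dtorus (f : T -> T) (p : E) (vs : seq E) : E :=
  iterD vs (in_chart (f \o @tproj R) p) p.

(* || D^(l) f - D^(l) g ||_oo for l >= 1; as f and g have 2 pi Z^2-periodic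
   derivatives, p ranges over all of R^2. *)
Definition Ddist (l : nat) (f g : T -> T) : \bar R :=
  ereal_sup [set opnorm l (fun vs => Dtorus f p vs - Dtorus g p vs) | p in setT].

Definition C0dist (f g : T -> T) : \bar R :=
  ereal_sup [set (tdist (f x) (g x))%:E | x in setT].

Definition Crdist (r : nat) (f g : T -> T) : \bar R :=
  (C0dist f g + \sum_(1 <= l < r.+1) Ddist l f g)%E.

End TorusMaps.

(* Main.v *)
Require Import Defs.
From mathcomp Require Import all_boot all_order all_algebra.
From mathcomp Require Import all_classical all_reals all_analysis.
From HB Require Import structures.
From mathcomp Require Import ring lra zify.

Set Implicit Arguments.
Unset Strict Implicit.
Unset Printing Implicit Defensive.

Import Order.TTheory GRing.Theory Num.Theory.
Import numFieldNormedType.Exports.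

Local Open Scope classical_set_scope.
Local Open Scope ring_scope.

Local Notation iterD := Defs.iterD.

(** The isotopy is lifted to maps Psi s of the plane and written as the flow of a time-dependent
    field X s ([lift_isotopy], [isotopy_field]). Time is first reparametrized by
    chi s = (1 - cos s) / 2, which makes the lift smooth on an open set of times. Each X s is
    periodic; it is odd because the isotopy is equivariant, and divergence free because it
    preserves area (Liouville).

    The Fejer sums of X s are trigonometric fields. Oddness leaves only their sine terms
    sin(w.y) c, and the vanishing divergence gives w.c = 0 for each of them. Hence X s is, up to a
    small error in C^k, a sum of shear fields, with frequencies w that do not depend on s
    ([field_approx]). As w.c = 0, the function sin(w.y) is constant along the lines of direction c:
    the flow of a shear field is p + t sin(w.p) c, a shearing isotopy, and coincides with its
    Euler steps.

    Operator splitting then concludes. On a short interval of time, the flow of a sum of shear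
    fields is close to the composition of the flows of its terms, and the errors accumulate like
    in Gronwall's lemma ([splitting_converges]). Running the shears one after the other gives the
    piecewise shearing isotopy. To have convergence in C^r, and not only in C^0, the estimate is
    applied to r-th iterated tangent maps, which turn Euler steps of a field into Euler steps of
    its tangent map ([itang_axpy], [splitting_approximation]).

    The Fourier analysis rests on three properties of the average over the torus: it is linear, it
    is positive, and it vanishes on derivatives. The limit of averages over finite grids along an
    ultrafilter has them ([mean]). *)

(** * Tangent maps and families of class C^k *)

Section Tangent.
Variable R : realType.
Implicit Types (V W X : normedModType R) (b : bool) (I : Type).

(** Its iterates pack all the derivatives of F up to a given order in a single map, and are
    functorial ([tang_comp]): estimates in C^k become estimates in C^0. *)
Definition tang V W (F : V -> W) (z : V * V) : W * W := (F z.1, 'D_(z.2) F z.1).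

Definition tameb (b : bool) I V W (U : set V) (F : I -> V -> W) : Prop :=
  b -> forall B : R, exists C : R, forall i x, U x -> `|x| <= B -> `|F i x| <= C.

(** Differentiability of order k, on U, of all the members of a family; the flag b adds bounds on
    balls that are uniform in the family. At order 0 and without the flag nothing is asked, so
    that the continuity of a derivative of order k comes with order k.+1. Tangent vectors range
    over the whole space: only the base point is restricted to U. *)
Fixpoint tame (b : bool) I (k : nat) :
    forall V W, set V -> (I -> V -> W) -> Prop :=
  if k is k'.+1 then fun V W U F =>
    (forall i x, U x -> differentiable (F i) x) /\
    @tame b I k' (V * V)%type (W * W)%type (fst @^-1` U) (fun i => tang (F i))
  else fun V W U F => tameb b U F.

Lemma norm_fst V W (z : V * W) : `|z.1| <= `|z|.
Proof. by rewrite [leRHS]/Num.norm /= le_max lexx. Qed.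
Lemma norm_snd V W (z : V * W) : `|z.2| <= `|z|.
Proof. by rewrite [leRHS]/Num.norm /= le_max lexx orbT. Qed.
Lemma norm_pair_le V W (z : V * W) B : (`|z| <= B) = (`|z.1| <= B) && (`|z.2| <= B).
Proof. by rewrite {1}/Num.norm /= ge_max. Qed.

Lemma open_fst V W (U : set V) : open U -> open (fst @^-1` U : set (V * W)%type).
Proof. by move=> oU; apply: open_comp => // z _; exact: cvg_fst. Qed.

#[local] Hint Extern 0 (open _) => solve [exact: openT | exact: (open_fst openT)] : core.

Lemma tame_bound b I k V W (U : set V) (F : I -> V -> W) : tame b k U F -> tameb b U F.
Proof.
elim: k V W U F => [//|k IH] V W U F [_ /IH h] bT B.
have [C hC] := h bT B; exists C => i x Ux xB.
apply: le_trans (norm_fst _) (hC i (x, 0) Ux _).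
by rewrite norm_pair_le xB normr0 (le_trans _ xB).
Qed.

Lemma tame_pred b I k V W (U : set V) (F : I -> V -> W) : tame b k.+1 U F -> tame b k U F.
Proof.
elim: k V W U F => [|k IH] V W U F; first exact: tame_bound.
by move=> [dF tF]; split=> //; exact: IH.
Qed.

Lemma tame_le b I k l V W (U : set V) (F : I -> V -> W) : (l <= k)%N ->
  tame b k U F -> tame b l U F.
Proof. by move=> /subnK <-; elim: (k - l)%N => // n IH /tame_pred. Qed.

Lemma tame_weak b I k V W (U : set V) (F : I -> V -> W) : tame b k U F -> tame false k U F.
Proof. by elim: k V W U F => [//|k IH] V W U F [dF /IH]. Qed.

Lemma tame_sub b I k V W (U U' : set V) (F : I -> V -> W) : U `<=` U' ->
  tame b k U' F -> tame b k U F.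
Proof.
elim: k V W U U' F => [|k IH] V W U U' F UU'.
  by move=> h bT B; have [C hC] := h bT B; exists C => i x /UU'; exact: hC.
move=> [dF tF]; split; first by move=> i x /UU'; exact: dF.
by apply: IH tF => z /UU'.
Qed.

Lemma near_eq_differentiable V W (f g : V -> W) (x : V) :
  {near x, f =1 g} -> differentiable f x -> differentiable g x.
Proof.
move=> fg /[dup] /diff_continuous cdf /diff_locally fE.
have gE : g \o shift x = cst (g x) + 'd f x +o_ (nbhs (0:V)) id.
  apply/eqaddoP => e e0; move/eqaddoP : fE => /(_ e e0) /= H.
  have fg' : \forall h \near (0:V), f (h + x) = g (h + x).
    by move: fg; rewrite (near_shift 0) /= subr0.
  near=> h; rewrite !fctE /= /cst /= -(near fg' h) // -(nbhs_singleton fg).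
  by near: h; exact: H.
by apply/diff_locallyP; rewrite (diff_unique cdf gE).
Unshelve. all: by end_near. Qed.

Lemma tame_eq b I k V W (U : set V) (F G : I -> V -> W) : open U ->
  (forall i x, U x -> F i x = G i x) -> tame b k U F -> tame b k U G.
Proof.
elim: k V W U F G => [|k IH] V W U F G oU FG.
  by move=> h bT B; have [C hC] := h bT B; exists C => i x Ux; rewrite -FG //; exact: hC.
move=> [dF tF]; split.
  move=> i x Ux; have nFG : {near x, F i =1 G i}.
    by apply: filterS (open_nbhs_nbhs (conj oU Ux)) => y; exact: FG.
  exact: near_eq_differentiable nFG (dF i x Ux).
apply: IH tF; first exact: open_fst.
move=> i [x v] /= Ux; rewrite /tang /= FG //; congr (_, _).
apply: near_eq_derive.
by apply: filterS (open_nbhs_nbhs (conj oU Ux)) => y; exact: FG.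
Qed.

Lemma tame_reindex b I J (e : I -> J) k V W (U : set V) (F : J -> V -> W) :
  tame b k U F -> tame b k U (fun i => F (e i)).
Proof.
elim: k V W U F => [|k IH] V W U F.
  by move=> h bT B; have [C hC] := h bT B; exists C => i x; exact: hC.
by move=> [dF tF]; split; [move=> i x; exact: dF|exact: (IH _ _ _ _ tF)].
Qed.

Lemma tang_comp V W X (F : W -> X) (G : V -> W) z :
  differentiable G z.1 -> differentiable F (G z.1) ->
  tang (F \o G) z = tang F (tang G z).
Proof.
move=> dG dF; rewrite /tang /=; congr (_, _).
rewrite !deriveE //; last exact: differentiable_comp.
by rewrite diff_comp.
Qed.

Lemma tame_comp b I k V W X (U : set V) (U' : set W) (F : I -> W -> X) (G : I -> V -> W) :
  open U -> (forall i x, U x -> U' (G i x)) ->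
  tame b k U' F -> tame b k U G -> tame b k U (fun i => F i \o G i).
Proof.
elim: k V W X U U' F G => [|k IH] V W X U U' F G oU UU'.
  move=> hF hG bT B; have [C hC] := hG bT B; have [D hD] := hF bT C.
  by exists D => i x Ux xB /=; apply: hD; [exact: UU'|exact: hC].
move=> [dF tF] [dG tG]; split.
  by move=> i x Ux; apply: differentiable_comp; [exact: dG|apply: dF; exact: UU'].
apply: (@tame_eq _ _ _ _ _ _ (fun i => tang (F i) \o tang (G i))).
- exact: open_fst.
- move=> i z Uz /=; rewrite tang_comp //; first exact: dG.
  by apply: dF; exact: UU'.
- apply: IH tF tG; first exact: open_fst.
  by move=> i z Uz /=; exact: UU'.
Qed.

Lemma diff_eps V W (f : V -> W) (L : V -> W) C x : linear L ->
  (forall v, `|L v| <= C * `|v|) ->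
  (forall e : R, 0 < e -> \forall h \near (0 : V), `|f (h + x) - f x - L h| <= e * `|h|) ->
  differentiable f x /\ forall v, 'D_v f x = L v.
Proof.
move=> lL bL H.
pose L' : {linear V -> W} := HB.pack L (GRing.isLinear.Build _ _ _ _ _ lL).
have cL : continuous L'.
  apply/bounded_linear_continuous/bounded_funP => r; exists (`|C| * r) => y yr.
  by apply: le_trans (bL y) _; rewrite (le_trans (ler_norm _))// normrM normr_id ler_pM.
have fE : f \o shift x = cst (f x) + L' +o_ (nbhs (0:V)) id.
  apply/eqaddoP => e e0; apply: filterS (H e e0) => h.
  by rewrite !fctE /= /cst /= opprD addrA.
have dL := diff_unique cL fE.
have dfx : differentiable f x by apply/diff_locallyP; rewrite dL.
by split=> // v; rewrite deriveE // dL.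
Qed.

Lemma blin_diff V W (L : V -> W) C x : linear L -> (forall x, `|L x| <= C * `|x|) ->
  differentiable L x /\ forall v, 'D_v L x = L v.
Proof.
move=> lL bL; apply: (diff_eps lL bL) => e e0; apply: (@nearW _ (nbhs (0 : V))) => h.
have := lL 1 h x; rewrite !scale1r => ->.
by rewrite addrK subrr normr0 mulr_ge0 // ltW.
Qed.

Lemma tame_lin b I k V W (U : set V) (L : I -> V -> W) (C : R) : 0 <= C ->
  (forall i, linear (L i)) -> (forall i x, `|L i x| <= C * `|x|) -> tame b k U L.
Proof.
move=> C0; elim: k V W U L => [|k IH] V W U L lL bL.
  by move=> bT B; exists (C * B) => i x _ xB; apply: le_trans (bL i x) _; rewrite ler_wpM2l.
have hL i x := blin_diff x (lL i) (bL i).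
split; first by move=> i x _; have [] := hL i x.
have -> : (fun i => tang (L i)) = (fun i z => (L i z.1, L i z.2)).
  by apply/funext => i; apply/funext => z; rewrite /tang (hL _ _).2.
apply: IH => [i a y z|i z] /=; first by rewrite !lL.
rewrite norm_pair_le /= (le_trans (bL _ _)) ?(ler_wpM2l _ (norm_fst z)) //=.
by rewrite (le_trans (bL _ _)) ?(ler_wpM2l _ (norm_snd z)).
Qed.

Lemma tame_cst b I k V W (U : set V) (c : I -> W) :
  (b -> exists C : R, forall i, `|c i| <= C) -> tame b k U (fun i _ => c i).
Proof.
elim: k V W U c => [|k IH] V W U c hc.
  by move=> bT B; have [C hC] := hc bT; exists C.
split; first by move=> i x _; exact: differentiable_cst.
have -> : (fun i => tang (fun _ : V => c i)) = (fun i _ => (c i, 0)).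
  by apply/funext => i; apply/funext => z; rewrite /tang derive_cst.
apply: IH => bT; have [C hC] := hc bT; exists C => i.
by rewrite norm_pair_le /= normr0 hC (le_trans _ (hC i)).
Qed.

Lemma tame_pair b I k V W X (U : set V) (F : I -> V -> W) (G : I -> V -> X) : open U ->
  tame b k U F -> tame b k U G -> tame b k U (fun i x => (F i x, G i x)).
Proof.
elim: k V W X U F G => [|k IH] V W X U F G oU.
  move=> hF hG bT B; have [C hC] := hF bT B; have [D hD] := hG bT B.
  exists (Num.max C D) => i x Ux xB.
  by rewrite norm_pair_le /= !le_max hC // hD // orbT.
move=> [dF tF] [dG tG]; split.
  by move=> i x Ux; apply: differentiable_pair; [exact: dF|exact: dG].
pose S (z : (W * W) * (X * X)) := ((z.1.1, z.2.1), (z.1.2, z.2.2)) : (W * X) * (W * X).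
apply: (@tame_eq _ _ _ _ _ _ (fun i => S \o (fun z => (tang (F i) z, tang (G i) z)))).
- exact: open_fst.
- move=> i [x v] Ux /=; rewrite /tang /S /=; congr (_, _).
  rewrite !deriveE; [|exact: differentiable_pair (dF _ _ Ux) (dG _ _ Ux)|exact: dG|exact: dF].
  by rewrite (diff_pair (dF _ _ Ux) (dG _ _ Ux)).
apply: (@tame_comp _ _ _ _ _ _ _ setT (fun _ => S)) => //; first exact: open_fst.
  apply: (@tame_lin _ _ _ _ _ _ _ 1) => // _ z.
  rewrite mul1r !norm_pair_le /=.
  by rewrite !(le_trans (norm_fst _)) ?norm_fst ?norm_snd //= !(le_trans (norm_snd _)) ?norm_fst ?norm_snd.
by apply: IH => //; exact: open_fst.
Qed.

Lemma tame_id b I k V (U : set V) : tame b k U (fun _ : I => id).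
Proof. by apply: (@tame_lin _ _ _ _ _ _ _ 1) => // _ x; rewrite mul1r. Qed.

Lemma tame_fst b I k V W (U : set (V * W)%type) : tame b k U (fun _ : I => fst).
Proof. by apply: (@tame_lin _ _ _ _ _ _ _ 1) => // _ x; rewrite mul1r norm_fst. Qed.

Lemma tame_snd b I k V W (U : set (V * W)%type) : tame b k U (fun _ : I => snd).
Proof. by apply: (@tame_lin _ _ _ _ _ _ _ 1) => // _ x; rewrite mul1r norm_snd. Qed.

Lemma tame_compT b I k V W X (U : set V) (F : I -> W -> X) (G : I -> V -> W) :
  open U -> tame b k setT F -> tame b k U G -> tame b k U (fun i x => F i (G i x)).
Proof. by move=> oU tF tG; exact: (@tame_comp _ _ _ _ _ _ _ setT F G). Qed.

Lemma tame_add b I k V W (U : set V) (F G : I -> V -> W) : open U ->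
  tame b k U F -> tame b k U G -> tame b k U (fun i x => F i x + G i x).
Proof.
move=> oU tF tG.
apply: (@tame_compT _ _ _ _ _ _ _ (fun _ z => z.1 + z.2) (fun i x => (F i x, G i x))) => //.
  apply: (@tame_lin _ _ _ _ _ _ _ 2) => [|i a x y /=|i x].
  - by [].
  - by rewrite scalerDr addrACA.
  - by rewrite (le_trans (ler_normD _ _)) // mulr_natl mulr2n lerD // ?norm_fst ?norm_snd.
exact: tame_pair.
Qed.

Lemma tame_opp b I k V W (U : set V) (F : I -> V -> W) : open U ->
  tame b k U F -> tame b k U (fun i x => - F i x).
Proof.
move=> oU tF; apply: (@tame_compT _ _ _ _ _ _ _ (fun _ z => - z) F) => //.
apply: (@tame_lin _ _ _ _ _ _ _ 1) => // [i a x y|i x]; first by rewrite opprD scalerN.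
by rewrite normrN mul1r.
Qed.

(** The tangent map of (a, w) |-> a w is made of sums of such products, on which the induction
    feeds. *)
Lemma tame_scale b I k W (U : set (R * W)%type) :
  tame b k U (fun (_ : I) (z : R * W) => z.1 *: z.2).
Proof.
apply: (@tame_sub _ _ _ _ _ _ setT) => //.
elim: k W {U} => [|k IH] W.
  move=> bT B; exists (`|B| * `|B|) => _ z _ zB; rewrite normrZ ler_pM //.
    by rewrite (le_trans _ (ler_norm B)) // (le_trans (norm_fst _)).
  by rewrite (le_trans _ (ler_norm B)) // (le_trans (norm_snd _)).
have key (x : R * W) : differentiable (fun z : R * W => z.1 *: z.2) x /\
   forall v, 'D_v (fun z : R * W => z.1 *: z.2) x = x.1 *: v.2 + v.1 *: x.2.
  apply: (@diff_eps (R * W)%type W (fun z : R * W => z.1 *: z.2) (fun v => x.1 *: v.2 + v.1 *: x.2) (`|x| + `|x|) x).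
  - move=> a u v /=; rewrite !scalerDr !scalerDl !scalerA addrACA.
    by rewrite (mulrC x.1).
  - move=> v; rewrite (le_trans (ler_normD _ _)) // mulrDl lerD // normrZ.
      by rewrite ler_pM // ?norm_fst ?norm_snd.
    by rewrite mulrC ler_pM // ?norm_fst ?norm_snd.
  move=> e e0; apply/nbhs_norm0P; exists e => //= h /ltW he.
  have -> : (h.1 + x.1) *: (h.2 + x.2) - x.1 *: x.2 - (x.1 *: h.2 + h.1 *: x.2) = h.1 *: h.2.
    rewrite !scalerDr !scalerDl.
    set A := h.1 *: h.2; set B := x.1 *: h.2; set D := h.1 *: x.2; set E := x.1 *: x.2.
    by rewrite addrA addrK -[A + B + D]addrA addrK.
  by rewrite normrZ ler_pM // ?norm_snd // (le_trans (norm_fst _)).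
split; first by move=> _ x _; have [] := key x.
apply: (@tame_eq _ _ _ _ _ _ (fun _ (z : (R * W) * (R * W)) =>
   (z.1.1 *: z.1.2, z.1.1 *: z.2.2 + z.2.1 *: z.1.2))).
- exact: open_fst openT.
- by move=> _ z _; rewrite /tang (key _).2.
have scl (p : (R * W) * (R * W) -> R) (q : (R * W) * (R * W) -> W) :
    tame b k setT (fun _ : I => p) -> tame b k setT (fun _ : I => q) ->
    tame b k setT (fun _ : I => fun z => p z *: q z).
  move=> tp tq.
  apply: (@tame_compT _ _ _ _ _ _ _ (fun _ (z : R * W) => z.1 *: z.2)
    (fun _ z => (p z, q z))) => //; exact: tame_pair.
have ff : tame b k setT (fun (_ : I) (z : (R * W) * (R * W)) => z.1.1).
  by apply: (@tame_compT _ _ _ _ _ _ _ (fun _ => fst) (fun _ => @fst _ _)) => //; [exact: tame_fst|exact: tame_fst].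
have fs : tame b k setT (fun (_ : I) (z : (R * W) * (R * W)) => z.1.2).
  by apply: (@tame_compT _ _ _ _ _ _ _ (fun _ => snd) (fun _ => @fst _ _)) => //; [exact: tame_snd|exact: tame_fst].
have sf : tame b k setT (fun (_ : I) (z : (R * W) * (R * W)) => z.2.1).
  by apply: (@tame_compT _ _ _ _ _ _ _ (fun _ => fst) (fun _ => @snd _ _)) => //; [exact: tame_fst|exact: tame_snd].
have ss : tame b k setT (fun (_ : I) (z : (R * W) * (R * W)) => z.2.2).
  by apply: (@tame_compT _ _ _ _ _ _ _ (fun _ => snd) (fun _ => @snd _ _)) => //; [exact: tame_snd|exact: tame_snd].
by apply: tame_pair => //; [|apply: tame_add => //]; exact: scl.
Qed.

Lemma tame_mul b I k V W (U : set V) (p : I -> V -> R) (q : I -> V -> W) : open U ->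
  tame b k U p -> tame b k U q -> tame b k U (fun i x => p i x *: q i x).
Proof.
move=> oU tp tq.
apply: (@tame_compT _ _ _ _ _ _ _ (fun _ (z : R * W) => z.1 *: z.2)
    (fun i z => (p i z, q i z))) => //; [exact: tame_scale|exact: tame_pair].
Qed.

Lemma tame_sum b I k V W (U : set V) (J : Type) (r : seq J) (P : pred J) (F : J -> I -> V -> W) :
  open U -> (forall j, tame b k U (F j)) ->
  tame b k U (fun i x => \sum_(j <- r | P j) F j i x).
Proof.
move=> oU tF; elim: r => [|j r IH].
  under eq_fun do under eq_fun do rewrite big_nil.
  by apply: (@tame_cst _ _ _ _ _ _ (fun=> 0)) => _; exists 0 => _; rewrite normr0.
under eq_fun do under eq_fun do rewrite big_cons.
by case: (P j) => //; exact: tame_add.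
Qed.

Lemma tame_sincos b I k (U : set R) :
  tame b k U (fun _ : I => @sin R) /\ tame b k U (fun _ : I => @cos R).
Proof.
suff [h1 h2] : tame b k setT (fun _ : I => @sin R) /\ tame b k setT (fun _ : I => @cos R).
  by split; [apply: tame_sub h1|apply: tame_sub h2].
elim: k {U} => [|k [IHs IHc]].
  by split => _ B; exists 1 => _ x _ _; rewrite ?sin_max ?cos_max.
have ds (x : R) : differentiable sin x by apply/derivable1_diffP/derivable_sin.
have dc (x : R) : differentiable cos x by apply/derivable1_diffP/derivable_cos.
have Ds (x v : R) : 'D_v sin x = v *: cos x.
  rewrite deriveE // -[v]mulr1 linearZ /= -deriveE //; congr (_ *: _); last by rewrite derive_val.
  by rewrite mulr1.
have Dc (x v : R) : 'D_v cos x = - v *: sin x.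
  rewrite deriveE // -{1}[v]mulr1 linearZ /= -deriveE // derive_val scalerN scaleNr //.
have cf (f : R -> R) : tame b k setT (fun _ : I => f) ->
    tame b k (fst @^-1` setT) (fun (_ : I) (z : R * R) => f z.1).
  move=> tf; apply: (@tame_compT _ _ _ _ _ _ _ (fun _ => f) (fun _ => fst)) => //.
  exact: tame_fst.
have t2 := @tame_snd b I k R R (fst @^-1` setT).
split; split=> //.
- have -> : (fun _ : I => tang (@sin R)) = (fun _ z => (sin z.1, z.2 *: cos z.1)).
    by apply/funext => i; apply/funext => z; rewrite /tang Ds.
  by apply: tame_pair; [|exact: cf|apply: tame_mul => //; exact: cf].
- have -> : (fun _ : I => tang (@cos R)) = (fun _ z => (cos z.1, - z.2 *: sin z.1)).
    by apply/funext => i; apply/funext => z; rewrite /tang Dc.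
  apply: tame_pair; [by []|exact: cf|apply: tame_mul => //; [exact: tame_opp|exact: cf]].
Qed.

End Tangent.

#[local] Hint Extern 0 (open _) => solve [exact: openT | exact: (open_fst openT)] : core.
Local Notation Ck k U F := (tame false k U (fun _ : unit => F)).

(** * Jets as iterated tangent maps *)

Section Iterated.
Variable R : realType.
Implicit Types V W X : normedModType R.

(** The doubling takes place inside, so that [itang] peels off the tangent functor next to F, and
    inductions generalize over V and W. *)
Fixpoint TE (k : nat) (V : normedModType R) : normedModType R :=
  if k is k'.+1 then TE k' (V * V)%type else V.

Fixpoint itang (k : nat) : forall V W, (V -> W) -> TE k V -> TE k W :=
  if k is k'.+1 then fun V W F => @itang k' (V * V)%type (W * W)%type (tang F)
  else fun V W F => F.

Lemma itang_ext k V W (F G : V -> W) : F =1 G -> itang (k := k) F = itang G.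
Proof. by move=> /funext ->. Qed.

Lemma itang_comp k V W X (F : W -> X) (G : V -> W) z :
  Ck k setT F -> Ck k setT G ->
  itang (k := k) (F \o G) z = itang F (itang G z).
Proof.
elim: k V W X F G z => [//|k IH] V W X F G z [dF tF] [dG tG] /=.
rewrite -IH //; congr (itang _ _); apply/funext => y; rewrite [RHS]/= tang_comp //.
  exact: (dG tt).
exact: (dF tt).
Qed.

(** An Euler step p + a G p becomes an Euler step: a scheme and its jets obey the same recursion. *)
Lemma itang_axpy k V W (a : R) (F G : V -> W) z :
  Ck k setT F -> Ck k setT G ->
  itang (k := k) (fun x => F x + a *: G x) z = itang F z + a *: itang G z.
Proof.
elim: k V W F G z => [//|k IH] V W F G z [dF tF] [dG tG] /=.
rewrite -IH //; congr (itang _ _); apply/funext => y; rewrite /tang.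
have dFy : differentiable F y.1 by exact: (dF tt).
have dGy : differentiable G y.1 by exact: (dG tt).
rewrite -[RHS]/(F y.1 + a *: G y.1, 'D_(y.2) F y.1 + a *: 'D_(y.2) G y.1); congr (_, _).
rewrite -deriveZ; last exact: diff_derivable.
by rewrite -deriveD //; apply: diff_derivable => //; exact: differentiableZ.
Qed.

Lemma itang_sum k V W (J : Type) (r : seq J) (F : J -> V -> W) z :
  (forall j, Ck k setT (F j)) ->
  itang (k := k) (fun x => \sum_(j <- r) F j x) z = \sum_(j <- r) itang (F j) z.
Proof.
move=> tF; elim: r => [|j r IH].
  rewrite big_nil (@itang_ext _ _ _ _ (fun=> 0)); last by move=> x; rewrite big_nil.
  elim: k V W {F tF} z => [//|k IH] V W z /=.
  rewrite (@itang_ext _ _ _ _ (fun=> 0)) //.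
  by move=> x; rewrite /tang derive_cst.
rewrite big_cons -IH -[X in _ = _ + X]scale1r -itang_axpy //; last exact: tame_sum.
by congr (itang _ z); apply/funext => x; rewrite big_cons scale1r.
Qed.

Lemma itang_bound I k V W (F : I -> V -> W) : tame true k setT F ->
  forall B : R, exists C : R, forall i z, `|z| <= B -> `|itang (k := k) (F i) z| <= C.
Proof.
elim: k V W F => [|k IH] V W F.
  by move=> /(_ isT) h B; have [C hC] := h B; exists C => i z; exact: hC.
by move=> [_ tF]; exact: (IH _ _ _ tF).
Qed.

Lemma differentiable_eps V W (f : V -> W) x : differentiable f x ->
  forall e : R, 0 < e ->
  exists2 d : R, 0 < d & forall h, `|h| < d -> `|f (h + x) - f x - 'd f x h| <= e * `|h|.
Proof.
move=> /diff_locally /eqaddoP H e /H /nbhs_norm0P [d /= d0 hd].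
by exists d => // h /hd; rewrite !fctE /= /cst /= opprD addrA.
Qed.

(** For M > C, the times t with |g t - g 0| <= M t form a compact set. Its maximum cannot be less
    than 1, since the inequality persists a little further by differentiability. *)
Lemma curve_MVT W (g : R -> W) (C : R) : (forall t, differentiable g t) ->
  (forall t, 0 <= t <= 1 -> `|'D_1 g t| <= C) -> `|g 1 - g 0| <= C.
Proof.
move=> dg hC; apply/ler_addgt0Pr => e e0; set M := C + e.
pose A := `[0, 1]%classic `&` [set t : R | `|g t - g 0| - M * t <= 0].
have cg : continuous g by move=> t; exact: differentiable_continuous.
have cA : compact A.
  apply: (subclosed_compact _ (@segment_compact R 0 1)); last by move=> t [].
  apply: closedI; first exact: interval_closed.
  apply: (@closed_comp _ _ (fun t => `|g t - g 0| - M * t) [set y : R | y <= 0]); last exact: closed_le.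
  move=> t _; apply: cvgB; last by apply: cvgM; [exact: cvg_cst|exact: cvg_id].
  by apply: cvg_norm; apply: cvgB; [exact: cg|exact: cvg_cst].
have A0 : A 0 by split; rewrite /= ?in_itv /= ?lexx ?ler01 // subrr normr0 mulr0 subrr.
have [||s /set_mem[/= + sM] smax] := @compact_EVT_max _ _ (fun t : R => t) A _ cA.
- by exists 0.
- by apply: continuous_subspaceT => t; exact: cvg_id.
rewrite in_itv /= => /andP[s0 s1].
rewrite subr_le0 in sM.
have [s1'|s1'] := ltrP s 1; last first.
  have -> : 1 = s by apply/le_anti; rewrite s1 s1'.
  have M0 : 0 <= M.
    by rewrite addr_ge0 ?(ltW e0) // (le_trans (normr_ge0 _) (hC 0 _)) // lexx ler01.
  by rewrite (le_trans sM) // -[leRHS]mulr1 ler_wpM2l.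
have [d d0 hd] : exists2 d : R, 0 < d & forall h, `|h| < d -> `|g (h + s) - g s - 'd g s h| <= e * `|h|.
  exact: differentiable_eps.
pose u := Num.min (d / 2) (1 - s).
have u0 : 0 < u by rewrite lt_min divr_gt0 //= subr_gt0.
have ud : u < d by rewrite gt_min ltr_pdivrMr // ltr_pMr // ltr1n.
have us : u + s <= 1 by rewrite -lerBrDr ge_min lexx orbT.
suff /smax : u + s \in A by rewrite gerDr leNgt u0.
apply/mem_set; split; first by rewrite /= in_itv /= us addr_ge0 // ltW.
have := hd u; rewrite gtr0_norm // => /(_ ud) hu.
rewrite /= subr_le0.
have dgu : `|'d g s u| <= C * u.
  have -> : 'd g s u = u *: 'd g s 1 by rewrite -linearZ /= -[X in _ = 'd g s X]/(u * 1) mulr1.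
  rewrite normrZ gtr0_norm // mulrC ler_wpM2r ?(ltW u0) //.
  by rewrite -deriveE // hC // s0 s1.
rewrite -[g _ - _](subrKA (g s)) (le_trans (ler_normD _ _)) // mulrDr lerD //.
rewrite -[_ - _](subrK ('d g s u)) (le_trans (ler_normD _ _)) // /M mulrDl addrC lerD //.
Qed.

Lemma ball_MVT V W (F : V -> W) (B C : R) : (forall x, differentiable F x) ->
  (forall x v, `|x| <= B -> `|'D_v F x| <= C * `|v|) ->
  forall x y, `|x| <= B -> `|y| <= B -> `|F x - F y| <= C * `|x - y|.
Proof.
move=> dF hC x y xB yB.
pose p (t : R) := y + t *: (x - y).
have dp t : differentiable p t /\ 'D_1 p t = x - y.
  have [||e e0|d ->] := @diff_eps R R V p (fun s => s *: (x - y)) `|x - y| t.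
  - by move=> a u v; rewrite scalerDl scalerA.
  - by move=> v; rewrite normrZ mulrC.
  - apply/nbhs_norm0P; exists 1 => //= h _.
    rewrite /p scalerDl addrCA addrK subrr normr0 mulr_ge0 //; exact: ltW.
  - by rewrite scale1r.
have pB t : 0 <= t <= 1 -> `|p t| <= B.
  move=> /andP[t0 t1]; have -> : p t = (1 - t) *: y + t *: x.
    by rewrite /p scalerBr scalerBl scale1r addrA addrAC.
  rewrite (le_trans (ler_normD _ _)) // !normrZ (ger0_norm t0) ger0_norm ?subr_ge0 //.
  have -> : B = (1 - t) * B + t * B by rewrite mulrBl mul1r subrK.
  by rewrite lerD // ler_wpM2l // subr_ge0.
have := @curve_MVT _ (F \o p) (C * `|x - y|) => /=.
have -> : p 1 = x by rewrite /p scale1r addrC subrK.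
have -> : p 0 = y by rewrite /p scale0r addr0.
apply.
  by move=> t; apply: differentiable_comp; [exact: (dp t).1|exact: dF].
move=> t /pB ptB.
have dpt := (dp t).1.
rewrite deriveE; last by apply: differentiable_comp => //; exact: dF.
by rewrite diff_comp //= -(deriveE _ dpt) (dp t).2 -deriveE // hC.
Qed.

Lemma tame_lip I V W (F : I -> V -> W) : tame true 1 setT F ->
  forall B : R, exists2 C : R, 0 <= C & forall i x y, `|x| <= B -> `|y| <= B ->
    `|F i x - F i y| <= C * `|x - y|.
Proof.
move=> [dF /(_ isT) tF] B; have [C hC] := tF (Num.max B 1); exists `|C| => // i x y.
apply: ball_MVT; first by move=> z; exact: dF.
move=> z v zB; have [->|v0] := eqVneq v 0; first by rewrite derive0 !normr0 mulr0.
have nv : 0 < `|v| by rewrite normr_gt0.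
have vE : v = `|v| *: (`|v|^-1 *: v) by rewrite scalerA divff ?scale1r ?gt_eqF.
rewrite deriveE; last exact: dF.
rewrite {1}vE linearZ /= normrZ normr_id mulrC ler_pM2r // -deriveE; last exact: dF.
apply: le_trans (ler_norm C); apply: le_trans (hC i (z, `|v|^-1 *: v) _ _) => //.
  exact: (@norm_snd _ _ _ (tang (F i) (z, `|v|^-1 *: v))).
by rewrite norm_pair_le /= !le_max zB normrZ normfV normr_id mulVf ?lexx ?orbT ?gt_eqF.
Qed.

Lemma itang_lip I k V W (F : I -> V -> W) : tame true k.+1 setT F ->
  forall B : R, exists2 C : R, 0 <= C & forall i x y, `|x| <= B -> `|y| <= B ->
    `|itang (k := k) (F i) x - itang (F i) y| <= C * `|x - y|.
Proof.
elim: k V W F => [|k IH] V W F; first exact: tame_lip.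
by move=> [_ tF]; exact: (IH _ _ _ tF).
Qed.

Lemma tame_derive (b : bool) I k V W (U : set V) (F : I -> V -> W) (v : I -> V) : open U ->
  (b -> exists C : R, forall i, `|v i| <= C) ->
  tame b k.+1 U F -> tame b k U (fun i => 'D_(v i) (F i)).
Proof.
move=> oU hv [dF tF].
have t1 : tame b k U (fun i (x : V) => (x, v i)).
  by apply: tame_pair => //; [exact: tame_id|exact: tame_cst].
have t2 : tame b k U (fun i (x : V) => tang (F i) (x, v i)).
  exact: (tame_comp oU _ tF t1).
apply: (@tame_compT _ _ _ _ _ _ _ U (fun _ => snd) (fun i x => tang (F i) (x, v i))) => //.
exact: tame_snd.
Qed.

Lemma iterD_rcons V W (vs : seq V) (v : V) (F : V -> W) :
  iterD (rcons vs v) F = iterD vs ('D_v F).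
Proof. by elim: vs => //= u vs ->. Qed.

Lemma tame_iterD (b : bool) I k V W (U : set V) (F : I -> V -> W) (vs : seq V) : open U ->
  tame b (k + size vs) U F -> tame b k U (fun i => iterD vs (F i)).
Proof.
move=> oU; elim: vs k => [|v vs IH] k /=; first by rewrite addn0.
rewrite addnS -addSn => /IH; apply: tame_derive => // _.
by exists `|v|.
Qed.

(** Freezing the vector component commutes with derivatives in the directions (u, 0); this reads
    derivatives of order k + 1 of a map as derivatives of order k of its tangent map. *)
Lemma iterD_slice V W W' (H : V * V -> W * W') (v : V) (vs : seq V) x :
  Ck (size vs) setT H ->
  iterD vs (fun x => (H (x, v)).2) x = (iterD [seq (u, 0) | u <- vs] H (x, v)).2.
Proof.
elim: vs x => [//|u vs IH] x tH /=.
have tH' := tame_pred tH.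
rewrite (_ : iterD vs _ = (fun x => (iterD [seq (u, 0) | u <- vs] H (x, v)).2)); last first.
  by apply/funext => y; exact: IH.
set K := iterD _ H.
have dK z : differentiable K z.
  have : Ck 1 setT K by apply: tame_iterD => //; rewrite size_map add1n.
  by move=> [/(_ tt z Logic.I)].
have dj : differentiable (fun y : V => (y, v)) x.
  by apply: differentiable_pair; [exact: ex_diff|exact: ex_diff].
have dKj : differentiable (fun y => K (y, v)) x.
  by apply: (@differentiable_comp _ _ _ _ (fun y : V => (y, v)) K) => //; exact: dK.
have e1 := @tang_comp _ _ _ _ K (fun y : V => (y, v)) (x, u) dj (dK _).
have Dj : 'D_u (fun y : V => (y, v)) x = (u, 0).
  rewrite deriveE // (@diff_pair _ _ _ _ id (fun=> v)); try exact: ex_diff.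
  by rewrite !diff_val.
have := congr1 snd e1; rewrite /tang /= Dj => <-.
have [] := @blin_diff _ _ _ (@snd W W') 1 (K (x, v)) => //.
  by move=> z; rewrite mul1r norm_snd.
move=> d2 D2.
have := @tang_comp _ _ _ _ snd (fun y => K (y, v)) (x, u) dKj d2.
by move/(congr1 snd) => /=; rewrite /tang /= D2.
Qed.

Lemma iterD_itang k V W (F G : V -> W) (B e : R) :
  Ck k setT F -> Ck k setT G ->
  (forall z : TE k V, `|z| <= B -> `|itang F z - itang G z| <= e) ->
  forall (vs : seq V) x, (size vs <= k)%N -> (forall v, v \in vs -> `|v| <= B) ->
  `|x| <= B -> `|iterD vs F x - iterD vs G x| <= e.
Proof.
elim: k V W F G => [|k IH] V W F G.
  by move=> _ _ h vs x; rewrite leqn0 => /nilP -> _; exact: h.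
move=> [dF tF] [dG tG] h vs x; case: (lastP vs) => [|{}vs v].
  move=> _ _ xB; apply: le_trans (IH _ _ (tang F) (tang G) tF tG h [::] (x, 0) _ _ _) => //.
    exact: (@norm_fst _ _ _ (tang F (x, 0) - tang G (x, 0))).
  by rewrite norm_pair_le xB normr0 (le_trans _ xB).
rewrite size_rcons ltnS => svs hvs xB; rewrite !iterD_rcons.
have vB : `|v| <= B by apply: hvs; rewrite mem_rcons inE eqxx.
have sub u : u \in vs -> `|u| <= B by move=> uvs; apply: hvs; rewrite mem_rcons inE uvs orbT.
rewrite -![iterD vs ('D_v _)]/(iterD vs (fun x => (tang _ (x, v)).2)).
rewrite !(@iterD_slice _ _ _ (tang _)); try by apply: tame_le svs _.
apply: le_trans (IH _ _ (tang F) (tang G) tF tG h [seq (u, 0) | u <- vs] (x, v) _ _ _) => //.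
- exact: (@norm_snd _ _ _ (_ - _)).
- by rewrite size_map.
- move=> _ /mapP[u uvs ->]; rewrite norm_pair_le normr0 sub //.
  by rewrite (le_trans _ xB).
- by rewrite norm_pair_le xB.
Qed.

(** A finite basis with its coordinates, which reduces all directions to finitely many. *)
Definition frame V (J : finType) (e : J -> V) (c : J -> V -> R) : Prop :=
  [/\ forall j, linear (c j), exists C : R, forall j x, `|c j x| <= C * `|x| &
      forall x, x = \sum_j c j x *: e j].

(** The tangent map is the sum of the partial derivatives weighted by the coordinates of the
    vector, so iterated partial derivatives control iterated tangent maps. *)
Lemma tame_frame (b : bool) I k V W (J : finType) (e : J -> V) (c : J -> V -> R) (U : set V)
    (F : I -> V -> W) : frame e c -> open U ->
  (forall i js x, (size js < k)%N -> U x -> differentiable (iterD (map e js) (F i)) x) ->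
  (forall js, (size js <= k)%N -> tameb b U (fun i => iterD (map e js) (F i))) ->
  tame b k U F.
Proof.
move=> [lc [C bc] ce] oU; elim: k F => [|k IH] F dF bF; first exact: (bF [::]).
split; first by move=> i x; exact: (dF i [::]).
apply: (@tame_eq _ _ _ _ _ _ _ (fun i z =>
   (F i z.1, \sum_j c j z.2 *: 'D_(e j) (F i) z.1))).
- exact: open_fst.
- move=> i [x v] /= Ux; rewrite /tang /=; congr (_, _).
  have d : differentiable (F i) x by exact: (dF i [::]).
  rewrite deriveE // [in RHS](ce v) linear_sum; apply: eq_bigr => j _.
  by rewrite linearZ /= -deriveE.
have oU1 := @open_fst _ V V U oU.
have cmp (G : I -> V -> W) : tame b k U G -> tame b k (fst @^-1` U) (fun i (z : V * V) => G i z.1).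
  move=> tG; apply: (@tame_comp _ _ _ _ _ _ _ _ U G (fun _ => fst)) => //.
  exact: tame_fst.
apply: tame_pair => //.
  apply: cmp; apply: IH => [i js x js_k|js js_k]; first exact/dF/ltnW.
  exact/bF/leqW.
apply: tame_sum => // j; apply: tame_mul => //.
  apply: (@tame_compT _ _ _ _ _ _ _ _ (fun _ => c j) (fun _ => snd)) => //; last exact: tame_snd.
  apply: (@tame_lin _ _ _ _ _ _ _ _ `|C|) => // _ x; rewrite (le_trans (bc j x)) //.
  by rewrite ler_wpM2r // ler_norm.
apply: (cmp (fun i => 'D_(e j) (F i))); apply: IH => [i js x js_k|js js_k].
  by rewrite -iterD_rcons -map_rcons; apply: dF; rewrite size_rcons.
rewrite (_ : (fun i => _) = fun i => iterD (map e (rcons js j)) (F i)).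
  by apply: bF; rewrite size_rcons.
by apply/funext => i; rewrite map_rcons iterD_rcons.
Qed.

Lemma smooth_tame k V W (J : finType) (e : J -> V) (c : J -> V -> R) (U : set V)
    (F : V -> W) : frame e c -> open U -> smooth_on U F ->
  Ck k U F.
Proof.
by move=> fr oU sF; apply: (tame_frame fr oU) => // _ js x _ Ux; exact: sF.
Qed.

Lemma tame_smooth V W (U : set V) (F : V -> W) : open U ->
  (forall k, Ck k U F) -> smooth_on U F.
Proof.
move=> oU tF vs x Ux.
by have [/(_ tt x Ux)] : Ck 1 U (iterD vs F) by exact: tame_iterD.
Qed.

Definition proper_space V := forall B : R, compact [set x : V | `|x| <= B].

Lemma proper_pair V W : proper_space V -> proper_space W -> proper_space (V * W)%type.
Proof.
move=> pV pW B.
rewrite (_ : [set x | _] = [set x : V | `|x| <= B] `*` [set x : W | `|x| <= B]).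
  exact: compact_setX.
by apply/seteqP; split=> z /=; rewrite norm_pair_le => /andP.
Qed.

Lemma proper_real : proper_space (R : normedModType R).
Proof.
move=> B; rewrite (_ : [set x | _] = `[- B, B]%classic); first exact: segment_compact.
by apply/seteqP; split=> x; rewrite /= in_itv /= ler_norml.
Qed.

Lemma compact_bound V W (A : set V) (F : V -> W) : compact A ->
  (forall x, differentiable F x) -> exists C : R, forall x, A x -> `|F x| <= C.
Proof.
move=> cA dF; have cF : {within A, continuous F}.
  by apply: continuous_subspaceT => x; exact: differentiable_continuous.
have /compact_bounded [M [_ hM]] := continuous_compact cF cA.
by exists (M + 1) => x Ax; apply: (hM (M + 1)); [rewrite ltrDl|exists x].
Qed.

(** One more derivative makes the last tangent map continuous, hence bounded on compact balls. *)
Lemma proper_tame I k V W (F : V -> W) : proper_space V ->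
  Ck k.+1 setT F -> tame true k setT (fun _ : I => F).
Proof.
elim: k V W F => [|k IH] V W F pV [dF tF].
  move=> _ B; have [C hC] := compact_bound (pV B) (fun x => dF tt x Logic.I).
  by exists C => _ x _; exact: hC.
split; first by move=> _ x _; exact: (dF tt).
by apply: IH => //; exact: proper_pair.
Qed.

End Iterated.

(** * Symmetry of second derivatives and Taylor remainders in time *)

Section TimeDependent.
Variable R : realType.
Implicit Types V W X : normedModType R.

Lemma derive_line V V' W (F : V -> W) (A : V' -> V) x v w :
  (forall h : R, A (h *: v + x) = h *: w + A x) -> 'D_v (F \o A) x = 'D_w F (A x).
Proof.
by move=> hA; rewrite /derive; under eq_fun do rewrite /= hA.
Qed.

Lemma differentiable_affine V V' W (F : V -> W) (L : V' -> V) (a : V) C x : linear L ->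
  (forall x, `|L x| <= C * `|x|) -> differentiable F (L x + a) ->
  differentiable (fun x => F (L x + a)) x.
Proof.
move=> lL bL dF; apply: (@differentiable_comp _ _ _ _ (fun x => L x + a) F) => //.
by apply: differentiableD; [exact: (blin_diff x lL bL).1|exact: differentiable_cst].
Qed.

Lemma differentiable_line V W (F : V -> W) (a w : V) (t : R) : differentiable F (t *: w + a) ->
  differentiable (fun t : R => F (t *: w + a)) t.
Proof.
apply: (@differentiable_affine V R W F (fun t => t *: w) a `|w| t).
  by move=> b x y; rewrite scalerDl scalerA.
by move=> x; rewrite normrZ mulrC.
Qed.

Lemma derive_line1 V W (F : V -> W) (a w : V) (t : R) :
  'D_1 (fun t : R => F (t *: w + a)) t = 'D_w F (t *: w + a).
Proof.
apply: (@derive_line _ _ _ F (fun t : R => t *: w + a)) => h.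
by rewrite scalerDl addrA -[X in X *: w]/(h * 1) mulr1.
Qed.

Lemma scalel_diff W (w : W) (t : R) : differentiable (fun t : R => t *: w) t /\
  'D_1 (fun t : R => t *: w) t = w.
Proof.
have [||d ->] := @blin_diff _ R W (fun t => t *: w) `|w| t; last by rewrite scale1r.
  by move=> b x y; rewrite scalerDl scalerA.
by move=> x; rewrite normrZ mulrC.
Qed.

(** The mean value inequality for t |-> F (t h u + h v + x) - F (t h u + x) - t h^2 D_v D_u F x:
    its derivative is o(h^2), because D_u F is differentiable at x. *)
Lemma mixed_difference V W (F : V -> W) x u v : (forall y, differentiable F y) ->
  differentiable ('D_u F) x -> forall e : R, 0 < e -> exists2 d : R, 0 < d &
  forall h, 0 < h -> h < d ->
  `|F (h *: u + (h *: v + x)) - F (h *: u + x) - (F (h *: v + x) - F x)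
    - (h * h) *: 'D_v ('D_u F) x| <= e * (h * h).
Proof.
move=> dF dDu e e0.
set N := `|u| + `|v| + 1.
have N0 : 0 < N by rewrite ltr_wpDl ?ltr01 // addr_ge0.
set e1 := e / (N + N).
have e10 : 0 < e1 by rewrite divr_gt0 // addr_gt0.
have [d d0 hd] := differentiable_eps dDu e10.
exists (d / N); first by rewrite divr_gt0.
move=> h h0; rewrite ltr_pdivlMr // => hdN.
set D := 'D_v ('D_u F) x.
pose g (t : R) := F (t *: (h *: u) + (h *: v + x)) - F (t *: (h *: u) + x) - t *: ((h * h) *: D).
have dl (w a : V) t : differentiable (fun t : R => F (t *: w + a)) t by exact: differentiable_line.
have dD t : differentiable (fun t : R => t *: ((h * h) *: D)) t.
  exact: (scalel_diff _ _).1.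
have dg t : differentiable g t.
  by apply: differentiableB => //; apply: differentiableB.
have DDE t : 'D_1 (fun t : R => t *: ((h * h) *: D)) t = (h * h) *: D.
  exact: (scalel_diff _ _).2.
have -> : F (h *: u + (h *: v + x)) - F (h *: u + x) - (F (h *: v + x) - F x) - (h * h) *: D
   = g 1 - g 0.
  rewrite /g !scale1r !scale0r !add0r subr0.
  by rewrite addrAC.
apply: curve_MVT => // t /andP[t0 t1].
rewrite deriveB ?DDE; try by apply: diff_derivable => //; apply: differentiableB.
rewrite deriveB; try exact: diff_derivable.
rewrite !derive_line1.
have DuE y : 'D_(h *: u) F y = h *: 'D_u F y by rewrite !deriveE // linearZ.
rewrite !DuE.
have th (y : V) : `|y| <= N * h -> `|y| < d by move=> /le_lt_trans; apply; rewrite mulrC.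
have n1 : `|t *: (h *: u) + h *: v| <= N * h.
  rewrite (le_trans (ler_normD _ _)) // !normrZ (ger0_norm t0) (gtr0_norm h0).
  rewrite mulrDl mulrDl -addrA lerD //.
    by rewrite mulrA (mulrC `|u|) ler_wpM2r // -[leRHS]mul1r ler_wpM2r // ltW.
  by rewrite (mulrC h); move: (ltW h0); lra.
have n2 : `|t *: (h *: u)| <= N * h.
  rewrite !normrZ (ger0_norm t0) (gtr0_norm h0) mulrA mulrC.
  rewrite ler_pM ?mulr_ge0 ?(ltW h0) //; first by have := normr_ge0 v; rewrite /N; lra.
  by rewrite -[leRHS]mul1r ler_wpM2r // ltW.
pose c := 'D_u F x; pose p := 'd ('D_u F) x (t *: (h *: u)); pose q := 'd ('D_u F) x (h *: v).
pose a := 'D_u F (t *: (h *: u) + x); pose b := 'D_u F (t *: (h *: u) + (h *: v + x)).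
have A1 : `|a - c - p| <= e1 * (N * h).
  by rewrite (le_trans (hd _ (th _ n2))) // ler_wpM2l // ltW.
have A2 : `|b - c - (p + q)| <= e1 * (N * h).
  rewrite /b addrA /p /q -linearD.
  by rewrite (le_trans (hd _ (th _ n1))) // ler_wpM2l // ltW.
have qE : q = h *: D by rewrite /q linearZ /= /D deriveE.
rewrite -/a -/b.
have -> : h *: b - h *: a - (h * h) *: D = h *: ((b - c - (p + q)) - (a - c - p)).
  rewrite -scalerA -qE -!scalerBr; congr (_ *: _).
  by apply: (addIr (a - c - p)); rewrite subrK addrACA [b - a + _]addrA subrK opprD [- q - p]addrC.
rewrite normrZ gtr0_norm // mulrC mulrA ler_wpM2r ?(ltW h0) //.
rewrite (le_trans (ler_normB _ _)) // (le_trans (lerD A2 A1)) //.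
by rewrite -mulrDr -mulrDl mulrA /e1 divfK // gt_eqF // addr_gt0.
Qed.

(** Both mixed derivatives are the limit of one and the same second difference divided by h^2. *)
Lemma Schwarz V W (F : V -> W) x u v : (forall y, differentiable F y) ->
  differentiable ('D_u F) x -> differentiable ('D_v F) x ->
  'D_v ('D_u F) x = 'D_u ('D_v F) x.
Proof.
move=> dF du dv; apply/eqP; rewrite -subr_eq0 -normr_le0; apply/ler_addgt0Pr => e e0.
rewrite add0r; have e2 : 0 < e / 2 by rewrite divr_gt0.
have [d d0 hd] := mixed_difference v dF du e2.
have [d' d'0 hd'] := mixed_difference u dF dv e2.
set h := Num.min d d' / 2.
have m0 : 0 < Num.min d d' by rewrite lt_min d0.
have h0 : 0 < h by rewrite divr_gt0.
have hm : h < Num.min d d' by rewrite ltr_pdivrMr // ltr_pMr // ltr1n.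
have := hd h h0; have := hd' h h0; move: hm; rewrite lt_min => /andP[-> ->] /(_ isT) A /(_ isT) B.
have hh : 0 < h * h by rewrite mulr_gt0.
rewrite -(ler_pM2r hh) -[X in _ * X]gtr0_norm // mulrC -normrZ.
rewrite (splitr e) mulrDl; apply: le_trans (lerD A B); apply: le_trans (ler_normB _ _).
have Z : forall a b c d P Q : W, (a - b - (c - d) - Q) - (a - c - (b - d) - P) = P - Q.
  move=> a b c d1 P Q.
  have -> : a - b - (c - d1) = a - c - (b - d1).
    by rewrite !opprB addrACA [- b - c]addrC -addrACA.
  by set T := a - c - _; rewrite opprB addrC addrA subrK.
by rewrite (addrCA (h *: v)) Z scalerBr.
Qed.

Definition smooth V W (F : V -> W) := forall k, Ck k setT F.

Lemma smooth_diff V W (F : V -> W) x : smooth F -> differentiable F x.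
Proof. by move=> /(_ 1) [/(_ tt x Logic.I)]. Qed.

Lemma smooth_derive V W (F : V -> W) v : smooth F -> smooth ('D_v F).
Proof. by move=> sF k; apply: (@tame_derive _ _ unit _ _ _ _ (fun=> F) (fun=> v)). Qed.

Lemma smooth_tang V W (F : V -> W) : smooth F -> smooth (tang F).
Proof. by move=> sF k; exact: (sF k.+1).2. Qed.

Lemma smooth_comp V W X (F : W -> X) (G : V -> W) : smooth F -> smooth G ->
  smooth (fun x => F (G x)).
Proof. by move=> sF sG k; apply: (@tame_compT _ _ _ _ _ _ _ _ (fun _ => F) (fun _ => G)). Qed.

Lemma smooth_pair V W X (F : V -> W) (G : V -> X) : smooth F -> smooth G ->
  smooth (fun x => (F x, G x)).
Proof. by move=> sF sG k; apply: tame_pair. Qed.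

Lemma smooth_fst V W : smooth (@fst V W). Proof. by move=> k; exact: tame_fst. Qed.
Lemma smooth_snd V W : smooth (@snd V W). Proof. by move=> k; exact: tame_snd. Qed.
Lemma smooth_cst V W (w : W) : smooth (fun _ : V => w).
Proof. by move=> k; exact: (@tame_cst _ _ _ _ _ _ _ (fun=> w)). Qed.
Lemma smooth_id V : smooth (@id V). Proof. by move=> k; exact: tame_id. Qed.
Lemma smooth_add V W (F G : V -> W) : smooth F -> smooth G -> smooth (fun x => F x + G x).
Proof. by move=> sF sG k; exact: tame_add. Qed.
Lemma smooth_opp V W (F : V -> W) : smooth F -> smooth (fun x => - F x).
Proof. by move=> sF k; exact: tame_opp. Qed.
Lemma smooth_mul V W (F : V -> R) (G : V -> W) : smooth F -> smooth G ->
  smooth (fun x => F x *: G x).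
Proof. by move=> sF sG k; exact: tame_mul. Qed.
Lemma smooth_sum V W (J : Type) (r : seq J) (F : J -> V -> W) : (forall j, smooth (F j)) ->
  smooth (fun x => \sum_(j <- r) F j x).
Proof. by move=> sF k; apply: tame_sum => // j; exact: sF. Qed.
Lemma smooth_lin V W (L : V -> W) C : linear L -> (forall x, `|L x| <= C * `|x|) -> smooth L.
Proof.
move=> lL bL k; apply: (@tame_lin _ _ _ _ _ _ _ _ `|C|) => // _ x.
by rewrite (le_trans (bL x)) // ler_wpM2r // ler_norm.
Qed.
Lemma smooth_sin : smooth (@sin R). Proof. by move=> k; exact: (tame_sincos _ _ _ _).1. Qed.
Lemma smooth_cos : smooth (@cos R). Proof. by move=> k; exact: (tame_sincos _ _ _ _).2. Qed.

Lemma derive_pair V W X (F : V -> W) (G : V -> X) v x :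
  differentiable F x -> differentiable G x ->
  'D_v (fun x => (F x, G x)) x = ('D_v F x, 'D_v G x).
Proof.
by move=> dF dG; rewrite !deriveE //; [rewrite diff_pair|exact: differentiable_pair].
Qed.

Lemma deriveZdir V W (F : V -> W) x v (a : R) : differentiable F x ->
  'D_(a *: v) F x = a *: 'D_v F x.
Proof. by move=> dF; rewrite !deriveE // linearZ. Qed.

Lemma curve_Taylor W (g : R -> W) C : (forall t, differentiable g t) ->
  (forall t, differentiable ('D_1 g) t) ->
  (forall t, 0 <= t <= 1 -> `|'D_1 ('D_1 g) t| <= C) ->
  `|g 1 - g 0 - 'D_1 g 0| <= C.
Proof.
move=> dg dg1 hC; set D := 'D_1 g 0.
have dD t := @scalel_diff _ D t.
have -> : g 1 - g 0 - D = (g 1 - 1 *: D) - (g 0 - 0 *: D).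
  by rewrite scale1r scale0r subr0 addrAC.
apply: (@curve_MVT _ _ (fun t => g t - t *: D)).
  by move=> t; apply: differentiableB => //; exact: (dD t).1.
move=> t /andP[t0 t1].
rewrite deriveB; [|exact: diff_derivable|exact: diff_derivable (dD t).1].
rewrite (dD t).2 /D.
have := @curve_MVT _ _ (fun u => 'D_1 g (u *: t + 0)) C; rewrite scale1r scale0r !addr0; apply.
  by move=> u; apply: (@differentiable_line _ _ ('D_1 g) 0 t u).
move=> u /andP[u0 u1].
rewrite (@derive_line1 _ _ ('D_1 g) 0 t u) addr0.
have -> : 'D_t ('D_1 g) (u *: t) = t *: 'D_1 ('D_1 g) (u *: t).
  by rewrite -deriveZdir // -[t *: 1]/(t * 1) mulr1.
rewrite normrZ ger0_norm // -[leRHS]mul1r ler_pM // hC //.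
by rewrite mulr_ge0 //= mulr_ile1.
Qed.

Lemma line_Taylor V W (F : V -> W) x v C h : smooth F ->
  (forall t, 0 <= t <= 1 -> `|'D_v ('D_v F) (t *: (h *: v) + x)| <= C) -> 0 <= h ->
  `|F (h *: v + x) - F x - h *: 'D_v F x| <= C * h ^+ 2.
Proof.
move=> sF hC h0.
have dF y : differentiable F y by exact: smooth_diff.
have dF1 y : differentiable ('D_v F) y by exact/smooth_diff/smooth_derive.
pose g (t : R) := F (t *: (h *: v) + x).
have dg t : differentiable g t by exact: (@differentiable_line _ _ F).
have g1E : 'D_1 g = fun t => h *: 'D_v F (t *: (h *: v) + x).
  by apply/funext => t; rewrite (@derive_line1 _ _ F) deriveZdir.
have dg1 t : differentiable ('D_1 g) t.
  by rewrite g1E; apply: differentiableZ; exact: (@differentiable_line _ _ ('D_v F)).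
have := @curve_Taylor _ g (C * h ^+ 2) dg dg1.
have -> : 'D_1 g 0 = h *: 'D_v F x by have /(congr1 (fun f => f 0)) := g1E; rewrite scale0r add0r.
rewrite g1E /g scale1r scale0r add0r; apply=> t t01.
rewrite deriveZ; last by apply: diff_derivable; exact: (@differentiable_line _ _ ('D_v F)).
rewrite (@derive_line1 _ _ ('D_v F)) deriveZdir // scalerA normrZ normrM ger0_norm //.
by rewrite mulrC expr2 ler_wpM2r ?mulr_ge0 ?hC.
Qed.

(** The division by the square of the time step makes uniform bounds say that an Euler step in
    time is correct up to O(h^2). *)
Definition Taylor_rem V W (F : R * V -> W) (i : R * R) (p : V) : W :=
  i.2 ^- 2 *: (F (i.1 + i.2, p) - F (i.1, p) - i.2 *: 'D_(1, 0) F (i.1, p)).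

(** The tangent map of the remainder of F is the remainder of the tangent map of F in the space
    variable, by [Schwarz]; so the case of order 0 is enough. *)
Lemma tame_Taylor_rem k V W (F : R * V -> W) (S : R) : proper_space V -> smooth F ->
  tame true k setT (fun i : {i : R * R | 0 <= i.1 <= S /\ 0 < i.2 <= 1} => Taylor_rem F (sval i)).
Proof.
move=> pV; elim: k V W F pV => [|k IH] V W F pV sF.
  move=> _ B.
  have [C hC] := compact_bound (@proper_pair _ _ _ (@proper_real R) pV (Num.max (S + 1) B))
    (fun x => smooth_diff x (smooth_derive (V := (R * V)%type) (1, 0) (smooth_derive (V := (R * V)%type) (1, 0) sF))).
  exists C => -[[s h] /= [/andP[s0 sS] /andP[h0 h1]]] p _ pB.
  rewrite /Taylor_rem /= normrZ gtr0_norm ?invr_gt0 ?exprn_gt0 // mulrC.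
  rewrite ler_pdivrMr ?exprn_gt0 //.
  have <- : h *: ((1, 0) : (R * V)%type) + (s, p) = (s + h, p).
    by rewrite -[LHS]/(h * 1 + s, h *: 0 + p) mulr1 scaler0 add0r addrC.
  apply: line_Taylor => // [t /andP[t0 t1]|]; last exact: ltW.
  apply: hC => /=; rewrite norm_pair_le /= !le_max !scaler0 add0r pB orbT andbT.
  apply/orP; left; rewrite -[t *: _]/(t * (h * 1)) mulr1.
  have th0 : 0 <= t * h by rewrite mulr_ge0 // ltW.
  rewrite ger0_norm ?addr_ge0 // addrC lerD //.
  by rewrite mulr_ile1 // ltW.
have dF x : differentiable F x by exact: smooth_diff.
have dF1 v x : differentiable ('D_v F) x by exact/smooth_diff/smooth_derive.
have dsl (G : R * V -> W) s p : (forall x, differentiable G x) ->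
    differentiable (fun p => G (s, p)) p /\ forall v, 'D_v (fun p => G (s, p)) p = 'D_(0, v) G (s, p).
  move=> dG; split=> [|v].
    have dsp : differentiable (fun p : V => (s, p)) p.
      by apply: differentiable_pair; exact: ex_diff.
    by apply: (@differentiable_comp _ _ _ _ (fun p : V => (s, p)) G).
  apply: (@derive_line _ _ _ G (fun p => (s, p))) => h.
  by rewrite -[RHS]/(h * 0 + s, h *: v + p) mulr0 add0r.
pose K (z : R * (V * V)) := 'D_(0, z.2.2) F (z.1, z.2.1).
pose F' (z : R * (V * V)) := (F (z.1, z.2.1), K z).
have sF'1 : smooth (fun z : R * (V * V) => F (z.1, z.2.1)).
  apply: smooth_comp => //; apply: smooth_pair; first exact: smooth_fst.
  by apply: (smooth_comp (@smooth_fst _ _) (@smooth_snd _ _)).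
have sK : smooth K.
  apply: (smooth_comp (@smooth_snd _ _) (G := fun z : R * (V * V) => tang F ((z.1, z.2.1), (0, z.2.2)))).
  apply: smooth_comp; first exact: smooth_tang.
  apply: smooth_pair; apply: smooth_pair; first exact: smooth_fst.
  - by apply: (smooth_comp (@smooth_fst _ _) (@smooth_snd _ _)).
  - exact: smooth_cst.
  - by apply: (smooth_comp (@smooth_snd _ _) (@smooth_snd _ _)).
have sF' : smooth F' by exact: smooth_pair.
have dR i p : differentiable (fun p => F (i.1 + i.2, p) - F (i.1, p) - i.2 *: 'D_(1, 0) F (i.1, p)) p.
  apply: differentiableB; first by apply: differentiableB; exact: (dsl F _ _ dF).1.
  by apply: differentiableZ; exact: (dsl _ _ _ (dF1 _)).1.
split; first by move=> i p _; apply: differentiableZ; exact: dR.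
have := IH _ _ F' (proper_pair pV pV) sF'.
congr (tame _ _ _ _); apply/funext => -[[s h] /= _]; apply/funext => -[p v].
rewrite /Taylor_rem /tang /=.
rewrite derive_pair; [|exact: smooth_diff..].
rewrite deriveZ; last exact: diff_derivable (dR (s, h) p).
rewrite deriveB; [|apply: diff_derivable..]; first last.
- by apply: differentiableZ; exact: (dsl _ _ _ (dF1 _)).1.
- by apply: differentiableB; exact: (dsl F _ _ dF).1.
rewrite deriveB; [|apply: diff_derivable; exact: (dsl F _ _ dF).1..].
rewrite deriveZ; last by apply: diff_derivable; exact: (dsl _ _ _ (dF1 _)).1.
rewrite !(dsl _ _ _ dF).2 (dsl _ _ _ (dF1 _)).2.
have -> : 'D_(1, 0) (fun x : R * (V * V) => F (x.1, x.2.1)) (s, (p, v)) = 'D_(1, 0) F (s, p).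
  apply: (@derive_line _ _ _ F (fun x : R * (V * V) => (x.1, x.2.1))) => a.
  by [].
have -> : 'D_(1, 0) K (s, (p, v)) = 'D_(1, 0) ('D_(0, v) F) (s, p).
  have E (a : R) : K (a *: ((1, 0) : (R * (V * V))%type) + (s, (p, v)))
      = 'D_(0, v) F (a *: ((1, 0) : (R * V)%type) + (s, p)).
    rewrite -[X in K X]/((a * 1 + s, (a *: 0 + p, a *: 0 + v)) : (R * (V * V))%type).
    rewrite -[X in _ = 'D_(0, v) F X]/((a * 1 + s, a *: 0 + p) : (R * V)%type).
    by rewrite /K /= !scaler0 !add0r.
  by rewrite [LHS]/derive; under eq_fun do rewrite /= E.
by rewrite (@Schwarz _ _ F (s, p) (1, 0) (0, v)).
Qed.

End TimeDependent.

Lemma le_of_eq (R : realType) (a b : R) : a = b -> a <= b. Proof. by move=> ->. Qed.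

(** * Convergence of operator splitting *)

Section Splitting.
Variables (R : realType) (V : normedModType R).
(** The scheme x runs, in its k-th round, through the m fields B (k m), ..., B (k m + m - 1) with
    step h, while y is the solution to approximate at the ends of the rounds, driven by Y k. The
    errors are eta, for Y k as the sum of the fields of a round, and C h^2, for the Euler steps
    of y. *)
Variables (x y : nat -> V) (B Y : nat -> V -> V) (N m : nat).
Variables (h b la L eta C rho : R).
Hypothesis h0 : 0 < h.
Hypotheses (la0 : 0 <= la) (L0 : 0 <= L) (eta0 : 0 <= eta) (C0 : 0 <= C) (b0 : 0 <= b).
Hypothesis xy0 : x 0%N = y 0%N.
Hypothesis xS : forall i, (i < N * m)%N -> x i.+1 = x i + h *: B i (x i).
Hypothesis yS : forall k, (k < N)%N -> `|y k.+1 - y k - h *: Y k (y k)| <= C * h ^+ 2.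
Hypothesis yb : forall k, (k <= N)%N -> `|y k| <= rho.
Hypothesis Bb : forall i z, (i < N * m)%N -> `|z| <= rho + 1 -> `|B i z| <= b.
Hypothesis Bl : forall i z z', (i < N * m)%N -> `|z| <= rho + 1 -> `|z'| <= rho + 1 ->
  `|B i z - B i z'| <= la * `|z - z'|.
Hypothesis Yl : forall k z z', (k < N)%N -> `|z| <= rho + 1 -> `|z'| <= rho + 1 ->
  `|Y k z - Y k z'| <= L * `|z - z'|.
Hypothesis BY : forall k z, (k < N)%N -> `|z| <= rho + 1 ->
  `|\sum_(j < m) B (k * m + j)%N z - Y k z| <= eta.

Let kappa := eta + (C + la * b * m%:R ^+ 2) * h.
(** Discrete Gronwall: each round makes an error of at most h kappa and amplifies the previous
    ones by 1 + L h. *)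
Definition splitting_error (k : nat) := (1 + L * h) ^+ k * (k%:R * (h * kappa)).

(** The bounds on the fields hold in the ball of radius rho + 1. The scheme stays in this ball as
    long as it is close to y, and this condition closes the circle. *)
Hypothesis small : splitting_error N + m%:R * (h * b) <= 1.

Let kappa0 : 0 <= kappa.
Proof. by rewrite addr_ge0 // mulr_ge0 ?(ltW h0) // addr_ge0 // !mulr_ge0. Qed.

Let q1 : 1 <= 1 + L * h. Proof. by rewrite lerDl mulr_ge0 // ltW. Qed.

Let error_le k l : (k <= l)%N -> splitting_error k <= splitting_error l.
Proof.
move=> kl; rewrite /splitting_error ler_pM //.
- by rewrite exprn_ge0 // (le_trans ler01).
- by rewrite !mulr_ge0 // ltW.
- by rewrite ler_weXn2l.
- by rewrite ler_wpM2r ?mulr_ge0 ?ler_nat // ltW.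
Qed.

Let substep_lt k j : (k < N)%N -> (j < m)%N -> (k * m + j < N * m)%N.
Proof.
by move=> kN jm; rewrite (@leq_trans (k.+1 * m)) ?leq_mul2r ?kN ?orbT // mulSn addnC ltn_add2r.
Qed.

Let scheme_ball k : (k < N)%N -> `|x (k * m)%N - y k| <= splitting_error k ->
  `|x (k * m)%N| + m%:R * (h * b) <= rho + 1.
Proof.
move=> kN IH; have Ek := error_le (ltnW kN).
rewrite -[x _](subrK (y k)) addrC (le_trans (lerD (lexx _) (ler_normD _ _))) //.
have := yb (ltnW kN); move: small IH Ek; lra.
Qed.

Lemma substep_drift k j : (k < N)%N -> (j <= m)%N -> `|x (k * m)%N| + m%:R * (h * b) <= rho + 1 ->
  `|x (k * m + j)%N - x (k * m)%N| <= j%:R * (h * b).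
Proof.
move=> kN jm xb; elim: j jm => [|j IH] jm; first by rewrite addn0 subrr normr0 mul0r.
have kmj := substep_lt kN jm.
have IHj := IH (ltnW jm).
rewrite addnS xS // addrAC (le_trans (ler_normD _ _)) // mulrSr mulrDl mul1r lerD //.
rewrite normrZ gtr0_norm // ler_pM2l // Bb //.
rewrite -[x _](subrK (x (k * m)%N)) addrC (le_trans (ler_normD _ _)) // (le_trans _ xb) // lerD //.
rewrite (le_trans IHj) // ler_wpM2r ?mulr_ge0 ?(ltW h0) // ler_nat; exact: ltnW.
Qed.

(** During a round the point drifts by at most m h b, so that evaluating the fields at the
    successive points, and not at the first one, costs la m h b for each of the m substeps. *)
Lemma substep_consistent k : (k < N)%N -> `|x (k * m)%N| + m%:R * (h * b) <= rho + 1 ->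
  `|x (k.+1 * m)%N - x (k * m)%N - h *: \sum_(j < m) B (k * m + j)%N (x (k * m)%N)|
    <= (la * b * m%:R ^+ 2) * h * h.
Proof.
move=> kN xb; set x0 := x (k * m)%N.
have x0b : `|x0| <= rho + 1.
  by rewrite (le_trans _ xb) // lerDl !mulr_ge0 ?(ltW h0).
suff H j : (j <= m)%N -> `|x (k * m + j)%N - x0 - h *: \sum_(i < j) B (k * m + i)%N x0|
    <= (la * b * m%:R) * h * h * j%:R.
  have := H m (leqnn m); rewrite -mulSnr => /le_trans; apply.
  by apply: le_of_eq; ring.
elim: j => [|j IH] jm.
  by rewrite big_ord0 scaler0 addn0 subrr subr0 normr0 mulr0.
have kmj := substep_lt kN jm.
have dr := substep_drift kN (ltnW jm) xb.
have mj : j%:R * (h * b) <= m%:R * (h * b).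
  by rewrite ler_wpM2r ?mulr_ge0 ?(ltW h0) // ler_nat ltnW.
rewrite big_ord_recr /= scalerDr addnS xS // mulrSr mulrDr mulr1.
set u := x (k * m + j)%N; set s := h *: \sum_(_ < j) _; set t := h *: B _ u.
have -> : u + t - x0 - (s + h *: B (k * m + j)%N x0)
   = (u - x0 - s) + h *: (B (k * m + j)%N u - B (k * m + j)%N x0).
  by rewrite scalerBr addrACA -/t opprD -!addrA; congr (_ + _); rewrite addrCA; congr (_ + _); rewrite addrCA.
rewrite (le_trans (ler_normD _ _)) // lerD //; first by apply: IH; exact: ltnW.
rewrite normrZ gtr0_norm // mulrC ler_wpM2r ?(ltW h0) //.
have ub : `|u| <= rho + 1.
  rewrite -[u](subrK x0) addrC (le_trans (ler_normD _ _)) // (le_trans _ xb) // lerD //.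
  exact: le_trans dr mj.
rewrite (le_trans (Bl kmj ub x0b)) // -!mulrA ler_wpM2l // (le_trans dr) // (le_trans mj) //.
by apply: le_of_eq; ring.
Qed.

Lemma splitting_converges k : (k <= N)%N -> `|x (k * m)%N - y k| <= splitting_error k.
Proof.
elim: k => [|k IH] kN.
  by rewrite mul0n xy0 subrr normr0 /splitting_error mul0r mulr0.
have {}IH := IH (ltnW kN).
have Ek := error_le (ltnW kN).
have xb := scheme_ball kN IH.
have xb' : `|x (k * m)%N| <= rho + 1.
  by rewrite (le_trans _ xb) // lerDl !mulr_ge0 ?(ltW h0).
have yb' : `|y k| <= rho + 1 by rewrite (le_trans (yb (ltnW kN))) // lerDl.
have H1 := substep_consistent kN xb.
have H2 := yS kN.
have H3 := BY kN xb'.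
have H4 := Yl kN xb' yb'.
set e := splitting_error k in IH Ek.
have H4' : `|Y k (x (k * m)%N) - Y k (y k)| <= L * e.
  by rewrite (le_trans H4) // ler_wpM2l.
have -> : x (k.+1 * m)%N - y k.+1 =
  (x (k.+1 * m)%N - x (k * m)%N - h *: \sum_(j < m) B (k * m + j)%N (x (k * m)%N))
  + h *: (\sum_(j < m) B (k * m + j)%N (x (k * m)%N) - Y k (x (k * m)%N))
  + h *: (Y k (x (k * m)%N) - Y k (y k))
  + (x (k * m)%N - y k)
  - (y k.+1 - y k - h *: Y k (y k)).
  rewrite !scalerBr.
  set a := x (k.+1 * m)%N; set c := x (k * m)%N; set d := h *: \sum_(_ < _) _.
  set f := h *: Y k c; set g := h *: Y k (y k).
  have tel (p q r : V) : (p - q) + (q - r) = p - r by rewrite addrA subrK.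
  rewrite !tel [a - c - g]addrAC tel !opprB [a - g - y k]addrAC.
  by rewrite addrA subrK addrA subrK.
rewrite (le_trans (ler_normB _ _)) //.
have step : `|x (k.+1 * m)%N - x (k * m)%N - h *: \sum_(j < m) B (k * m + j)%N (x (k * m)%N)|
   + h * eta + h * (L * e) + e + C * h ^+ 2 <= splitting_error k.+1.
  apply: (@le_trans _ _ ((1 + L * h) * e + h * kappa)).
    rewrite /kappa; move: H1; set A := `|_|; set D := _ * m%:R ^+ 2; move=> H1.
    rewrite expr2; move: H1; lra.
  have Q1 : 1 <= (1 + L * h) * (1 + L * h) ^+ k by rewrite -exprS exprn_ege1.
  have P0 : 0 <= h * kappa by rewrite mulr_ge0 // ltW.
  have := ler_wpM2r P0 Q1; rewrite mul1r /e /splitting_error exprS -(natr1 k).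
  set Q := _ ^+ k; set P := h * kappa; set K := k%:R;
  lra.
apply: le_trans step; rewrite lerD // (le_trans (ler_normD _ _)) // lerD //.
rewrite (le_trans (ler_normD _ _)) // lerD //.
  rewrite (le_trans (ler_normD _ _)) // lerD // normrZ gtr0_norm // ler_wpM2l // ltW //.
by rewrite normrZ gtr0_norm // ler_wpM2l // ltW.
Qed.

Lemma splitting_substep k j (c : R) : (k < N)%N -> (j < m)%N -> 0 <= c <= h ->
  `|x (k * m + j)%N + c *: B (k * m + j)%N (x (k * m + j)%N) - y k|
    <= splitting_error N + m%:R * (h * b).
Proof.
move=> kN jm /andP[c0 ch].
have Ek := error_le (ltnW kN).
have IH := splitting_converges (ltnW kN).
have xb := scheme_ball kN IH.
have dr := substep_drift kN (ltnW jm) xb.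
have mj : (j%:R + 1) * (h * b) <= m%:R * (h * b).
  by rewrite -[1]/(1%:R) -natrD ler_wpM2r ?mulr_ge0 ?(ltW h0) // ler_nat addn1.
have hb : 0 <= h * b by rewrite mulr_ge0 // ltW.
have kmj := substep_lt kN jm.
set u := x (k * m + j)%N in dr *.
have ub : `|u| <= rho + 1.
  rewrite -[u](subrK (x (k * m)%N)) addrC (le_trans (ler_normD _ _)) // (le_trans _ xb) // lerD //.
  by move: dr mj; rewrite mulrDl mul1r; lra.
have -> : u + c *: B (k * m + j)%N u - y k =
    (x (k * m)%N - y k) + (u - x (k * m)%N) + c *: B (k * m + j)%N u.
  by rewrite [x (k * m)%N - y k + _]addrC addrA subrK addrAC.
have cB : `|c *: B (k * m + j)%N u| <= h * b.
  by rewrite normrZ ger0_norm // ler_pM // Bb.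
rewrite (le_trans (ler_normD _ _)) // (le_trans (lerD (ler_normD _ _) cB)) //.
by move: mj; rewrite mulrDl mul1r; move: dr IH Ek; lra.
Qed.

End Splitting.

(** * Approximation of a flow by shear steps *)

Section PlaneSplitting.
Variable R : realType.
Local Notation E := 'rV[R]_2.

Lemma norm_coord n (x : 'rV[R]_n) i : `|x 0 i| <= `|x|.
Proof. by rewrite [leRHS]/Num.norm /= mx_normrE; exact: (le_bigmax _ _ (0, i)). Qed.

Lemma norm_rV_le n (x : 'rV[R]_n) (B : R) : 0 <= B -> (forall i, `|x 0 i| <= B) -> `|x| <= B.
Proof.
move=> B0 h; rewrite [leLHS]/Num.norm /= mx_normrE; apply: bigmax_le => //= -[i j] _ /=.
by rewrite (ord1 i).
Qed.

Lemma proper_rV n : proper_space ('rV[R]_n : normedModType R).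
Proof.
move=> B; apply: bounded_closed_compact.
  by exists B; split; [exact: num_real|move=> C BC x /= xB; rewrite (le_trans xB) // ltW].
apply: (@closed_comp _ _ (fun x : 'rV[R]_n => `|x|) [set y : R | y <= B]); last exact: closed_le.
by move=> x _; exact: norm_continuous.
Qed.

Lemma frame_rV n : frame (fun j : 'I_n => delta_mx 0 j : 'rV[R]_n) (fun j x => x 0 j).
Proof.
split=> [j a x y||x]; first by rewrite !mxE.
  by exists 1 => j x; rewrite mul1r norm_coord.
by rewrite {1}(row_sum_delta x).
Qed.

Lemma ord2 (j : 'I_2) : j = 0 \/ j = 1.
Proof. by case: j => -[|[|//]] lj; [left|right]; exact/val_inj. Qed.

Lemma dot2 (A : pzRingType) (u v : 'rV[A]_2) : dot u v = u 0 0 * v 0 0 + u 0 1 * v 0 1.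
Proof.
rewrite /dot big_ord_recl big_ord1 (_ : lift ord0 ord0 = 1 :> 'I_2) //; exact/val_inj.
Qed.

Lemma dot_linear (u : E) : linear (dot u).
Proof.
move=> a x y; rewrite /dot scaler_sumr -big_split; apply: eq_bigr => i _ /=.
by rewrite !mxE mulrDr -[a *: _]/(a * _) mulrCA.
Qed.

Lemma dot_le (u x : E) : `|dot u x| <= 2 * `|u| * `|x|.
Proof.
rewrite dot2 (le_trans (ler_normD _ _)) // -mulrA mulr_natl mulr2n.
by rewrite lerD // normrM ler_pM // norm_coord.
Qed.

Definition shear (u c : E) (p : E) : E := sin (dot u p) *: c.

Lemma tame_shear k (U C : R) : tame true k setT
  (fun i : {i : E * E | `|i.1| <= U /\ `|i.2| <= C} => shear (sval i).1 (sval i).2).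
Proof.
apply: tame_mul => //; last first.
  by apply: (@tame_cst _ _ _ _ _ _ _ (fun i : {i : E * E | _} => (sval i).2)) => _;
    exists C => -[i [/=]].
apply: (@tame_compT _ _ _ _ _ _ _ _ (fun _ => sin) (fun i : {i : E * E | _} => dot (sval i).1)) => //.
  exact: (tame_sincos _ _ _ _).1.
apply: (@tame_lin _ _ _ _ _ _ _ _ (2 * `|U|)); first by rewrite mulr_ge0.
  by move=> i; exact: dot_linear.
move=> [[u c] [/= uU _]] x; rewrite (le_trans (dot_le _ _)) // ler_wpM2r // ler_wpM2l //.
by rewrite (le_trans uU) // ler_norm.
Qed.

Lemma smooth_shear u c : smooth (shear u c).
Proof.
apply: smooth_mul; last exact: smooth_cst.
apply: smooth_comp; first exact: smooth_sin.
exact: (smooth_lin (dot_linear u) (dot_le u)).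
Qed.

Fixpoint shear_steps (A : nat -> E -> E) (h : R) (i : nat) (p : E) : E :=
  if i is i'.+1 then shear_steps A h i' p + h *: A i' (shear_steps A h i' p) else p.

Lemma smooth_shear_steps A h i : (forall i, smooth (A i)) -> smooth (shear_steps A h i).
Proof.
move=> sA; elim: i => [|i IH] /=; first exact: smooth_id.
apply: smooth_add => //; apply: smooth_mul; first exact: smooth_cst.
exact: smooth_comp.
Qed.

Definition split_field (m N : nat) (S : R) (u : nat -> E) (c : R -> nat -> E) (i : nat) : E -> E :=
  shear (u (i %% m)%N) (c (S / N%:R * (i %/ m)%:R) (i %% m)%N).

(** The abstract estimate in the space of k-jets: x, y, B and Y are the k-th tangent maps, at a
    given point, of the shear steps, of Psi and of the fields. The conclusion holds for every
    fraction t of the current step and every s in the corresponding interval, which leaves the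
    speed along each step free. The predicate P is a side condition on the shears to be kept. *)
Theorem splitting_approximation (P : E -> E -> Prop) (Psi : R * E -> E) (X : R -> E -> E) (S : R) :
  0 < S -> smooth Psi -> (forall p, Psi (0, p) = p) ->
  (forall s p, 0 <= s <= S -> 'D_(1, 0) Psi (s, p) = X s (Psi (s, p))) ->
  (forall k, tame true k setT (fun s : {s : R | 0 <= s <= S} => X (sval s))) ->
  (forall k (B e : R), 0 < e -> exists m (u : nat -> E) (c : R -> nat -> E) (C : R),
    [/\ (0 < m)%N, forall s j, 0 <= s <= S -> `|c s j| <= C,
        forall s j, 0 <= s <= S -> P (u j) (c s j) &
        forall s (z : TE k E), 0 <= s <= S -> `|z| <= B ->
          `|itang (fun p => \sum_(j < m) shear (u j) (c s j) p) z - itang (X s) z| <= e]) ->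
  forall k (B e : R), 0 < e -> exists N m (u : nat -> E) (c : R -> nat -> E),
    [/\ (0 < N)%N, (0 < m)%N, forall s j, 0 <= s <= S -> P (u j) (c s j) &
     let h := S / N%:R in let A := split_field m N S u c in
     forall i t s (z : TE k E), (i < N * m)%N -> 0 <= t <= h ->
       h / m%:R * i%:R <= s <= h / m%:R * i.+1%:R -> `|z| <= B ->
       `|itang (fun p => shear_steps A h i p + t *: A i (shear_steps A h i p)) z
         - itang (fun p => Psi (s, p)) z| <= e].
Proof.
move=> S0 sPsi Psi0 dPsi tX apX k B e0' e0'0.
set e := Num.min e0' 1.
have e_0 : 0 < e by rewrite lt_min e0'0 ltr01.
have e1 : e <= 1 by rewrite ge_min lexx orbT.
have ee0 : e <= e0' by rewrite ge_min lexx.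
pose J := {s : R | 0 <= s <= S}.
have tPsi (G : R * E -> E) : smooth G ->
    tame true k setT (fun (s : J) p => G (sval s, p)).
  move=> sG.
  have t1 : tame true k setT (fun _ : J => G).
    apply: proper_tame; last exact: sG.
    exact: proper_pair (@proper_real R) (@proper_rV 2).
  apply: (@tame_compT _ _ _ _ _ _ _ _ (fun _ => G) (fun (s : J) (p : E) => (sval s, p))) => //.
  apply: tame_pair => //; last exact: tame_id.
  apply: (@tame_cst _ _ _ _ _ _ _ (fun s : J => sval s)) => _; exists S => -[s /= /andP[s0 sS]].
  by rewrite ger0_norm.
have [rho hrho] := itang_bound (tPsi _ sPsi) B.
have [D hD] := itang_bound (tPsi _ (smooth_derive (V := (R * E)%type) (1, 0) sPsi)) B.
have [L L0 hL] := itang_lip (tX k.+1) (rho + 1).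
have [C' hC'] := itang_bound (tame_Taylor_rem k S (@proper_rV 2) sPsi) B.
set q := expR (L * S) * S.
have q0 : 0 < q by rewrite mulr_gt0 ?expR_gt0.
set eta := e / 4 / q.
have eta0 : 0 < eta by rewrite !divr_gt0.
have [m [u [c [C [m0 cC cP hm]]]]] := apX k (rho + 1) eta eta0.
set U := \big[Num.max/0]_(j < m) `|u j|.
have [b0 hb0] := itang_bound (tame_shear k U C) (rho + 1).
have [la la0 hla] := itang_lip (tame_shear k.+1 U C) (rho + 1).
set b := `|b0|.
set Cp := `|C'|.
(* K collects the factors of h in all the errors: the step will satisfy h K <= e / 4 *)
set K := q * (Cp + la * b * m%:R ^+ 2) + m%:R * b + `|D| + Cp + 1.
have Cp0 : 0 <= Cp by exact: normr_ge0.
have b_0 : 0 <= b by exact: normr_ge0.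
have a1 : 0 <= q * (Cp + la * b * m%:R ^+ 2).
  by rewrite mulr_ge0 ?(ltW q0) // addr_ge0 // !mulr_ge0 // exprn_ge0.
have a2 : 0 <= m%:R * b :> R by rewrite mulr_ge0.
have K1 : 1 <= K.
  have a3 := normr_ge0 D.
  rewrite /K; lra.
have K0 : 0 < K by rewrite (lt_le_trans ltr01).
set N := Num.bound (S * (4 * K / e)).
have SK0 : 0 < S * (4 * K / e) by rewrite mulr_gt0 // divr_gt0 // mulr_gt0.
have NS : S * (4 * K / e) < N%:R by apply: archi_boundP; exact: ltW.
have N0 : 0 < N%:R :> R by rewrite (lt_trans SK0).
set h := S / N%:R.
have h0 : 0 < h by rewrite divr_gt0.
have hK : h * K <= e / 4.
  rewrite /h mulrAC ler_pdivrMr // mulrAC ler_pdivlMr //.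
  rewrite mulrA ltr_pdivrMr // in NS.
  by move: NS; rewrite (mulrC e); lra.
have h1 : h <= 1.
  rewrite -(ler_pM2r K0) mul1r (le_trans hK) // (le_trans _ K1) //.
  by rewrite ler_pdivrMr // mul1r (le_trans e1) // ler1n.
exists N, m, u, c; split => //.
move=> /= i t s z iNm th hs zB.
rewrite -/h in th *; set A := split_field m N S u c.
apply: le_trans ee0.
have N0' : (0 < N)%N by move: N0; rewrite ltr0n.
have sk_in (l : nat) : (l <= N)%N -> 0 <= h * l%:R <= S.
  move=> lN; rewrite mulr_ge0 ?(ltW h0) //=.
  by rewrite /h mulrAC ler_pdivrMr // ler_wpM2l ?(ltW S0) // ler_nat.
have uU j : `|u (j %% m)%N| <= U.
  exact: (le_bigmax _ (fun j : 'I_m => `|u j|) (Ordinal (ltn_pmod j m0))).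
have ikN (l : nat) : (l < N * m)%N -> (l %/ m < N)%N by move=> lNm; rewrite ltn_divLR.
have Ain l : (l < N * m)%N -> `|u (l %% m)%N| <= U /\ `|c (h * (l %/ m)%:R) (l %% m)%N| <= C.
  by move=> /ikN lN; split; [exact: uU|apply/cC/sk_in/ltnW].
have sA l : smooth (A l) by exact: smooth_shear.
have sSt l : smooth (shear_steps A h l) by exact: smooth_shear_steps.
have sX l : (l <= N)%N -> Ck k setT (X (h * l%:R)).
  move=> lN; apply: (@tame_weak _ true).
  exact: (tame_reindex (fun _ : unit => (exist _ (h * l%:R) (sk_in l lN) : J)) (tX k)).
have sPs s' : smooth (fun p => Psi (s', p)).
  by apply: smooth_comp => //; apply: smooth_pair; [exact: smooth_cst|exact: smooth_id].
pose x l := itang (k := k) (shear_steps A h l) z.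
pose y (l : nat) := itang (k := k) (fun p => Psi (h * l%:R, p)) z.
pose Bf l := itang (k := k) (A l).
pose Y (l : nat) := itang (k := k) (X (h * l%:R)).
have step (l : nat) (a : R) : itang (fun p => shear_steps A h l p + a *: A l (shear_steps A h l p)) z
    = x l + a *: Bf l (x l).
  rewrite itang_axpy; [|exact: sSt|exact: (smooth_comp (sA l) (sSt l))].
  by rewrite (@itang_comp _ _ _ _ _ (A l) (shear_steps A h l)) //; [exact: sA|exact: sSt].
have inc (s' a : R) : 0 <= s' <= S -> 0 < a <= 1 ->
    `|itang (k := k) (fun p => Psi (s' + a, p)) z - itang (fun p => Psi (s', p)) z
      - a *: itang (fun p => 'D_(1, 0) Psi (s', p)) z| <= Cp * a ^+ 2.
  move=> s'S a01; have /andP[a0 _] := a01.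
  have := hC' (exist _ (s', a) (conj s'S a01)) z zB; set Q := itang _ z => hQ.
  have sD : smooth (fun p => 'D_(1, 0) Psi (s', p)).
    apply: (smooth_comp (smooth_derive (V := (R * E)%type) (1, 0) sPsi)).
    by apply: smooth_pair; [exact: smooth_cst|exact: smooth_id].
  have sR : smooth (Taylor_rem Psi (s', a)).
    apply: smooth_mul; first exact: smooth_cst.
    apply: smooth_add.
      by apply: smooth_add; [exact: sPs|apply: smooth_opp; exact: sPs].
    by apply: smooth_opp; apply: smooth_mul; [exact: smooth_cst|].
  have E1 : itang (k := k) (fun p => Psi (s' + a, p)) z =
      itang (fun p => Psi (s', p)) z + a *: itang (fun p => 'D_(1, 0) Psi (s', p)) z + a ^+ 2 *: Q.
    rewrite -itang_axpy; [|exact: sPs|exact: sD].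
    rewrite -itang_axpy; [|apply: smooth_add; [exact: sPs|apply: smooth_mul; [exact: smooth_cst|exact: sD]]|exact: sR].
    congr (itang _ z); apply/funext => p; rewrite /Taylor_rem /= scalerA divff ?scale1r ?expf_neq0 ?gt_eqF //.
    by rewrite -[_ - _ - _]addrA -opprD [RHS]addrC subrK.
  rewrite E1 [X in `|X - _ - _|]addrC; set w1 := itang _ z; set w2 := a *: _.
  rewrite -addrA -opprD addrK.
  rewrite normrZ ger0_norm ?exprn_ge0 ?(ltW a0) // mulrC ler_wpM2r ?exprn_ge0 ?(ltW a0) //.
  by rewrite (le_trans hQ) // ler_norm.
have DX s' : 0 <= s' <= S -> `|itang (k := k) (fun p => 'D_(1, 0) Psi (s', p)) z| <= `|D|.
  by move=> s'S; rewrite (le_trans (hD (exist _ s' s'S) z zB)) // ler_norm.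
have kN := ikN _ iNm; have jm := ltn_pmod i m0.
have iE : (i %/ m * m + i %% m)%N = i by rewrite -divn_eq.
have hq : (1 + L * h) ^+ N * (N%:R * h) <= q.
  have hN : N%:R * h = S by rewrite mulrC /h divfK // gt_eqF.
  have LS : L * S = N%:R * (L * h) by rewrite -hN mulrCA.
  rewrite hN /q ler_wpM2r ?(ltW S0) // LS expRM_natl lerXn2r ?nnegrE ?expR_ge0 //.
    by rewrite addr_ge0 // mulr_ge0 // ltW.
  exact: expR_ge1Dx.
have err : splitting_error m h b la L eta Cp N + m%:R * (h * b) <= e / 2.
  set kap := eta + (Cp + la * b * m%:R ^+ 2) * h.
  have kap0 : 0 <= kap.
    by rewrite addr_ge0 ?(ltW eta0) // mulr_ge0 ?(ltW h0) // addr_ge0 // !mulr_ge0 // exprn_ge0.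
  have e1' : splitting_error m h b la L eta Cp N <= q * kap.
    rewrite /splitting_error -/kap.
    have -> : (1 + L * h) ^+ N * (N%:R * (h * kap)) = (1 + L * h) ^+ N * (N%:R * h) * kap.
      by rewrite !mulrA.
    by rewrite ler_wpM2r.
  have qe : q * eta = e / 4 by rewrite /eta mulrC divfK // gt_eqF.
  have hD0 : 0 <= h * (`|D| + Cp + 1) by rewrite mulr_ge0 ?(ltW h0) // !addr_ge0.
  move: e1' hK hD0; rewrite /kap mulrDr qe /K.
  set QQ := Cp + _; lra.
have k0S := sk_in _ (ltnW kN).
have i1 : s - h * (i %/ m)%:R <= h.
  have : h / m%:R * i.+1%:R <= h * (i %/ m)%:R + h.
    have -> : h * (i %/ m)%:R + h = h * (i %/ m).+1%:R by rewrite -natr1 mulrDr mulr1.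
    rewrite mulrAC ler_pdivrMr ?ltr0n //.
    rewrite -[_ * m%:R]mulrA ler_wpM2l ?(ltW h0) //.
    by rewrite -natrM ler_nat -{1}iE mulSn -addnS addnC leq_add2r.
  by case/andP: hs => _ s2 /(le_trans s2); rewrite lerBlDl.
have i0 : 0 <= s - h * (i %/ m)%:R.
  have : h * (i %/ m)%:R <= h / m%:R * i%:R.
    rewrite [h / m%:R * _]mulrAC ler_pdivlMr ?ltr0n // -[_ * m%:R]mulrA ler_wpM2l ?(ltW h0) //.
    by rewrite -natrM ler_nat -{2}iE leq_addr.
  by case/andP: hs => s1 _ /le_trans /(_ s1); rewrite subr_ge0.
have E2 : `|itang (k := k) (fun p => Psi (s, p)) z - y (i %/ m)%N| <= e / 2.
  move: i0; rewrite le_eqVlt => /orP[/eqP s0|a0].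
    have -> : s = h * (i %/ m)%:R by move: s0; lra.
    by rewrite subrr normr0 divr_ge0 // ltW.
  set a := s - _ in a0 i1; have sE : s = h * (i %/ m)%:R + a by rewrite /a addrC subrK.
  have a01 : 0 < a <= 1 by rewrite a0 (le_trans i1).
  have := inc _ _ k0S a01; rewrite -sE; set w := itang _ z => hw.
  rewrite -[w - _](subrK (a *: itang (fun p => 'D_(1, 0) Psi (h * (i %/ m)%:R, p)) z)).
  rewrite (le_trans (ler_normD _ _)) // (le_trans (lerD hw (lexx _))) //.
  have n1 : `|a *: itang (k := k) (fun p => 'D_(1, 0) Psi (h * (i %/ m)%:R, p)) z| <= h * `|D|.
    rewrite normrZ gtr0_norm // ler_pM ?(ltW a0) //; exact: DX.
  have n2 : Cp * a ^+ 2 <= h * Cp.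
    rewrite mulrC ler_wpM2r // expr2 -[leRHS]mulr1 ler_pM ?(ltW a0) //.
    by case/andP: a01.
  have n3 : h * `|D| + h * Cp <= h * K.
    rewrite -mulrDr ler_wpM2l ?(ltW h0) // /K.
    lra.
  move: n1 n2 n3 hK e_0; lra.
have E1 : `|x i + t *: Bf i (x i) - y (i %/ m)%N| <= e / 2.
  apply: (le_trans _ err); rewrite -{1 2 3}iE.
  apply: (@splitting_substep _ _ x y Bf Y N m h b la L eta Cp rho) => //.
  - exact: ltW.
  - rewrite /x /y /= mulr0; congr (itang _ z); apply/funext => p; rewrite Psi0 //.
  - by move=> l lN; rewrite {1}/x /= step.
  - move=> l lN.
    have := inc (h * l%:R) h (sk_in _ (ltnW lN)) _; rewrite h0 h1 => /(_ isT).
    rewrite /y /Y -[l.+1%:R]natr1 mulrDr mulr1 => hi.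
    rewrite -itang_comp //; [|exact/sX/ltnW|exact: sPs].
    apply: le_trans hi; apply: le_of_eq.
    congr (`| _ - _ *: itang _ z|); apply/funext => p /=.
    by rewrite dPsi // sk_in // ltnW.
  - by move=> l lN; have := hrho (exist _ (h * l%:R) (sk_in l lN) : J) z zB.
  - move=> l w lN wB; rewrite (le_trans _ (ler_norm b0)) //.
    exact: (hb0 (exist _ (_, _) (Ain l lN)) w wB).
  - move=> l w w' lN wB w'B; exact: (hla (exist _ (_, _) (Ain l lN)) w w' wB w'B).
  - by move=> l w w' lN wB w'B; have := hL (exist _ (h * l%:R) (sk_in l (ltnW lN)) : J) w w' wB w'B.
  - move=> l w lN wB.
    have := hm _ w (sk_in _ (ltnW lN)) wB.
    rewrite itang_sum; last by move=> j0; exact: smooth_shear.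
    apply: le_trans; apply: le_of_eq; congr (`|_ - _|).
    apply: eq_bigr => j0 _; rewrite /Bf /A /split_field modnMDl modn_small // divnMDl //.
    by rewrite divn_small // addn0.
  - apply: (le_trans err); rewrite ler_pdivrMr // mul1r (le_trans e1) //.
    by rewrite ler1n.
rewrite step.
rewrite -(subrKA (y (i %/ m)%N)) (le_trans (ler_normD _ _)) //.
by rewrite [leRHS](splitr e) lerD // distrC.
Qed.

End PlaneSplitting.

(** * The average over the torus *)

Section TorusMean.
Variable R : realType.
Local Notation E := 'rV[R]_2.

Definition lattice_periodic W (f : E -> W) := forall p l, l \in lattice R -> f (p + l) = f p.

Lemma twopi_gt0 : 0 < 2 * pi :> R. Proof. by rewrite mulr_gt0 // pi_gt0. Qed.
Local Hint Resolve twopi_gt0 : core.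

Lemma latticeP (l : E) : reflect (exists k : 'I_2 -> int, forall i, l 0 i = 2 * pi * (k i)%:~R)
  (l \in lattice R).
Proof.
apply: (iffP forallP) => [h|[k hk] i]; last first.
  by rewrite hk mulrAC divff ?gt_eqF // mul1r intr_int.
exists (fun i => Num.floor (l 0 i / (2 * pi))) => i.
by rewrite floorK // mulrC divfK // gt_eqF.
Qed.

Lemma lattice_reduce (y : E) : exists2 l, l \in lattice R & forall i, - pi <= (y - l) 0 i < pi.
Proof.
pose k i := Num.floor ((y 0 i + pi) / (2 * pi)).
exists (\row_i (2 * pi * (k i)%:~R)); first by apply/latticeP; exists k => i; rewrite mxE.
move=> i; rewrite !mxE.
have /andP[] := floor_itv ((y 0 i + pi) / (2 * pi)); rewrite -/(k i).
rewrite ler_pdivlMr // ltr_pdivrMr // intrD mulrDl mul1r [(k i)%:~R * _]mulrC.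
move=> h1 h2; apply/andP; split; lra.
Qed.

Lemma lattice_reduce_norm (y : E) : exists2 l, l \in lattice R & `|y - l| <= pi.
Proof.
have [l ll h] := lattice_reduce y; exists l => //; apply: norm_rV_le; first exact: pi_ge0.
by move=> i; have /andP[h1 h2] := h i; rewrite ler_norml; apply/andP; split; [exact: h1|exact: ltW h2].
Qed.

Lemma periodic_sub W (f : E -> W) p l : lattice_periodic f -> l \in lattice R -> f (p - l) = f p.
Proof. by move=> pf ll; have := pf (p - l) l ll; rewrite subrK => ->. Qed.

Lemma periodic_bounded (W : normedModType R) (f : E -> W) : lattice_periodic f -> smooth f ->
  exists C : R, forall x, `|f x| <= C.
Proof.
move=> pf sf; have [C hC] := compact_bound (@proper_rV R 2 pi) (fun x => smooth_diff x sf).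
exists C => x; have [l ll h] := lattice_reduce_norm x.
by rewrite -(periodic_sub x pf ll); exact: hC.
Qed.

Lemma periodic_derive (W : normedModType R) (f : E -> W) v : lattice_periodic f -> lattice_periodic ('D_v f).
Proof.
move=> pf p l ll; have fE : f \o (fun x => x + l) = f by apply/funext => x /=; rewrite pf.
rewrite -[in RHS]fE (@derive_line _ _ _ _ f (fun x => x + l) p v v) //.
by move=> h; rewrite addrA.
Qed.

Definition nodes n := 'rV['I_n.+1]_2.
Definition freq n (a : nodes n) : E := \row_i (a 0 i)%:R.
Definition grid n (a : nodes n) : E := (2 * pi / n.+1%:R) *: freq a.
Definition grid_mean n (f : E -> R) : R := #|{: nodes n}|%:R^-1 * \sum_(a : nodes n) f (grid a).

Lemma card_nodes_gt0 n : 0 < #|{: nodes n}|%:R :> R.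
Proof. by rewrite ltr0n; apply/card_gt0P; exists 0. Qed.
Local Hint Resolve card_nodes_gt0 : core.

Lemma grid_mod n (d : E) (a b : nodes n) (k q : 'I_2 -> int) :
  (forall i, d 0 i = 2 * pi / n.+1%:R * (k i)%:~R) ->
  (forall i, (k i + (a 0 i)%:Z - (b 0 i)%:Z)%R = q i * n.+1%:Z) ->
  d + grid a - grid b \in lattice R.
Proof.
move=> hd hk; apply/latticeP; exists q => i.
rewrite !mxE hd -mulrDr -mulrBr.
have /(congr1 (fun z : int => z%:~R : R)) := hk i.
rewrite intrM !(intrD, rmorphB, rmorphN) /= => ->.
by rewrite [_ * n.+1%:~R]mulrC mulrA divfK // pnatr_eq0.
Qed.

(** The translation by one grid step permutes the nodes modulo the lattice. *)
Lemma grid_mean_shift n (f : E -> R) j : lattice_periodic f ->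
  grid_mean n (fun y => f (y + (2 * pi / n.+1%:R) *: delta_mx 0 j)) = grid_mean n f.
Proof.
move=> pf; rewrite /grid_mean; congr (_ * _).
pose e : nodes n := \row_i (if i == j then inZp 1 else 0).
rewrite [RHS](reindex (fun a : nodes n => a + e)) /=; last first.
  by exists (fun a => a - e) => a _; rewrite ?addrK ?subrK.
apply: eq_bigr => a _.
rewrite -[in RHS](pf _ ((2 * pi / n.+1%:R) *: delta_mx 0 j + grid a - grid (a + e))).
  by congr f; rewrite [grid (a + e) + _]addrC subrK addrC.
apply: (@grid_mod _ _ _ _ (fun i => Posz (i == j)) (fun i => Posz (((i == j) + a 0 i) %/ n.+1))) => i.
  by rewrite !mxE eqxx /=; case: (i == j).
have -> : nat_of_ord ((a + e)%R 0%R i) = (((i == j) + a 0%R i) %% n.+1)%N.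
  by rewrite !mxE; case: (i == j) => /=; rewrite ?modnDmr ?addn0 // addnC.
have := divn_eq ((i == j) + a 0 i) n.+1.
set x := (_ %/ _)%N; set y := (_ %% _)%N; case: (i == j) => /=; lia.
Qed.

Lemma grid_mean_opp n (f : E -> R) : lattice_periodic f ->
  grid_mean n (fun y => f (- y)) = grid_mean n f.
Proof.
move=> pf; rewrite /grid_mean; congr (_ * _).
rewrite [RHS](reindex_inj oppr_inj) /=; apply: eq_bigr => a _.
rewrite -[LHS](pf _ (grid a + grid (- a) - grid (0 : nodes n))).
  by congr f; rewrite -addrA addKr /grid [freq 0](_ : _ = 0) ?scaler0 ?subr0 //; apply/rowP => i; rewrite !mxE.
apply: (@grid_mod _ _ _ _ (fun i => Posz (a 0 i)) (fun i => Posz ((a 0 i + (n.+1 - a 0 i) %% n.+1) %/ n.+1))) => i.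
  by rewrite !mxE.
have -> : nat_of_ord ((- a)%R 0%R i) = ((n.+1 - a 0%R i) %% n.+1)%N by rewrite !mxE.
have -> : nat_of_ord ((0%R : nodes n) 0%R i) = 0%N by rewrite !mxE.
have := ltn_ord (a 0 i); set x := nat_of_ord (a 0 i) => xn.
case: (posnP x) => [->|x0]; first by rewrite subn0 modnn div0n.
by rewrite (modn_small (m := n.+1 - x)) ?ltn_subrL ?x0 // subnKC ?divnn ?(ltnW xn) //; lia.
Qed.

Lemma grid_mean_le n (f g : E -> R) : (forall y, f y <= g y) -> grid_mean n f <= grid_mean n g.
Proof.
move=> fg; rewrite /grid_mean ler_wpM2l ?invr_ge0 ?(ltW (card_nodes_gt0 n)) //.
by apply: ler_sum.
Qed.

Lemma grid_mean_cst n (c : R) : grid_mean n (fun=> c) = c.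
Proof.
by rewrite /grid_mean sumr_const -[c *+ _]mulr_natr mulrCA mulVf ?mulr1 // gt_eqF.
Qed.

Lemma grid_mean_axpy n (a : R) (f g : E -> R) :
  grid_mean n (fun y => f y + a * g y) = grid_mean n f + a * grid_mean n g.
Proof.
by rewrite /grid_mean big_split /= mulrDr -mulr_sumr mulrCA.
Qed.

Lemma grid_mean_norm n (f : E -> R) C : (forall y, `|f y| <= C) -> `|grid_mean n f| <= C.
Proof.
move=> h; rewrite ler_norml -{1}(grid_mean_cst n C) -{2}(grid_mean_cst n C).
rewrite -mulN1r -[-1 * _]add0r -{1}(grid_mean_cst n 0) -grid_mean_axpy.
by apply/andP; split; apply: grid_mean_le => y; have := h y; rewrite ler_norml ?add0r ?mulN1r => /andP[].
Qed.

Definition ultra : set_system nat := sval (cid (ultraFilterLemma eventually_filter)).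

Lemma ultra_ultra : UltraFilter ultra. Proof. exact: (svalP (cid (ultraFilterLemma eventually_filter))).1. Qed.
Local Instance ultra_filter : ProperFilter ultra. Proof. exact: (@ultra_proper _ _ ultra_ultra). Qed.
Lemma ultra_eventually : eventually `<=` ultra.
Proof. exact: (svalP (cid (ultraFilterLemma eventually_filter))).2. Qed.

(** For the functions in use this is the integral over the torus divided by its area. The
    ultrafilter gives a limit to all bounded sequences. *)
Definition mean (f : E -> R) : R := lim (grid_mean n f @[n --> ultra]).

Definition bounded_map (f : E -> R) := exists C : R, forall y, `|f y| <= C.

Lemma mean_cvg f : bounded_map f -> grid_mean n f @[n --> ultra] --> mean f.
Proof.
move=> [C hC]; set F := (X in X --> _).
have FF : ProperFilter F by exact: fmap_proper_filter.
have FC : F `[- C, C]%classic.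
  by apply: (@filterE _ ultra) => n /=; have := grid_mean_norm n hC; rewrite in_itv /= ler_norml.
have [p [_ cp]] := @segment_compact R (- C) C F FF FC.
have Fp : F --> p.
  move=> V pV; have [//|nV] := in_ultra_setVsetC ((fun n => grid_mean n f) @^-1` V) ultra_ultra.
  by have [x [/= ]] := cp (~` V) V nV pV.
by rewrite /mean -/F (cvg_lim _ Fp).
Qed.

Lemma mean_unique f l : grid_mean n f @[n --> ultra] --> l -> mean f = l.
Proof. exact: cvg_lim. Qed.

Lemma bounded_map_cst c : bounded_map (fun=> c). Proof. by exists `|c|. Qed.
Lemma bounded_map_axpy a f g : bounded_map f -> bounded_map g -> bounded_map (fun y => f y + a * g y).
Proof.
move=> [C hC] [D hD]; exists (C + `|a| * D) => y.
by rewrite (le_trans (ler_normD _ _)) // lerD // normrM ler_wpM2l.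
Qed.
Lemma bounded_map_mul f g : bounded_map f -> bounded_map g -> bounded_map (fun y => f y * g y).
Proof.
move=> [C hC] [D hD]; exists (C * D) => y.
by rewrite normrM ler_pM.
Qed.
Lemma bounded_map_add f g : bounded_map f -> bounded_map g -> bounded_map (fun y => f y + g y).
Proof.
move=> [C hC] [D hD]; exists (C + D) => y.
by rewrite (le_trans (ler_normD _ _)) // lerD.
Qed.
Lemma bounded_map_sum (J : Type) (r : seq J) (F : J -> E -> R) : (forall j, bounded_map (F j)) ->
  bounded_map (fun y => \sum_(j <- r) F j y).
Proof.
move=> bF; elim: r => [|j r IH].
  by exists 0 => y; rewrite big_nil normr0.
by have [C hC] := bounded_map_add (bF j) IH; exists C => y; rewrite big_cons.
Qed.
Lemma bounded_map_cos (u : E -> R) : bounded_map (fun y => cos (u y)).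
Proof. by exists 1 => y; exact: cos_max. Qed.
Lemma bounded_map_sin (u : E -> R) : bounded_map (fun y => sin (u y)).
Proof. by exists 1 => y; exact: sin_max. Qed.

Lemma mean_axpy a f g : bounded_map f -> bounded_map g ->
  mean (fun y => f y + a * g y) = mean f + a * mean g.
Proof.
move=> bf bg; apply: mean_unique; under eq_fun do rewrite grid_mean_axpy.
by apply: cvgD; [exact: mean_cvg|apply: cvgM; [exact: cvg_cst|exact: mean_cvg]].
Qed.

Lemma mean_cst c : mean (fun=> c) = c.
Proof. by apply: mean_unique; under eq_fun do rewrite grid_mean_cst; exact: cvg_cst. Qed.

Lemma mean_scale a f : bounded_map f -> mean (fun y => a * f y) = a * mean f.
Proof.
move=> bf; have := mean_axpy a (bounded_map_cst 0) bf; rewrite mean_cst add0r => <-.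
by congr mean; apply/funext => y; rewrite add0r.
Qed.

Lemma mean_add f g : bounded_map f -> bounded_map g -> mean (fun y => f y + g y) = mean f + mean g.
Proof.
move=> bf bg; have := mean_axpy 1 bf bg; rewrite mul1r => <-.
by congr mean; apply/funext => y; rewrite mul1r.
Qed.

Lemma mean_sum (J : Type) (r : seq J) (F : J -> E -> R) : (forall j, bounded_map (F j)) ->
  mean (fun y => \sum_(j <- r) F j y) = \sum_(j <- r) mean (F j).
Proof.
move=> bF; elim: r => [|j r IH].
  by rewrite big_nil -[RHS](mean_cst 0); congr mean; apply/funext => y; rewrite big_nil.
rewrite big_cons -IH -mean_add //; last exact: bounded_map_sum.
by congr mean; apply/funext => y; rewrite big_cons.
Qed.

Lemma mean_norm_near f e : bounded_map f -> (\forall n \near \oo, `|grid_mean n f| <= e) -> `|mean f| <= e.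
Proof.
move=> bf /ultra_eventually h; have cf := mean_cvg bf.
have cvf : cvg (grid_mean n f @[n --> ultra]) by apply/cvg_ex; exists (mean f).
rewrite ler_norml; apply/andP; split.
  by apply: limr_ge => //; apply: filterS h => n; rewrite ler_norml => /andP[].
by apply: limr_le => //; apply: filterS h => n; rewrite ler_norml => /andP[].
Qed.

Lemma mean_le f g : bounded_map f -> bounded_map g -> (forall y, f y <= g y) -> mean f <= mean g.
Proof.
move=> bf bg fg; apply: ler_lim.
- by apply/cvg_ex; exists (mean f); exact: mean_cvg.
- by apply/cvg_ex; exists (mean g); exact: mean_cvg.
- by apply: filterE => n; exact: grid_mean_le.
Qed.

Lemma mean_norm_le f g : bounded_map f -> bounded_map g -> (forall y, `|f y| <= g y) -> `|mean f| <= mean g.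
Proof.
move=> bf bg fg; rewrite ler_norml; apply/andP; split; last first.
  by apply: mean_le => // y; rewrite (le_trans (ler_norm _)).
rewrite -mulN1r -mean_scale //; apply: mean_le => //.
  by have := bounded_map_mul (bounded_map_cst (-1)) bg.
by move=> y; rewrite mulN1r; have := fg y; rewrite ler_norml => /andP[].
Qed.

(** Node by node, the grids are invariant under y |-> - y modulo the lattice. *)
Lemma mean_odd f : lattice_periodic f -> (forall y, f (- y) = - f y) -> mean f = 0.
Proof.
move=> pf of_; apply: mean_unique.
rewrite (_ : (fun n => grid_mean n f) = fun=> 0); first exact: cvg_cst.
apply/funext => n; have := grid_mean_opp n pf.
rewrite (_ : (fun y => f (- y)) = fun y => 0 + (-1) * f y); last first.
  by apply/funext => y; rewrite of_ add0r mulN1r.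
rewrite grid_mean_axpy grid_mean_cst add0r mulN1r => h.
by move: h; lra.
Qed.

(** For the grid step s, the increment f (y + s e) - f y has grid mean 0, and it differs from
    s D_e f y by O(s^2). *)
Lemma mean_derive f j : lattice_periodic f -> smooth f -> mean ('D_(delta_mx 0 j) f) = 0.
Proof.
move=> pf sf; set e := delta_mx 0 j.
have sDf : smooth ('D_e f) by exact: smooth_derive.
have bDf : bounded_map ('D_e f) by apply: periodic_bounded => //; exact: periodic_derive.
have bf : bounded_map f by exact: periodic_bounded.
have [C hC] := periodic_bounded (periodic_derive e (periodic_derive e pf)) (smooth_derive e sDf).
apply/eqP; rewrite -normr_le0; apply/ler_addgt0Pr => d d0; rewrite add0r.
apply: mean_norm_near => //.
have C0 : 0 <= C by apply: le_trans (hC 0).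
exists (Num.bound (2 * pi * C / d)) => //= n /= bn.
set s : R := 2 * pi / n.+1%:R.
have s0 : 0 < s by rewrite divr_gt0.
have key : `|grid_mean n ('D_e f)| <= C * s.
  rewrite -(ler_pM2l s0) -{1}(gtr0_norm s0) -normrM.
  have -> : s * grid_mean n ('D_e f) = - grid_mean n (fun y => (f (y + s *: e) + (-1) * f y) + (- s) * 'D_e f y).
    by rewrite !grid_mean_axpy grid_mean_shift // mulN1r subrr add0r mulNr opprK.
  rewrite normrN; apply: le_trans (@grid_mean_norm _ _ (C * s ^+ 2) _) _; last first.
    by rewrite expr2 mulrCA.
  by move=> y; rewrite mulN1r mulNr addrC [y + _]addrC addrC; apply: line_Taylor => [//|t _|]; [exact: hC|exact: ltW].
rewrite (le_trans key) //.
have q0 : 0 <= 2 * pi * C / d by rewrite divr_ge0 ?(ltW d0) // mulr_ge0 // ltW.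
have -> : C * s = 2 * pi * C / n.+1%:R by rewrite /s mulrA (mulrC C).
rewrite ler_pdivrMr ?ltr0n // -ler_pdivrMl // [d^-1 * _]mulrC.
have := archi_boundP q0 => /ltW /le_trans; apply.
by rewrite ler_nat leqW.
Qed.

End TorusMean.

(** * Fejer smoothing *)

Section Fejer.
Variable R : realType.
Local Notation E := 'rV[R]_2.
Local Notation basis j := (delta_mx 0 j : E).

Lemma dotC (u v : E) : dot u v = dot v u.
Proof. by apply: eq_bigr => i _; rewrite mulrC. Qed.
Lemma dotDr (u x y : E) : dot u (x + y) = dot u x + dot u y.
Proof. by have := dot_linear u 1 x y; rewrite !scale1r. Qed.
Lemma dotNr (u x : E) : dot u (- x) = - dot u x.
Proof. by rewrite /dot -sumrN; apply: eq_bigr => i _; rewrite mxE mulrN. Qed.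
Lemma dotDl (u v x : E) : dot (u + v) x = dot u x + dot v x.
Proof. by rewrite dotC dotDr !(dotC x). Qed.
Lemma dotNl (u x : E) : dot (- u) x = - dot u x.
Proof. by rewrite dotC dotNr dotC. Qed.
Lemma dot0l (x : E) : dot 0 x = 0.
Proof. by rewrite /dot big1 // => i _; rewrite mxE mul0r. Qed.
Lemma dot_basis (u : E) j : dot u (basis j) = u 0 j.
Proof.
rewrite /dot (bigD1 j) //= mxE !eqxx mulr1 big1 ?addr0 // => i ij.
by rewrite mxE (negPf ij) andbF mulr0.
Qed.

Lemma smooth_dot (u : E) : smooth (dot u).
Proof. exact: smooth_lin (dot_linear u) (dot_le u). Qed.

Lemma derive_dot (u : E) v x : 'D_v (dot u) x = dot u v.
Proof. exact: (blin_diff x (dot_linear u) (dot_le u)).2. Qed.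

Lemma derive_comp1 (g : R -> R) (F : E -> R) v x : differentiable F x -> derivable g (F x) 1 ->
  'D_v (g \o F) x = 'D_v F x * 'D_1 g (F x).
Proof.
move=> dF dg; have dg' : differentiable g (F x) by apply/derivable1_diffP.
rewrite deriveE; last exact: differentiable_comp.
rewrite diff_comp //= -(deriveE _ dF) [X in _ = _ * X]deriveE //.
by rewrite -[X in 'd g _ X = _]mulr1 -[_ * 1]/(_ *: (1 : R)) linearZ.
Qed.

Lemma derive_cos_dot (u : E) v x : 'D_v (fun x => cos (dot u x)) x = - (dot u v * sin (dot u x)).
Proof.
rewrite (@derive_comp1 cos (dot u)) ?derive_dot; first by rewrite derive_val mulrN.
  exact: smooth_diff (smooth_dot u).
exact: derivable_cos.
Qed.

Lemma derive_sin_dot (u : E) v x : 'D_v (fun x => sin (dot u x)) x = dot u v * cos (dot u x).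
Proof.
rewrite (@derive_comp1 sin (dot u)) ?derive_dot; first by rewrite derive_val.
  exact: smooth_diff (smooth_dot u).
exact: derivable_sin.
Qed.

Lemma smooth_cos_dot (u : E) : smooth (fun x => cos (dot u x)).
Proof. by apply: smooth_comp; [exact: smooth_cos|exact: smooth_dot]. Qed.
Lemma smooth_sin_dot (u : E) : smooth (fun x => sin (dot u x)).
Proof. by apply: smooth_comp; [exact: smooth_sin|exact: smooth_dot]. Qed.

Lemma trig_int (x : R) (k : int) : sin (x + 2 * pi * k%:~R) = sin x /\ cos (x + 2 * pi * k%:~R) = cos x.
Proof.
have pos (y : R) (n : nat) : sin (y + 2 * pi * n%:R) = sin y /\ cos (y + 2 * pi * n%:R) = cos y.
  rewrite (_ : 2 * pi * n%:R = (pi *+ 2) *+ n); last by rewrite mulr_natr mulr_natl.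
  by rewrite (periodicn (@sinD2pi R)) (periodicn (@cosD2pi R)).
case: k => n; first exact: pos.
rewrite NegzE mulrNz mulrN -pmulrn.
by have [h1 h2] := pos (x - 2 * pi * n.+1%:R) n.+1; rewrite -h1 -h2 subrK.
Qed.

Lemma dot_int_lattice (w : 'rV[int]_2) (l : E) : l \in lattice R ->
  exists k : int, dot (of_int R w) l = 2 * pi * k%:~R.
Proof.
move=> /latticeP[k hk]; exists (\sum_i w 0 i * k i).
rewrite rmorph_sum mulr_sumr /=; apply: eq_bigr => i _.
by rewrite mxE hk intrM mulrCA.
Qed.

Lemma periodic_trig_dot (w : 'rV[int]_2) : lattice_periodic (fun x => sin (dot (of_int R w) x)) /\
  lattice_periodic (fun x => cos (dot (of_int R w) x)).
Proof.
by split=> p l /(dot_int_lattice w)[k hk]; rewrite dotDr hk; have [] := trig_int (dot (of_int R w) p) k.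
Qed.

(** If w j <> 0 then cos(w.y) is proportional to the derivative of sin(w.y) along basis j. *)
Lemma mean_trig (w : 'rV[int]_2) : mean (fun x => sin (dot (of_int R w) x)) = 0 /\
  mean (fun x => cos (dot (of_int R w) x)) = (w == 0)%:R.
Proof.
have [ps pc] := periodic_trig_dot w; split.
  by apply: mean_odd => // y; rewrite dotNr sinN.
case: eqP => [->|/eqP w0] /=.
  rewrite -[RHS](mean_cst 1); congr mean; apply/funext => y.
  by rewrite /of_int map_mx0 dot0l cos0.
have [j wj] : exists j, w 0 j != 0.
  apply/existsP; apply: contraR w0 => /existsPn h; apply/eqP/rowP => j.
  by rewrite mxE; apply/eqP; have := h j; rewrite negbK.
have := mean_derive j ps (smooth_sin_dot (of_int R w)).
rewrite (_ : 'D_(delta_mx 0 j) _ = fun x => (w 0 j)%:~R * cos (dot (of_int R w) x)); last first.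
  by apply/funext => x; rewrite derive_sin_dot dot_basis mxE.
rewrite mean_scale; last exact: bounded_map_cos.
by move/eqP; rewrite mulf_eq0 intr_eq0 (negPf wj) => /eqP.
Qed.

Definition pairs n := (nodes n * nodes n)%type.
Definition ifreq n (t : pairs n) : 'rV[int]_2 := \row_i ((t.1 0 i)%:Z - (t.2 0 i)%:Z).
Definition wave n (t : pairs n) : E := of_int R (ifreq t).

Lemma waveE n (t : pairs n) : wave t = freq R t.1 - freq R t.2.
Proof. by apply/rowP => i; rewrite !mxE rmorphB. Qed.

(** The squared modulus of the sum of exp(i a.z) over a in {0, ..., n}^2, divided by (n + 1)^2:
    the product of two Fejer kernels of one variable. *)
Definition fejer n (z : E) : R := #|{: nodes n}|%:R^-1 * \sum_(t : pairs n) cos (dot (wave t) z).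

(** The convolution with the Fejer kernel ([smoothingE]), in the form that displays its
    coefficients. *)
Definition smoothing n (f : E -> R) (x : E) : R :=
  #|{: nodes n}|%:R^-1 * \sum_(t : pairs n)
    (mean (fun y => f y * cos (dot (wave t) y)) * cos (dot (wave t) x) +
     mean (fun y => f y * sin (dot (wave t) y)) * sin (dot (wave t) x)).

Lemma fejer_bounded n (x : E) : bounded_map (fun y => fejer n (x - y)).
Proof.
rewrite /fejer; apply: (bounded_map_mul (@bounded_map_cst R _)).
by apply: bounded_map_sum => t; exact: bounded_map_cos.
Qed.

Lemma smoothingE n f x : bounded_map f -> smoothing n f x = mean (fun y => f y * fejer n (x - y)).
Proof.
move=> bf; rewrite /smoothing.
pose F (t : pairs n) y := cos (dot (wave t) x) * (f y * cos (dot (wave t) y)) +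
   sin (dot (wave t) x) * (f y * sin (dot (wave t) y)).
have bc (t : pairs n) : bounded_map (fun y => f y * cos (dot (wave t) y)) by exact: bounded_map_mul bf (bounded_map_cos _).
have bs (t : pairs n) : bounded_map (fun y => f y * sin (dot (wave t) y)) by exact: bounded_map_mul bf (bounded_map_sin _).
have bF (t : pairs n) : bounded_map (F t).
  by apply: bounded_map_add; [apply: (bounded_map_mul (@bounded_map_cst R (cos _)))|apply: (bounded_map_mul (@bounded_map_cst R (sin _)))].
transitivity (mean (fun y => #|{: nodes n}|%:R^-1 * \sum_(t : pairs n) F t y)); last first.
  congr mean; apply/funext => y; rewrite /fejer mulrCA; congr (_ * _).
  rewrite mulr_sumr; apply: eq_bigr => t _.
  by rewrite /F dotDr dotNr cosB; ring.
rewrite mean_scale; last exact: bounded_map_sum.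
rewrite mean_sum //; congr (_ * _); apply: eq_bigr => t _.
rewrite /F mean_add; [|exact: (bounded_map_mul (bounded_map_cst _) (bc t))|exact: (bounded_map_mul (bounded_map_cst _) (bs t))].
by rewrite !mean_scale // ![_ * mean _]mulrC.
Qed.

Lemma derive_sum_smooth (J : Type) (r : seq J) (F : J -> E -> R) v x : (forall j, smooth (F j)) ->
  'D_v (fun x => \sum_(j <- r) F j x) x = \sum_(j <- r) 'D_v (F j) x.
Proof.
move=> sF; elim: r => [|j r IH].
  rewrite big_nil (_ : (fun x => _) = fun=> 0) ?derive_cst //.
  by apply/funext => y; rewrite big_nil.
rewrite big_cons -IH -deriveD; [|exact/diff_derivable/smooth_diff|exact/diff_derivable/smooth_diff/smooth_sum].
by congr ('D_v _ x); apply/funext => y; rewrite big_cons.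
Qed.

Lemma derive_scale_smooth (F : E -> R) (a : R) v x : smooth F ->
  'D_v (fun x => a * F x) x = a * 'D_v F x.
Proof.
move=> sF; rewrite -[LHS]/('D_v (fun x => a *: F x) x) deriveZ //.
exact/diff_derivable/smooth_diff.
Qed.

(** Integration by parts: the derivative of f times a wave has mean 0. *)
Lemma mean_parts (f : E -> R) j (w : 'rV[int]_2) : lattice_periodic f -> smooth f ->
  mean (fun y => 'D_(basis j) f y * cos (dot (of_int R w) y)) =
    (w 0 j)%:~R * mean (fun y => f y * sin (dot (of_int R w) y)) /\
  mean (fun y => 'D_(basis j) f y * sin (dot (of_int R w) y)) =
    - (w 0 j)%:~R * mean (fun y => f y * cos (dot (of_int R w) y)).
Proof.
move=> pf sf; have [ps pc] := periodic_trig_dot w.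
have bf := periodic_bounded pf sf.
have bDf := periodic_bounded (periodic_derive (basis j) pf) (smooth_derive (basis j) sf).
have key (g g' : E -> R) (a : R) : lattice_periodic g -> smooth g -> bounded_map g -> bounded_map g' ->
   (forall y, 'D_(basis j) g y = a * g' y) ->
   mean (fun y => 'D_(basis j) f y * g y) = - a * mean (fun y => f y * g' y).
  move=> pg sg bg bg' Dg.
  have := @mean_derive _ (fun y => f y *: g y) j.
  rewrite (_ : 'D_(delta_mx 0 j) _ = fun y => 'D_(basis j) f y * g y + a * (f y * g' y)); last first.
    apply/funext => y; rewrite (@deriveM _ _ f g); try exact/diff_derivable/smooth_diff.
    rewrite Dg -[LHS]/(f y * (a * g' y) + g y * 'D_(basis j) f y); ring.
  rewrite mean_axpy; [|exact: bounded_map_mul bDf bg|exact: bounded_map_mul bf bg'].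
  move=> h; have {}h := h _ _; rewrite mulNr; apply/eqP; rewrite -addr_eq0 h //.
    by move=> p l ll; rewrite pf // pg.
  exact: smooth_mul.
split.
  rewrite (@key _ (fun y => sin (dot (of_int R w) y)) (- (w 0 j)%:~R)) ?opprK //.
  - exact: smooth_cos_dot.
  - exact: bounded_map_cos.
  - exact: bounded_map_sin.
  by move=> y; rewrite derive_cos_dot dot_basis mxE mulNr.
apply: key => //.
- exact: smooth_sin_dot.
- exact: bounded_map_sin.
- exact: bounded_map_cos.
by move=> y; rewrite derive_sin_dot dot_basis mxE.
Qed.

(** Therefore uniform approximation by smoothings passes to derivatives. *)
Lemma smoothing_derive n f j x : lattice_periodic f -> smooth f ->
  'D_(basis j) (smoothing n f) x = smoothing n ('D_(basis j) f) x.
Proof.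
move=> pf sf; rewrite /smoothing.
have sm (t : pairs n) (a b : R) : smooth (fun x => a * cos (dot (wave t) x) + b * sin (dot (wave t) x)).
  apply: smooth_add; apply: (smooth_mul (F := fun=> _)); try exact: smooth_cst.
    exact: smooth_cos_dot.
  exact: smooth_sin_dot.
rewrite derive_scale_smooth; last exact: smooth_sum.
rewrite derive_sum_smooth //; congr (_ * _); apply: eq_bigr => t _.
have [e1 e2] := mean_parts j (ifreq t) pf sf; rewrite /wave e1 e2.
set a := mean _; set b := mean _.
rewrite -[LHS]/('D_(basis j) ((fun x => a * cos (dot (wave t) x)) + (fun x => b * sin (dot (wave t) x))) x).
rewrite deriveD; try (apply: diff_derivable; apply: smooth_diff;
  apply: (smooth_mul (F := fun=> _)); first exact: smooth_cst); last first.
- exact: smooth_sin_dot.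
- exact: smooth_cos_dot.
rewrite !derive_scale_smooth; [|exact: smooth_sin_dot|exact: smooth_cos_dot].
rewrite derive_cos_dot derive_sin_dot dot_basis mxE.
by rewrite /wave; ring.
Qed.

End Fejer.

(** * Uniform approximation by Fejer smoothing *)

Section Korovkin.
Variable R : realType.
Local Notation E := 'rV[R]_2.
Local Notation basis j := (delta_mx 0 j : E).
Local Hint Resolve card_nodes_gt0 : core.

Lemma sin_lower : exists2 c : R, 0 < c & forall u : R, 0 <= u <= pi / 2 -> c * u <= sin u.
Proof.
have p0 := pi_gt0 R; have p2 := pi_ge2 R.
have q0 : 0 < pi / 4 :> R by rewrite divr_gt0.
have q1 : 0 < (pi / 4 : R) < pi / 2 by apply/andP; split=> //; lra.
have c0 : 0 < cos (pi / 4 : R) by apply: cos_gt0_pihalf; apply/andP; split; lra.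
have s0 : 0 < sin (pi / 4 : R) by exact: sin_gt0_pihalf.
set m := Num.min (cos (pi / 4 : R)) (sin (pi / 4)).
have m0 : 0 < m by rewrite lt_min c0.
exists (m / 2) => [|u /andP[u0 u1]]; first by rewrite divr_gt0.
have [u4|u4] := lerP u (pi / 4).
  move: u0; rewrite le_eqVlt => /orP[/eqP <-|u0]; first by rewrite mulr0 sin0.
  have [|xi + E1] := @MVT R sin cos 0 u u0 (fun x _ => is_derive_sin x).
    by apply: continuous_subspaceT => x; exact: continuous_sin.
  rewrite in_itv /= => /andP[xi0 xiu]; move: E1; rewrite sin0 !subr0 => ->.
  rewrite ler_wpM2r ?(ltW u0) //.
  apply: (@le_trans _ _ (cos (pi / 4))).
    by rewrite (@le_trans _ _ m) ?ge_min ?lexx // ler_pdivrMr // ler_pMr // ler1n.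
  by rewrite le_eqVlt ltr_cos ?in_itv /=; [apply/orP; right; lra|lra|lra].
apply: (@le_trans _ _ (sin (pi / 4))).
  apply: (@le_trans _ _ m); last by rewrite ge_min lexx orbT.
  rewrite -mulrA ler_piMr ?(ltW m0) // mulrC ler_pdivrMr // mul1r.
  by have := pihalf_lt2 R; lra.
by rewrite le_eqVlt ltr_sin ?in_itv /=; [apply/orP; right; lra|lra|lra].
Qed.

Lemma one_sub_cos_lower : exists2 c : R, 0 < c &
  forall x : R, `|x| <= pi -> c * x ^+ 2 <= 1 - cos x.
Proof.
have [c c0 hc] := sin_lower; exists (c ^+ 2 / 2) => [|x xpi]; first by rewrite divr_gt0 // exprn_gt0.
have -> : cos x = 1 - sin (`|x| / 2) ^+ 2 *+ 2.
  rewrite -cos_norm; have {1}-> : `|x| = (`|x| / 2) *+ 2 by rewrite -mulr_natr divfK.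
  by rewrite cos_mulr2n cos2sin2 mulrnBl -addrA addrC; ring.
have h := hc (`|x| / 2); have {}h := h _.
have h1 : c * (`|x| / 2) <= sin (`|x| / 2) by apply: h; apply/andP; split; [rewrite divr_ge0|lra].
have h2 : 0 <= c * (`|x| / 2) by rewrite mulr_ge0 ?(ltW c0) // divr_ge0.
have : (c * (`|x| / 2)) ^+ 2 <= sin (`|x| / 2) ^+ 2 by rewrite lerXn2r ?nnegrE // (le_trans h2).
rewrite exprMn expr_div_n real_normK ?num_real //; lra.
Qed.

Lemma card_nodes_neq0 n : #|{: nodes n}|%:R != 0 :> R.
Proof. by rewrite pnatr_eq0 -lt0n; apply/card_gt0P; exists 0. Qed.

(** The sum over pairs of nodes is a squared modulus. *)
Lemma fejer_ge0 n (z : E) : 0 <= fejer n z.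
Proof.
rewrite mulr_ge0 ?invr_ge0 //.
have -> : \sum_(t : pairs n) cos (dot (wave R t) z) =
    (\sum_(a : nodes n) cos (dot (freq R a) z)) ^+ 2 + (\sum_(a : nodes n) sin (dot (freq R a) z)) ^+ 2.
  rewrite !expr2 !big_distrlr /= !pair_big -big_split /=; apply: eq_bigr => -[a b] _ /=.
  by rewrite waveE /= dotDl dotNl cosB.
by rewrite addr_ge0 // sqr_ge0.
Qed.

Lemma mean_wave (w : 'rV[int]_2) (x : E) :
  mean (fun y => cos (dot (of_int R w) (x - y))) = (w == 0)%:R.
Proof.
have [ms mc] := mean_trig R w.
rewrite (_ : (fun y => _) = fun y => cos (dot (of_int R w) x) * cos (dot (of_int R w) y)
   + sin (dot (of_int R w) x) * sin (dot (of_int R w) y)); last first.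
  by apply/funext => y; rewrite dotDr dotNr cosB.
rewrite mean_axpy; [|exact: bounded_map_mul (bounded_map_cst _) (bounded_map_cos _)|exact: bounded_map_sin].
rewrite mean_scale ?ms ?mc; last exact: bounded_map_cos.
rewrite mulr0 addr0; case: eqP => [->|_]; last by rewrite mulr0.
by rewrite /of_int map_mx0 dot0l cos0 mulr1.
Qed.

Lemma card_nodes_coord n k : (n.+1%:R * \sum_(a : nodes n) (a 0 k == ord_max)%:R = #|{: nodes n}|%:R :> R).
Proof.
have E1 (c : 'I_n.+1) : \sum_(a : nodes n) (a 0 k == ord_max)%:R =
    \sum_(a : nodes n) (c == ord_max - a 0 k)%:R :> R.
  rewrite (reindex (fun a : nodes n => a + (\row_i (if i == k then c else 0)))) /=; last first.
    by exists (fun a => a - (\row_i (if i == k then c else 0))) => a _; rewrite ?addrK ?subrK.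
  apply: eq_bigr => a _; rewrite !mxE eqxx; congr (_ %:R); congr nat_of_bool.
  by apply/eqP/eqP => [<-|->]; [rewrite addrAC subrr add0r|rewrite addrC subrK].
rewrite -{1}(card_ord n.+1) mulrC mulr_natr -sumr_const.
under eq_bigr => c _ do rewrite (E1 c).
rewrite exchange_big /= -sumr_const; apply: eq_bigr => a _.
rewrite (bigD1 (ord_max - a 0 k)) //= eqxx big1 ?addr0 // => c /negPf ->.
by [].
Qed.

(** Every node has a neighbour in direction k except those on one side of the square, which are
    one in n + 1. *)
Lemma count_shift n k (s : bool) :
  1 - n.+1%:R^-1 <= #|{: nodes n}|%:R^-1 * \sum_(t : pairs n)
    ((if s then ifreq t + delta_mx 0 k else ifreq t - delta_mx 0 k) == 0)%:R :> R.
Proof.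
rewrite -[leLHS](@mulKf _ #|{: nodes n}|%:R); last exact: card_nodes_neq0.
rewrite ler_wpM2l ?invr_ge0 //.
rewrite mulrBr mulr1 -{2}(card_nodes_coord n k) mulrC mulKf ?pnatr_eq0 //.
rewrite -sumr_const -sumrB.
pose P (a b : nodes n) : bool :=
  (if s then ifreq (a, b) + delta_mx 0 k else ifreq (a, b) - delta_mx 0 k) == 0.
have -> : \sum_(t : pairs n) ((if s then ifreq t + delta_mx 0 k else ifreq t - delta_mx 0 k) == 0)%:R
    = \sum_(a : nodes n) \sum_(b : nodes n) (if s then P a b else P b a)%:R :> R.
  rewrite /P; case: {+}s.
    by rewrite pair_big /=; apply: eq_bigr => -[a b].
  by rewrite exchange_big pair_big /=; apply: eq_bigr => -[a b].
apply: ler_sum => a _; case: eqP => [_|/eqP ak] /=.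
  by rewrite subrr sumr_ge0.
rewrite subr0.
pose b : nodes n := \row_i (if i == k then inord (a 0 k).+1 else a 0 i).
rewrite (bigD1 b) //= -[leLHS]addr0 lerD ?sumr_ge0 //.
suff -> : (if s then P a b else P b a) = true by [].
have aklt : (a 0%R k < n)%N by rewrite ltn_neqAle -ltnS ltn_ord andbT.
have bE i : (b 0 i)%:Z = (a 0 i)%:Z + (i == k)%:Z.
  rewrite mxE; case: eqP => [->|_]; last by rewrite addr0.
  by rewrite inordK ?ltnS //= -addn1 PoszD.
rewrite /P {P}; case: s; apply/eqP/rowP => i; move: (bE i); rewrite !mxE eqxx /=; case: (i == k) => /=; lia.
Qed.

Lemma mean_fejer n (x : E) : mean (fun y => fejer n (x - y)) = 1.
Proof.
rewrite /fejer mean_scale; last by apply: bounded_map_sum => t; exact: bounded_map_cos.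
rewrite mean_sum; last by move=> t; exact: bounded_map_cos.
rewrite (_ : \sum_(t : pairs n) _ = #|{: nodes n}|%:R) ?mulVf ?card_nodes_neq0 //.
rewrite -sumr_const -(pair_bigA _ (fun a b => mean (fun y => cos (dot (wave R (a, b)) (x - y))))) /=.
apply: eq_bigr => a _; rewrite (bigD1 a) //= mean_wave big1 ?addr0.
  by rewrite (_ : ifreq _ = 0) ?eqxx //; apply/rowP => i; rewrite !mxE subrr.
move=> b ba; rewrite mean_wave; case: eqP => // /rowP w0; case/eqP: ba.
apply/rowP => i; apply/val_inj; have := w0 i; rewrite !mxE /= => /eqP; rewrite subr_eq0 => /eqP [] //.
Qed.

(** Comparable to the squared distance to the lattice, and a trigonometric polynomial. *)
Definition spread (z : E) : R := \sum_k (1 - cos (dot (basis k) z)).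

(** Multiplication by cos z_k shifts the frequencies by one step, so its mean against the kernel
    counts neighbouring nodes. *)
Lemma mean_spread_fejer n (x : E) : mean (fun y => spread (x - y) * fejer n (x - y)) <= 2 / n.+1%:R.
Proof.
have bF : bounded_map (fun y => fejer n (x - y)) by exact: fejer_bounded.
have bcF k : bounded_map (fun y => cos (dot (basis k) (x - y)) * fejer n (x - y)).
  by apply: bounded_map_mul => //; exact: bounded_map_cos.
have E1 : (fun y => spread (x - y) * fejer n (x - y)) =
    (fun y => \sum_k (fejer n (x - y) + (-1) * (cos (dot (basis k) (x - y)) * fejer n (x - y)))).
  apply/funext => y; rewrite mulr_suml; apply: eq_bigr => k _; ring.
rewrite E1 mean_sum; last by move=> k; exact: bounded_map_axpy.
rewrite (_ : 2 / n.+1%:R = \sum_(k < 2) n.+1%:R^-1); last first.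
  by rewrite sumr_const card_ord mulr_natl.
apply: ler_sum => k _.
rewrite mean_axpy // mean_fejer mulN1r.
suff : 1 - n.+1%:R^-1 <= mean (fun y => cos (dot (basis k) (x - y)) * fejer n (x - y)).
  by move=> h; rewrite lerBlDr addrC -lerBlDr.
pose G (t : pairs n) (s : bool) (y : E) := cos (dot (of_int R (if s then ifreq t + delta_mx 0 k else ifreq t - delta_mx 0 k)) (x - y)).
have bG t s : bounded_map (G t s) by exact: bounded_map_cos.
have E2 : (fun y => cos (dot (basis k) (x - y)) * fejer n (x - y)) =
   (fun y => #|{: nodes n}|%:R^-1 * \sum_(t : pairs n) (2^-1 * G t true y + 2^-1 * G t false y)).
  apply/funext => y; rewrite /fejer mulrCA; congr (_ * _); rewrite mulr_sumr; apply: eq_bigr => t _.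
  have dk : of_int R (delta_mx 0 k) = basis k by rewrite /of_int map_delta_mx.
  rewrite /G /of_int map_mxB map_mxD -!/(of_int R _) dk !dotDl dotNl.
  rewrite cosB cosD -/(wave R t); by field.
have b2 t s : bounded_map (fun y => 2^-1 * G t s y) by exact: bounded_map_mul (bounded_map_cst _) (bG t s).
have b3 t : bounded_map (fun y => 2^-1 * G t true y + 2^-1 * G t false y).
  exact: bounded_map_axpy _ (b2 t true) (bG t false).
rewrite E2 mean_scale; last exact: bounded_map_sum.
rewrite mean_sum //.
under eq_bigr => t _ do rewrite (mean_axpy _ (b2 t true) (bG t false)) (mean_scale _ (bG t true)) !mean_wave.
rewrite big_split /= -!mulr_sumr mulrDr.
have := count_shift n k true; have := count_shift n k false => /=.
rewrite !(mulrCA _ 2^-1).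
by move=> h1 h2; rewrite -mulrDr ler_pdivlMl // mulr_natl mulr2n lerD.
Qed.

(** Korovkin's argument. A Lipschitz function satisfies |f y - f x| <= 2 eta + K spread (x - y);
    averaging against the kernel, which is nonnegative of mass 1, bounds the error by 2 eta + O(1/n).
    The constants depend on the Lipschitz bound alone, so n serves all such f at once. *)
Theorem smoothing_approx (e : R) : 0 < e -> exists n, forall f : E -> R,
  lattice_periodic f -> smooth f -> (forall j y, `|'D_(basis j) f y| <= 1) ->
  forall x, `|smoothing n f x - f x| <= e.
Proof.
move=> e0; have [c c0 hc] := one_sub_cos_lower.
set eta := e / 4.
have eta0 : 0 < eta by rewrite divr_gt0.
set n := Num.bound (4 / (c * eta) / eta).
have q0 : 0 < 4 / (c * eta) / eta by rewrite !divr_gt0 // mulr_gt0.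
exists n => f pf sf Df x.
have bf := periodic_bounded pf sf.
have bK := fejer_bounded n x.
have lip (d : E) : `|f (x - d) - f x| <= 2 * `|d|.
  have := @ball_MVT _ _ _ f (`|x| + `|d|) 2 (fun y => smooth_diff y sf).
  move=> h; have {}h := h _ (x - d) x _ _; rewrite addrAC subrr add0r normrN in h; apply: h.
  - move=> y v _; rewrite deriveE; last exact: smooth_diff.
    rewrite [v in 'd _ _ v](row_sum_delta v) linear_sum /= (le_trans (ler_norm_sum _ _ _)) //.
    have hj j : `|'d f y (v 0 j *: basis j)| <= `|v|.
      rewrite linearZ /= -deriveE; last exact: smooth_diff.
      by rewrite normrM -[leRHS]mulr1 ler_pM // norm_coord.
    by rewrite big_ord_recl big_ord1 mulr_natl mulr2n lerD.
  - exact: ler_normB.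
  - by rewrite lerDl.
have key y : `|f y - f x| <= 2 * eta + 2 / (c * eta) * spread (x - y).
  have [l ll dpi] := lattice_reduce_norm (x - y).
  set d := x - y - l in dpi.
  have xd : x - d = y + l by rewrite /d !opprB addrCA [x + _]addrC subrK addrC.
  have -> : f y = f (x - d) by rewrite xd pf.
  rewrite (le_trans (lip d)) // -mulrA -mulrDr ler_wpM2l //.
  have sE : spread (x - y) = \sum_k (1 - cos (d 0 k)).
    apply: eq_bigr => k _; have -> : d 0 k = dot (basis k) d by rewrite dotC dot_basis.
    have dk : of_int R (delta_mx 0 k) = basis k by rewrite /of_int map_delta_mx.
    have [_ pc] := periodic_trig_dot R (delta_mx 0 k).
    have := periodic_sub (x - y) pc ll; rewrite dk -/d => <-.
    by [].
  have sk k : 0 <= 1 - cos (d 0 k) by rewrite subr_ge0 cos_le1.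
  have s0 : 0 <= spread (x - y) by rewrite sE sumr_ge0.
  have ce0 : 0 <= (c * eta)^-1 by rewrite invr_ge0 mulr_ge0 ?(ltW c0) ?(ltW eta0).
  apply: norm_rV_le => [|k].
    by rewrite addr_ge0 ?(ltW eta0) // mulr_ge0.
  have h1 : c * (d 0 k) ^+ 2 <= spread (x - y).
    rewrite sE (bigD1 k) //= -[leLHS]addr0 lerD ?sumr_ge0 //.
    by apply: hc; rewrite (le_trans (norm_coord d k)).
  have [dk|dk] := lerP `|d 0 k| eta.
    by rewrite (le_trans dk) // lerDl mulr_ge0.
  rewrite -[leLHS]add0r lerD ?(ltW eta0) // mulrC ler_pdivlMr ?mulr_gt0 //.
  rewrite (le_trans _ h1) // mulrCA ler_wpM2l ?(ltW c0) //.
  rewrite -real_normK ?num_real // expr2 ler_wpM2l // ltW //.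
rewrite smoothingE //.
have -> : f x = mean (fun y => f x * fejer n (x - y)).
  by rewrite mean_scale // mean_fejer mulr1.
have bfK : bounded_map (fun y => f y * fejer n (x - y)) by exact: bounded_map_mul.
have bcK a : bounded_map (fun y => a * fejer n (x - y)) by exact: (bounded_map_mul (bounded_map_cst _)).
have bsp : bounded_map (fun y => spread (x - y) * fejer n (x - y)).
  apply: bounded_map_mul => //; apply: bounded_map_sum => k; exists 2 => y.
  by rewrite (le_trans (ler_normB _ _)) // normr1 lerD // cos_max.
have -> : mean (fun y => f y * fejer n (x - y)) - mean (fun y => f x * fejer n (x - y)) =
    mean (fun y => f y * fejer n (x - y) + (-1) * (f x * fejer n (x - y))).
  by rewrite mean_axpy // mulN1r.
apply: (@le_trans _ _ (mean (fun y => 2 * eta * fejer n (x - y) +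
    2 / (c * eta) * (spread (x - y) * fejer n (x - y))))).
  apply: mean_norm_le; [exact: bounded_map_axpy|exact: bounded_map_axpy|].
  move=> y; rewrite mulN1r -mulrBl normrM (ger0_norm (fejer_ge0 n _)) [X in _ <= _ + X]mulrA -mulrDl.
  by rewrite ler_wpM2r ?fejer_ge0.
rewrite mean_axpy // mean_scale // mean_fejer mulr1.
have hs := mean_spread_fejer n x.
have a0 : 0 <= 2 / (c * eta) by rewrite divr_ge0 // mulr_ge0 ?(ltW c0) ?(ltW eta0).
have h2 : 4 / (c * eta) / n.+1%:R <= eta.
  rewrite ler_pdivrMr ?ltr0n // -ler_pdivrMl // [eta^-1 * _]mulrC.
  have := archi_boundP (ltW q0) => /ltW /le_trans; apply.
  by rewrite ler_nat.
have h3 : 2 / (c * eta) * mean (fun y => spread (x - y) * fejer n (x - y)) <= eta.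
  apply: le_trans h2; rewrite (le_trans (ler_wpM2l a0 hs)) //; apply: le_of_eq.
  by rewrite mulrACA -natrM -[RHS]mulrA.
have -> : e = 4 * eta by rewrite /eta mulrC divfK.
by move: h3; set M := _ * mean _; move: eta0; lra.
Qed.

End Korovkin.

(** * Odd divergence-free fields as sums of shear fields *)

Section FieldApprox.
Variable R : realType.
Local Notation E := 'rV[R]_2.
Local Notation basis j := (delta_mx 0 j : E).
Local Hint Resolve card_nodes_gt0 : core.

Lemma uniform_words (J : finType) (P : seq J -> R -> Prop) K :
  (forall js C D, C <= D -> P js C -> P js D) -> (forall js, exists C, P js C) ->
  exists2 C : R, 0 < C & forall js, (size js <= K)%N -> P js C.
Proof.
move=> mP /choice[c hc].
pose M := 1 + \sum_(n < K.+1) \sum_(t : n.-tuple J) `|c t|.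
have M0 n : 0 <= \sum_(t : n.-tuple J) `|c t| by exact: sumr_ge0.
exists M => [|js sjs]; first by rewrite ltr_wpDr // sumr_ge0.
apply: mP (hc js); rewrite (le_trans (ler_norm _)) // /M.
rewrite (bigD1 (Ordinal (sjs : (size js < K.+1)%N))) //= (bigD1 (in_tuple js)) //=.
have h1 : 0 <= \sum_(i < K.+1 | i != Ordinal (sjs : (size js < K.+1)%N)) \sum_(t : i.-tuple J) `|c t|.
  by apply: sumr_ge0.
have h2 : 0 <= \sum_(i : (size js).-tuple J | i != in_tuple js) `|c i| by apply: sumr_ge0.
by move: h1 h2; lra.
Qed.

Lemma smooth_iterD (V W : normedModType R) (F : V -> W) vs : smooth F -> smooth (iterD vs F).
Proof. by move=> sF; elim: vs => [//|v vs IH] /=; exact: smooth_derive. Qed.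

Lemma periodic_iterD (W : normedModType R) (F : E -> W) vs : lattice_periodic F -> lattice_periodic (iterD vs F).
Proof. by move=> pF; elim: vs => [//|v vs IH] /=; exact: periodic_derive. Qed.

Lemma iterD_scaled_sub (V W : normedModType R) (a : R) (F H : V -> W) vs : smooth F -> smooth H ->
  iterD vs (fun y => a *: (F y - H y)) = fun y => a *: (iterD vs F y - iterD vs H y).
Proof.
move=> sF sH; elim: vs => [//|v vs IH] /=; rewrite IH; apply/funext => y.
have dF := smooth_diff y (smooth_iterD vs sF).
have dH := smooth_diff y (smooth_iterD vs sH).
rewrite deriveZ; last by apply: diff_derivable; exact: differentiableB.
by rewrite deriveB //; exact: diff_derivable.
Qed.

Lemma derive_coord (V : normedModType R) (F : V -> E) v x l : differentiable F x ->
  'D_v (fun y => F y 0 l) x = ('D_v F x) 0 l.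
Proof. by move=> dF; rewrite derive_mx ?mxE //; exact: diff_derivable. Qed.

Lemma smooth_coord_map l : smooth (fun u : E => u 0 l).
Proof.
apply: (@smooth_lin _ _ _ _ 1) => [a x y|x]; first by rewrite !mxE.
by rewrite mul1r norm_coord.
Qed.

Lemma smooth_coord (V : normedModType R) (F : V -> E) l : smooth F -> smooth (fun y => F y 0 l).
Proof. by move=> sF; apply: (smooth_comp (smooth_coord_map l) sF). Qed.

Lemma iterD_coord (V : normedModType R) (F : V -> E) vs l : smooth F ->
  iterD vs (fun y => F y 0 l) = fun y => iterD vs F y 0 l.
Proof.
move=> sF; elim: vs => [//|v vs IH] /=; rewrite IH; apply/funext => y.
by rewrite derive_coord //; exact/smooth_diff/smooth_iterD.
Qed.

Lemma iterD_smoothing n f js : lattice_periodic f -> smooth f ->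
  iterD [seq basis j | j <- js] (smoothing n f) = smoothing n (iterD [seq basis j | j <- js] f).
Proof.
move=> pf sf; elim: js => [//|j js IH] /=; rewrite IH; apply/funext => y.
by rewrite smoothing_derive //; [exact: periodic_iterD|exact: smooth_iterD].
Qed.

Lemma smoothing_scale n a (f : E -> R) x : bounded_map f ->
  smoothing n (fun y => a * f y) x = a * smoothing n f x.
Proof.
move=> bf; rewrite !smoothingE //; last exact: (bounded_map_mul (bounded_map_cst _)).
rewrite -mean_scale; last by apply: bounded_map_mul => //; exact: fejer_bounded.
by congr mean; apply/funext => y; rewrite mulrA.
Qed.

(** The case of partial derivatives bounded by 1 suffices, since jets are linear in the field. *)
Lemma field_bound_jets k (B : R) : exists2 C : R, 0 < C & forall G : E -> E, smooth G ->
  (forall js : seq 'I_2, (size js <= k)%N -> forall y, `|iterD [seq basis j | j <- js] G y| <= 1) ->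
  forall z : TE k E, `|z| <= B -> `|itang G z| <= C.
Proof.
pose J := {G : E -> E | smooth G /\
  (forall js : seq 'I_2, (size js <= k)%N -> forall y, `|iterD [seq basis j | j <- js] G y| <= 1)}.
have t : tame true k setT (fun G : J => sval G).
  apply: (tame_frame (@frame_rV R 2)) => //.
    by move=> [G [/= sG _]] js x _ _; exact/smooth_diff/smooth_iterD.
  move=> js sjs _ B'; exists 1 => -[G [/= _ hG]] x _ _; exact: hG.
have [C hC] := itang_bound t B; exists (`|C| + 1) => [|G sG hG z zB].
  by rewrite ltr_wpDl.
by rewrite (le_trans (hC (exist _ G (conj sG hG)) z zB)) // (le_trans (ler_norm C)) // lerDl.
Qed.

(** The approximations are the Fejer smoothings of the components, with frequencies independent
    of i. The cosine coefficients are means of odd functions. The coefficient c of sin(w.y)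
    satisfies w.c = 0, because integrating by parts turns it into the mean of the divergence times
    cos(w.y). *)
Theorem field_approx (I : Type) (X : I -> E -> E) :
  (forall i, smooth (X i)) -> (forall i, lattice_periodic (X i)) ->
  (forall i y, X i (- y) = - X i y) ->
  (forall i y, \sum_l ('D_(basis l) (X i) y) 0 l = 0) ->
  (forall js : seq 'I_2, exists C : R, forall i y, `|iterD [seq basis j | j <- js] (X i) y| <= C) ->
  forall k (B e : R), 0 < e -> exists m (w : nat -> 'rV[int]_2) (c : I -> nat -> E) (C : R),
    [/\ (0 < m)%N, forall i j, `|c i j| <= C,
        forall i j, dot (of_int R (w j)) (c i j) = 0 &
        forall i (z : TE k E), `|z| <= B ->
          `|itang (fun p => \sum_(j < m) shear (of_int R (w j)) (c i j) p) z - itang (X i) z| <= e].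
Proof.
move=> sX pX oX dX bX k B e e0.
have [C0 C00 hC0] := field_bound_jets k B.
set eta := e / C0; have eta0 : 0 < eta by rewrite divr_gt0.
have [M M0 hM] := @uniform_words _ _ k.+1 (fun js C D CD h i y => le_trans (h i y) CD) bX.
have [n hn] := smoothing_approx (divr_gt0 eta0 M0).
pose T : finType := (nodes n * nodes n)%type.
pose t0 : T := (0, 0).
pose tj j := nth t0 (enum T) j.
have sumT (F : T -> R) : \sum_t F t = \sum_(j < #|T|) F (tj j).
  by rewrite cardE -(big_mkord xpredT (fun j => F (tj j))) -(big_nth t0 xpredT F) big_enum.
pose q : R := #|{: nodes n}|%:R^-1.
have q0 : 0 <= q by rewrite invr_ge0.
pose Xl i l y := X i y 0 l.
have sXl i l : smooth (Xl i l) by exact: smooth_coord.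
have pXl i l : lattice_periodic (Xl i l) by move=> p v vl; rewrite /Xl pX.
have bXl i l : bounded_map (Xl i l) by exact: periodic_bounded.
pose c i j : E := \row_l (q * mean (fun y => Xl i l y * sin (dot (wave R (tj j)) y))).
have hX0 := hM [::] isT.
have cC i j : `|c i j| <= q * M.
  apply: norm_rV_le => [|l]; first by rewrite mulr_ge0 // ltW.
  rewrite mxE normrM (ger0_norm q0) ler_wpM2l // -[leRHS](mean_cst M).
  apply: mean_norm_le; [exact: bounded_map_mul (bXl _ _) (bounded_map_sin _)|exact: bounded_map_cst|].
  move=> y; rewrite normrM -[leRHS]mulr1 ler_pM ?sin_max //.
  by rewrite (le_trans (norm_coord _ _)) // hX0.
pose P i p := \sum_(j < #|T|) shear (of_int R (ifreq (tj j))) (c i j) p.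
have PE i l : (fun y => P i y 0 l) = smoothing n (Xl i l).
  apply/funext => y; rewrite /P summxE /smoothing -/q mulr_sumr.
  rewrite [RHS]sumT. apply: eq_bigr => j _.
  rewrite mulrDr -/(tj j) [X in q * (X * _)](_ : _ = 0) ?mul0r ?mulr0 ?add0r.
    by rewrite !mxE mulrC mulrA.
  apply: mean_odd => [p v vl|p]; last by rewrite /Xl oX mxE dotNr cosN mulNr.
  by have [_ pc] := periodic_trig_dot R (ifreq (tj j)); rewrite pXl // pc.
have sP i : smooth (P i) by apply: smooth_sum => j; exact: smooth_shear.
exists #|T|, (fun j => ifreq (tj j)), c, (q * M); split => //.
- by apply/card_gt0P; exists t0.
- move=> i j; rewrite /dot.
  transitivity (q * \sum_l mean (fun y => 'D_(basis l) (Xl i l) y * cos (dot (wave R (tj j)) y))).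
    rewrite mulr_sumr; apply: eq_bigr => l _; rewrite !mxE.
    have [-> _] := mean_parts l (ifreq (tj j)) (pXl i l) (sXl i l).
    by rewrite mxE mulrCA.
  rewrite -mean_sum; last first.
    move=> l; apply: bounded_map_mul; last exact: bounded_map_cos.
    by apply: periodic_bounded; [exact: periodic_derive|exact: smooth_derive].
  rewrite (_ : (fun y => _) = fun=> 0) ?mean_cst ?mulr0 //.
  apply/funext => y; rewrite -mulr_suml (_ : \sum_l _ = 0) ?mul0r // -[RHS](dX i y).
  by apply: eq_bigr => l _; rewrite derive_coord //; exact: smooth_diff.
move=> i z zB.
pose G y := eta^-1 *: (P i y - X i y).
have sG : smooth G.
  apply: smooth_mul; first exact: smooth_cst.
  by apply: smooth_add => //; exact: smooth_opp.
have hG : `|itang G z| <= C0.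
  apply: hC0 => // js sjs y; rewrite iterD_scaled_sub // normrZ gtr0_norm ?invr_gt0 //.
  rewrite mulrC ler_pdivrMr // mul1r; apply: norm_rV_le => [|l]; first exact: ltW.
  have := congr1 (fun f => f y) (iterD_coord [seq basis j | j <- js] l (sP i)).
  have := congr1 (fun f => f y) (iterD_coord [seq basis j | j <- js] l (sX i)).
  rewrite PE iterD_smoothing // !mxE => <- <-.
  set g := iterD _ (Xl i l).
  have sg : smooth g by exact: smooth_iterD.
  have pg : lattice_periodic g by exact: periodic_iterD.
  have := hn (fun y => M^-1 * g y) _ _ _ y.
  rewrite smoothing_scale; last exact: periodic_bounded.
  rewrite -mulrBr normrM gtr0_norm ?invr_gt0 // ler_pdivrMl // mulrCA divff ?gt_eqF // mulr1.
  apply.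
  + by move=> p v vl; rewrite pg.
  + by apply: (smooth_mul (F := fun=> M^-1)); first exact: smooth_cst.
  move=> j y'; rewrite derive_scale_smooth // normrM gtr0_norm ?invr_gt0 // mulrC ler_pdivrMr // mul1r.
  have := hM (j :: js) sjs i y'.
  rewrite -['D_(basis j) g y']/(iterD [seq basis j0 | j0 <- j :: js] (Xl i l) y') iterD_coord //.
  by apply: le_trans; exact: norm_coord.
have -> : (fun p => \sum_(j < #|T|) shear (of_int R (ifreq (tj j))) (c i j) p) = fun p => X i p + eta *: G p.
  by apply/funext => p; rewrite /G scalerA divff ?gt_eqF // scale1r addrC subrK.
rewrite itang_axpy; [|exact: sX|exact: sG].
rewrite addrAC subrr add0r normrZ gtr0_norm // (_ : e = eta * C0); last by rewrite /eta divfK // gt_eqF.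
by rewrite ler_wpM2l // ltW.
Qed.

End FieldApprox.

(** * Charts of the torus and local lifts *)

Section TorusCharts.
Variable R : realType.
Local Notation E := 'rV[R]_2.
Local Notation T := (torus R).
Implicit Types V W : normedModType R.

Lemma tprojD (u v : E) : tproj (u + v) = tproj u + tproj v :> T.
Proof. exact: (@Quotient.pi_add _ (lattice R) u v). Qed.

Lemma tprojN (u : E) : tproj (- u) = - tproj u :> T.
Proof. exact: (@Quotient.pi_opp _ (lattice R) u). Qed.

Lemma tprojB (u v : E) : tproj (u - v) = tproj u - tproj v :> T.
Proof. by rewrite tprojD tprojN. Qed.

Lemma tproj_eq (u v : E) : (tproj u = tproj v :> T) <-> u - v \in lattice R.
Proof.
split=> [h|h].
  by rewrite (@Quotient.idealrBE _ (lattice R)); apply/eqP.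
by move: h; rewrite (@Quotient.idealrBE _ (lattice R)) => /eqP.
Qed.

Lemma tproj0 : tproj (0 : E) = 0 :> T.
Proof. by have := tprojB 0 0; rewrite !subrr. Qed.

Lemma tproj_lattice (u l : E) : l \in lattice R -> tproj (u + l) = tproj u :> T.
Proof. by move=> ll; apply/tproj_eq; rewrite addrC addKr. Qed.

Lemma tlog_spec (x : T) : tproj (tlog x) = x /\ forall i, - pi <= tlog x 0 i < pi.
Proof.
have [u hu] : exists u : E, tproj u = x by exists (repr x); rewrite /tproj reprK.
have [l ll hl] := lattice_reduce u.
apply: (@xgetPex _ 0 [set u : E | tproj u = x /\ forall i, - pi <= u 0 i < pi]).
exists (u - l); split => //=; rewrite -hu.
by have := tproj_lattice (u - l) ll; rewrite subrK.
Qed.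

Lemma tlogK (x : T) : tproj (tlog x) = x. Proof. exact: (tlog_spec x).1. Qed.

Lemma lattice_small (u v : E) : (forall i, - pi <= u 0 i < pi) -> (forall i, - pi <= v 0 i < pi) ->
  u - v \in lattice R -> u = v.
Proof.
move=> hu hv /latticeP[k hk]; apply/rowP => i.
have p0 := pi_gt0 R.
have := hk i; rewrite !mxE => e.
have k0 : k i = 0.
  have /andP[u1 u2] := hu i; have /andP[v1 v2] := hv i.
  have h1 : -1 < (k i)%:~R :> R by rewrite -(ltr_pM2l (twopi_gt0 R)) -e; lra.
  have h2 : (k i)%:~R < 1 :> R by rewrite -(ltr_pM2l (twopi_gt0 R)) -e; lra.
  have {}h1 : (-1 : int) < k i by rewrite -(ltr_int R) rmorphN.
  have {}h2 : k i < (1 : int) by rewrite -(ltr_int R).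
  lia.
by apply/eqP; rewrite -subr_eq0 e k0 mulr0.
Qed.

Lemma tlog_unique (u : E) : (forall i, - pi <= u 0 i < pi) -> tlog (tproj u) = u.
Proof.
move=> hu; have [h1 h2] := tlog_spec (tproj u); apply: lattice_small => //.
by apply/tproj_eq.
Qed.

Lemma tlog_small (u : E) : `|u| < pi -> tlog (tproj u) = u.
Proof.
move=> hu; apply: tlog_unique => i; have := le_lt_trans (norm_coord u i) hu.
by rewrite ltr_norml => /andP[h1 h2]; rewrite h2 ltW.
Qed.

Lemma tlog_norm (x : T) : `|tlog x| <= pi.
Proof.
apply: norm_rV_le; first exact: pi_ge0.
by move=> i; have /andP[h1 h2] := (tlog_spec x).2 i; rewrite ler_norml h1 ltW.
Qed.

Lemma tproj_descent (F : E -> E) p : (forall q l, l \in lattice R -> F (q + l) = F q + l) ->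
  tproj (F (tlog (tproj p : T))) = tproj (F p) :> T.
Proof.
move=> Fl; have ll : tlog (tproj p : T) - p \in lattice R by apply/tproj_eq; rewrite tlogK.
by rewrite -(subrK p (tlog _)) addrC Fl // tproj_lattice.
Qed.

(** Smoothness through arbitrary local lifts, not only those centred at the values of f: it is
    stable under differences. *)
Definition tsmooth V (f : V -> T) : Prop := forall a, exists (U : set V) (G : V -> E),
  [/\ open U, U a, forall k, Ck k U G & forall x, U x -> f x = tproj (G x)].

Lemma tame_cont V W (U : set V) (G : V -> W) x : U x -> (forall k, Ck k U G) ->
  {for x, continuous G}.
Proof. by move=> Ux /(_ 1) [/(_ tt x Ux)] d _; exact: differentiable_continuous. Qed.

Lemma open_small V (W : normedModType R) (U : set V) (G : V -> W) (e : R) : open U ->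
  (forall k, Ck k U G) -> open (U `&` [set x | `|G x| < e]).
Proof.
move=> oU tG; rewrite openE => x [Ux Gx]; apply: filterI; first exact: open_nbhs_nbhs.
have cG := tame_cont Ux tG.
have : nbhs (G x) [set y | `|y| < e].
  apply: open_nbhs_nbhs; split=> //.
  apply: (@open_comp _ _ (fun y : W => `|y|) [set r | r < e]); last exact: open_lt.
  by move=> y _; exact: norm_continuous.
exact: cG.
Qed.

Lemma tsmooth_comp (V V' : normedModType R) (J : finType) (e : J -> V) (c : J -> V -> R)
    (A : set V) (f : V -> T) (q : V' -> V) : frame e c -> torus_smooth A f -> smooth q ->
  (forall x, A (q x)) -> tsmooth (f \o q).
Proof.
move=> fr tf sq qA a; have [U [G [oU Ua sG hG]]] := tf _ (qA a).
exists (q @^-1` U), (fun x => tlog (f (q a)) + G (q x)).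
have oq : open (q @^-1` U).
  by apply: open_comp => // x _; exact: differentiable_continuous (smooth_diff x sq).
split => // [k|x Ux].
  apply: tame_add => //; first exact: (@tame_cst _ _ _ _ _ _ _ (fun=> _)).
  apply: (@tame_comp _ _ _ _ _ _ _ _ U (fun=> G) (fun=> q)) => //.
    exact: smooth_tame fr oU sG.
  by apply: tame_sub (sq k).
by rewrite tprojD tlogK hG // /in_chart tlogK /= addrC subrK.
Qed.

Lemma tsmooth_sub V (f g : V -> T) : tsmooth f -> tsmooth g -> tsmooth (fun x => f x - g x).
Proof.
move=> tf tg a; have [U [F [oU Ua tF hF]]] := tf a; have [U' [G [oU' Ua' tG hG]]] := tg a.
exists (U `&` U'), (fun x => F x - G x); split=> //.
- exact: openI.
- move=> k; apply: tame_add; first exact: openI.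
    by apply: tame_sub (tF k) => x [].
  apply: tame_opp; first exact: openI.
  by apply: tame_sub (tG k) => x [].
by move=> x [Ux U'x]; rewrite tprojB hF // hG.
Qed.

Lemma smooth_local V W (F : V -> W) : (forall a, exists (U : set V) (G : V -> W),
  [/\ open U, U a, forall k, Ck k U G & forall x, U x -> F x = G x]) ->
  smooth F.
Proof.
move=> h k.
suff : forall k V W (F : V -> W) (A : set V), (forall a, A a -> exists (U : set V) (G : V -> W),
  [/\ open U, U a, Ck k U G & forall x, U x -> F x = G x]) ->
  Ck k A F.
  apply=> a _; have [U [G [oU Ua tG FG]]] := h a.
  by exists U, G; split.
elim=> [//|{}k IH] {h}V {}W {}F A h; split.
  move=> _ x Ax; have [U [G [oU Ua [dG _] FG]]] := h x Ax.
  apply: near_eq_differentiable (dG tt x Ua).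
  by apply: filterS (open_nbhs_nbhs (conj oU Ua)) => y Uy; rewrite FG.
apply: IH => -[x v] /= Ax; have [U [G [oU Ua [dG tG] FG]]] := h x Ax.
exists (fst @^-1` U), (tang G); split=> //; first exact: open_fst.
move=> [y w] /= Uy; rewrite /tang /= FG //; congr (_, _); apply: near_eq_derive.
by apply: filterS (open_nbhs_nbhs (conj oU Uy)) => z Uz; rewrite FG.
Qed.

Lemma tsmooth_near V (f : V -> T) (u : E) a : tsmooth f -> f a = tproj u ->
  forall e : R, 0 < e -> exists (U : set V) (G : V -> E),
  [/\ open U, U a, forall k, Ck k U G, G a = u &
      forall x, U x -> f x = tproj (G x) /\ `|G x - u| < e].
Proof.
move=> tf fa e e0; have [U [G [oU Ua tG hG]]] := tf a.
pose l := G a - u.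
have ll : l \in lattice R by apply/tproj_eq; rewrite -hG.
have tG' k : Ck k U (fun x => G x - l).
  by apply: tame_add => //; apply: tame_opp => //; exact: (@tame_cst _ _ _ _ _ _ _ (fun=> l)).
have tG'' k : Ck k U (fun x => G x - l - u).
  by apply: tame_add => //; apply: tame_opp => //; exact: (@tame_cst _ _ _ _ _ _ _ (fun=> u)).
have Ga : G a - l = u by rewrite /l opprB addrC subrK.
exists (U `&` [set x | `|G x - l - u| < e]), (fun x => G x - l); split=> //.
- exact: (@open_small _ _ _ (fun x => G x - l - u)).
- by split=> //=; rewrite Ga subrr normr0.
- by move=> k; apply: tame_sub (tG' k) => x [].
move=> x [Ux /= h]; split=> //; rewrite hG //.
by have := tproj_lattice (G x - l) ll; rewrite subrK.
Qed.

(** The discontinuities of tlog lie on the boundary of a square that small values avoid. *)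
Lemma smooth_tlog V (f : V -> T) : tsmooth f -> (forall x, exists2 u : E, `|u| < 1 & f x = tproj u) ->
  smooth (fun x => tlog (f x)).
Proof.
move=> tf hf; apply: smooth_local => a; have [u u1 fa] := hf a.
have [U [G [oU Ua tG Ga hG]]] := tsmooth_near tf fa ltr01.
exists U, G; split=> // x Ux; have [-> Gx] := hG x Ux; apply: tlog_small.
rewrite -(subrK u (G x)) (le_lt_trans (ler_normD _ _)) // (lt_le_trans _ (pi_ge2 R)) //.
by move: Gx u1; lra.
Qed.

Lemma periodic_tproj W (F : E -> W) (u v : E) : lattice_periodic F -> tproj u = tproj v :> T -> F u = F v.
Proof. by move=> pF /tproj_eq h; rewrite -(subrK v u) addrC pF. Qed.

(** The jumps of tlog lie in the lattice, and F does not see them. *)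
Lemma smooth_tlog_periodic V W (F : E -> W) (f : V -> T) : lattice_periodic F -> smooth F ->
  tsmooth f -> smooth (fun x => F (tlog (f x))).
Proof.
move=> pF sF tf; apply: smooth_local => a; have [U [G [oU Ua tG hG]]] := tf a.
exists U, (F \o G); split=> // [k|x Ux].
  by apply: (@tame_comp _ _ _ _ _ _ _ _ setT (fun=> F) (fun=> G)).
by apply: periodic_tproj => //; rewrite tlogK hG.
Qed.

Lemma in_chart_lift V (F : V -> E) a : {for a, continuous F} ->
  \forall x \near a, in_chart (fun x => tproj (F x) : T) a x = F x - F a.
Proof.
move=> /cvgrPdist_lt /(_ pi (pi_gt0 R)) h; apply: filterS h => x h.
by rewrite /in_chart -tprojB tlog_small // distrC.
Qed.

Lemma lift_torus_smooth V (F : V -> E) (A : set V) : smooth F -> torus_smooth A (fun x => tproj (F x) : T).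
Proof.
move=> sF a _; have cF := differentiable_continuous (smooth_diff a sF).
have : nbhs a [set x | in_chart (fun x => tproj (F x) : T) a x = F x - F a] := in_chart_lift cF.
rewrite nbhsE => -[U [oU Ua] hU].
exists U, (fun x => F x - F a); split=> // [|x Ux _]; last by rewrite hU.
move=> vs x _; apply: smooth_diff; apply: smooth_iterD.
by apply: smooth_add => //; apply: smooth_opp; exact: smooth_cst.
Qed.

End TorusCharts.

(** * Lifting the isotopy to the plane *)

Section LiftIsotopy.
Variable R : realType.
Local Notation E := 'rV[R]_2.
Local Notation T := (torus R).

Lemma frame_real_pair (V : normedModType R) (J : finType) (e : J -> V) (c : J -> V -> R) :
  frame e c ->
  frame (fun j : option J => if j is Some i then (0, e i) else ((1, 0) : R * V))
    (fun j z => if j is Some i then c i z.2 else z.1).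
Proof.
move=> [lc [C bc] ce]; split.
- by case=> [i|] a x y //=; rewrite lc.
- exists (Num.max 1 C) => -[i|] x /=.
    rewrite (le_trans (bc i _)) //.
    apply: (@le_trans _ _ (Num.max 1 C * `|x.2|)); first by rewrite ler_wpM2r // le_max lexx orbT.
    by rewrite ler_wpM2l ?norm_snd // le_max ler01.
  apply: (@le_trans _ _ (1 * `|x|)); first by rewrite mul1r norm_fst.
  by rewrite ler_wpM2r // le_max lexx.
move=> [s x]; rewrite (bigD1 None) //= (reindex_omap Some id) /=; last by case.
rewrite (eq_bigl xpredT); last by move=> i /=; rewrite eqxx.
have -> : \sum_j c j x *: ((0, e j) : R * V) = (0, x).
  rewrite [in RHS](ce x); elim/big_rec2: _ => // i y1 y2 _ ->.
  by rewrite -[LHS]/(c i x *: 0 + 0, c i x *: e i + y1) scaler0 addr0.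
by rewrite -[RHS]/(s * 1 + 0, s *: 0 + x) mulr1 scaler0 addr0 add0r.
Qed.

(** It maps R into [0, 1] and increases from 0 to 1 on [0, pi]: composed with it, an isotopy
    parametrized by [0, 1] extends smoothly to all times. *)
Definition chi (s : R) : R := (1 - cos s) / 2.

Lemma chi01 s : 0 <= chi s <= 1.
Proof.
rewrite /chi; have := cos_le1 s; have := cos_geN1 s => h1 h2.
by rewrite divr_ge0 ?subr_ge0 //= ler_pdivrMr //; lra.
Qed.

Lemma chi0 : chi 0 = 0. Proof. by rewrite /chi cos0 subrr mul0r. Qed.
Lemma chipi : chi pi = 1. Proof. by rewrite /chi cospi opprK divff. Qed.

Lemma smooth_chi : smooth chi.
Proof.
rewrite /chi; under eq_fun do rewrite mulrC.
apply: (smooth_mul (F := fun=> 2^-1)); first exact: smooth_cst.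
by apply: smooth_add; [exact: smooth_cst|apply: smooth_opp; exact: smooth_cos].
Qed.

Variable psi : R -> T -> T.
Hypothesis psi0 : psi 0 = id.
Hypothesis psi_smooth : @torus_smooth R (R * E)%type [set z | 0 <= z.1 <= 1] (fun z => psi z.1 (tproj z.2)).

Lemma uniform_step : exists N, forall t t' p, 0 <= t <= 1 -> 0 <= t' <= 1 -> `|t' - t| <= N.+1%:R^-1 ->
  exists2 u : E, `|u| < 1 & psi t' (tproj p) - psi t (tproj p) = tproj u.
Proof.
pose K := (`[0, 1]%classic : set R) `*` [set p : E | `|p| <= pi].
have cK : compact K by apply: compact_setX; [exact: segment_compact|exact: (@proper_rV R 2)].
pose P (n : nat) (z : R * E) := forall t', 0 <= t' <= 1 -> `|t' - z.1| <= n.+1%:R^-1 -> 0 <= z.1 <= 1 ->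
  exists2 u : E, `|u| < 1 & psi t' (tproj z.2) - psi z.1 (tproj z.2) = tproj u.
have /(_ nat \oo P eventually_filter) h := (compact_near_coveringP K).1 cK.
have {h} [N _ hN] : \forall n \near \oo, K `<=` P n.
  apply: h => -[t0 p0] [/= t01 p0pi].
  have At0 : [set z : R * E | 0 <= z.1 <= 1] (t0, p0) by move: t01; rewrite /= in_itv.
  have [U [G [oU Ua sG hG]]] := psi_smooth At0.
  have tG k : Ck k U G.
    exact: smooth_tame (frame_real_pair (@frame_rV R 2)) oU sG.
  have Ga : G (t0, p0) = 0.
    by rewrite hG // /in_chart subrr -(tproj0 R) tlog_small // normr0 pi_gt0.
  have half0 : 0 < 2^-1 :> R by [].
  have oU' := open_small 2^-1 oU tG.
  have : nbhs (t0, p0) (U `&` [set x | `|G x| < 2^-1]).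
    by apply: open_nbhs_nbhs; split=> //; split=> //=; rewrite Ga normr0.
  move=> /nbhs_ballP[d /= d0 hd].
  have d20 : 0 < d / 2 by rewrite divr_gt0.
  exists (ball (t0, p0) (d / 2), [set n | n.+1%:R^-1 < d / 2]).
    split=> /=; first exact: nbhsx_ballx.
    exact: (near_infty_natSinv_lt (PosNum d20)).
  move=> [[t p] n] [/= [bt bp] nd] t' t'01 tt' t01'.
  have b1 : ball (t0, p0) d (t, p) by split=> /=; [apply: le_ball bt|apply: le_ball bp]; rewrite ler_pdivrMr // ler_pMr // ler1n.
  have b2 : ball (t0, p0) d (t', p).
    split=> /=; last by apply: le_ball bp; rewrite ler_pdivrMr // ler_pMr // ler1n.
    rewrite (splitr d); apply: ball_triangle bt _.
    by rewrite /ball /= distrC (le_lt_trans tt').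
  have [/= Ut Gt] := hd _ b1; have [/= Ut' Gt'] := hd _ b2.
  exists (G (t', p) - G (t, p)).
    by rewrite (le_lt_trans (ler_normB _ _)) // [ltRHS]splitr ltrD // mul1r.
  by rewrite tprojB !hG // /in_chart !tlogK /= opprB addrA subrK.
exists N => t t' p t01 t'01 tt'.
have [l ll pl] := lattice_reduce_norm p.
have := hN N (leqnn N) (t, p - l) _ t' t'01 tt' t01.
rewrite /= -(tproj_lattice (p - l) ll) subrK; apply.
by split=> //=; rewrite in_itv.
Qed.

(** Cut the time interval in pieces during which the points of the torus move by less than 1, and
    add up the displacements, read off by tlog. They depend on the point of the torus only, whence
    the behaviour under the lattice, and they are odd if the isotopy is equivariant. *)
Theorem lift_isotopy : exists Psi : R * E -> E,
  [/\ smooth Psi, forall p, Psi (0, p) = p,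
      forall s p, tproj (Psi (s, p)) = psi (chi s) (tproj p),
      forall s p l, l \in lattice R -> Psi (s, p + l) = Psi (s, p) + l &
      (forall t, 0 <= t <= 1 -> equivariant (psi t)) ->
        forall s p, Psi (s, - p) = - Psi (s, p)].
Proof.
have [N hN] := uniform_step.
pose D (k : nat) (z : R * E) : T := psi (chi z.1 * (k.+1%:R / N.+1%:R)) (tproj z.2) - psi (chi z.1 * (k%:R / N.+1%:R)) (tproj z.2).
have in01 (k : nat) s : (k <= N.+1)%N -> 0 <= chi s * (k%:R / N.+1%:R) <= 1.
  move=> kN; have /andP[c0 c1] := chi01 s.
  have r0 : 0 <= k%:R / N.+1%:R :> R by rewrite divr_ge0.
  by rewrite mulr_ge0 //= mulr_ile1 // ler_pdivrMr ?ltr0n // mul1r ler_nat.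
have tD k : (k <= N.+1)%N -> tsmooth (fun z : R * E => psi (chi z.1 * (k%:R / N.+1%:R)) (tproj z.2)).
  move=> kN; apply: (@tsmooth_comp _ _ _ _ _ _ _ (fun z : R * E => psi z.1 (tproj z.2))
    (fun z => (chi z.1 * (k%:R / N.+1%:R), z.2)) (frame_real_pair (@frame_rV R 2)) psi_smooth).
    apply: (@smooth_pair _ (R * E)%type R E (fun z => chi z.1 * (k%:R / N.+1%:R)) snd); last exact: smooth_snd.
    under eq_fun do rewrite mulrC.
    apply: (smooth_mul (F := fun=> k%:R / N.+1%:R)); first exact: smooth_cst.
    exact: smooth_comp smooth_chi (@smooth_fst _ _ _).
  by move=> z /=; exact: in01.
have Dsmall k z : (k < N.+1)%N -> exists2 u : E, `|u| < 1 & D k z = tproj u.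
  move=> kN; apply: hN; [exact/in01/ltnW|exact: in01|].
  rewrite -mulrBr -mulrBl -natrB // subSnn mul1r normrM.
  have /andP[c0 c1] := chi01 z.1.
  by rewrite (ger0_norm c0) ger0_norm ?invr_ge0 // ler_piMl ?invr_ge0.
exists (fun z => z.2 + \sum_(k < N.+1) tlog (D k z)); split.
- apply: smooth_add; first exact: smooth_snd.
  apply: smooth_sum => k; apply: smooth_tlog; last by move=> z; exact: Dsmall.
  by apply: tsmooth_sub; apply: tD => //; exact: ltnW.
- move=> p /=; rewrite big1 ?addr0 // => k _.
  rewrite /D chi0 !mul0r psi0 subrr -(tproj0 R) tlog_small // normr0; exact: pi_gt0.
- move=> s p /=.
  have H m : (m <= N.+1)%N -> tproj (p + \sum_(k < m) tlog (D k (s, p))) = psi (chi s * (m%:R / N.+1%:R)) (tproj p).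
    elim: m => [|m IH] mN; first by rewrite big_ord0 addr0 mul0r mulr0 psi0.
    by rewrite big_ord_recr /= addrA tprojD tlogK IH ?(ltnW mN) // /D /= addrC subrK.
  by rewrite H // divff ?mulr1 // pnatr_eq0.
- move=> s p l ll /=; rewrite addrAC; congr (_ + _ + _).
  by apply: eq_bigr => k _; rewrite /D /= tproj_lattice.
move=> eq s p /=; rewrite opprD -sumrN; congr (_ + _); apply: eq_bigr => k _.
have [u u1 Du] := Dsmall k (s, p) (ltn_ord k).
have u1' : `|u| < pi by rewrite (lt_le_trans u1) // (le_trans _ (pi_ge2 R)) // ler1n.
have -> : D k (s, - p) = - D k (s, p).
  rewrite /D /= tprojN (eq _ (in01 k.+1 s (ltn_ord k))) (eq _ (in01 k s (ltnW (ltn_ord k)))).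
  by rewrite opprD.
by rewrite Du -tprojN !tlog_small // normrN.
Qed.

End LiftIsotopy.

(** * The velocity field of an area-preserving flow *)

Section VelocityField.
Variable R : realType.
Local Notation E := 'rV[R]_2.
Local Notation T := (torus R).
Local Notation basis j := (delta_mx 0 j : E).
Local Notation V := (R * E)%type.
Local Notation ddt f := ('D_((1, 0) : V) f).

Lemma det2 (A : 'M[R]_2) : \det A = A 0 0 * A 1 1 - A 0 1 * A 1 0.
Proof.
rewrite (expand_det_row _ 0) big_ord_recl big_ord1 /cofactor !det_mx11 !mxE /=.
transitivity (A 0 0 * ((-1) ^+ 0 * A 1 1) + A 0 1 * ((-1) ^+ 1 * A 1 0)); last by ring.
by congr (A _ _ * (_ * A _ _) + A _ _ * (_ * A _ _)); exact/val_inj.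
Qed.

Lemma basis_sum (u : E) : u = u 0 0 *: basis 0 + u 0 1 *: basis 1.
Proof. by rewrite {1}(row_sum_delta u) big_ord_recl big_ord1; congr (_ + _ *: delta_mx _ _); [congr (u _ _)|]; exact/val_inj. Qed.

Lemma slice_derive (W : normedModType R) (F : V -> W) s p v :
  'D_v (fun p => F (s, p)) p = 'D_(0, v) F (s, p).
Proof.
apply: (@derive_line _ _ _ _ F (fun p => (s, p))) => h.
by rewrite -[RHS]/(h * 0 + s, h *: v + p) mulr0 add0r.
Qed.

Lemma smooth_slice (W : normedModType R) (F : V -> W) s : smooth F -> smooth (fun p => F (s, p)).
Proof.
move=> sF; apply: (smooth_comp sF (G := fun p : E => (s, p))).
by apply: smooth_pair; [exact: smooth_cst|exact: smooth_id].
Qed.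

Lemma derive_compose (V1 V2 W : normedModType R) (F : V2 -> W) (G : V1 -> V2) w z :
  differentiable G z -> differentiable F (G z) ->
  'D_w (fun z => F (G z)) z = 'D_('D_w G z) F (G z).
Proof.
move=> dG dF; rewrite (@deriveE _ _ _ (F \o G)); last exact: differentiable_comp.
by rewrite diff_comp // !deriveE.
Qed.

Lemma derive_det (V1 : normedModType R) (f g h k : V1 -> R) w z :
  smooth f -> smooth g -> smooth h -> smooth k ->
  'D_w (fun z => f z * g z - h z * k z) z =
    f z * 'D_w g z + g z * 'D_w f z - (h z * 'D_w k z + k z * 'D_w h z).
Proof.
move=> /(smooth_diff z)/diff_derivable sf /(smooth_diff z)/diff_derivable sg.
move=> /(smooth_diff z)/diff_derivable sh /(smooth_diff z)/diff_derivable sk.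
by rewrite (@deriveB _ _ _ (f * g) (h * k)) ?deriveM //; exact: derivableM.
Qed.

Variable Psi : V -> E.
Hypothesis sPsi : smooth Psi.
Let a (i j : 'I_2) (z : V) : R := 'D_((0, basis j) : V) Psi z 0 i.
Hypothesis detPsi : forall z, a 0 0 z * a 1 1 z - a 0 1 z * a 1 0 z = 1.

Let sa i j : smooth (a i j).
Proof. by apply: smooth_coord; exact: smooth_derive. Qed.

(** The preimage of v under the space derivative of Psi, by Cramer's rule. *)
Let adj (v : E) (z : V) : E := \row_i (if i == 0 then a 1 1 z * v 0 0 - a 0 1 z * v 0 1
  else a 0 0 z * v 0 1 - a 1 0 z * v 0 0).

Let adjE v z : adj v z = (a 1 1 z * v 0 0 - a 0 1 z * v 0 1) *: basis 0 +
  (a 0 0 z * v 0 1 - a 1 0 z * v 0 0) *: basis 1.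
Proof. by rewrite [LHS]basis_sum !mxE. Qed.

Let smooth_adj v : smooth (adj v).
Proof.
have -> : adj v = fun z => (v 0 0 * a 1 1 z - v 0 1 * a 0 1 z) *: basis 0 +
  (v 0 1 * a 0 0 z - v 0 0 * a 1 0 z) *: basis 1.
  by apply/funext => z; rewrite adjE; congr (_ *: _ + _ *: _); rewrite ![_ * v 0 _]mulrC.
have sm (c : R) i j : smooth (fun z => c * a i j z).
  by apply: (smooth_mul (F := fun=> c)); [exact: smooth_cst|exact: sa].
by apply: smooth_add; apply: smooth_mul; try exact: smooth_cst; apply: smooth_add => //; apply: smooth_opp.
Qed.

Let derive_adj v z : 'D_((0, adj v z) : V) Psi z = v.
Proof.
have dP : differentiable Psi z by exact: smooth_diff.
have -> : ((0, adj v z) : V) = (a 1 1 z * v 0 0 - a 0 1 z * v 0 1) *: ((0, basis 0) : V) +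
   (a 0 0 z * v 0 1 - a 1 0 z * v 0 0) *: ((0, basis 1) : V).
  rewrite adjE; set x := _ - _; set y := _ - _.
  by rewrite -[RHS]/(x * 0 + y * 0, x *: basis 0 + y *: basis 1) !mulr0 addr0.
have lin (x y : R) : 'D_(x *: ((0, basis 0) : V) + y *: ((0, basis 1) : V)) Psi z =
    x *: 'D_((0, basis 0) : V) Psi z + y *: 'D_((0, basis 1) : V) Psi z.
  by rewrite !deriveE // linearD !linearZ.
rewrite lin; set d0 := 'D_((0, basis 0) : V) Psi z; set d1 := 'D_((0, basis 1) : V) Psi z.
have a0 i : a i 0 z = d0 0 i by [].
have a1 i : a i 1 z = d1 0 i by [].
have := detPsi z; rewrite !a0 !a1; clearbody d0 d1 => dt.
apply/rowP => i; rewrite !mxE -[RHS]mul1r -{}dt.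
have [->|->] := ord2 i.
  by ring.
by ring.
Qed.

Let chain_slice (F : E -> E) (G : V -> E) s p w : smooth F ->
  (forall q, F (Psi (s, q)) = G (s, q)) ->
  'D_((0, w) : V) G (s, p) = 'D_('D_((0, w) : V) Psi (s, p)) F (Psi (s, p)).
Proof.
move=> sF FG; rewrite -slice_derive.
have -> : (fun p => G (s, p)) = fun q => F (Psi (s, q)) by apply/funext => q.
rewrite (@derive_compose _ _ _ F (fun q => Psi (s, q))); [|exact/smooth_diff/smooth_slice|exact: smooth_diff].
by rewrite slice_derive.
Qed.

Variable X : R -> E -> E.
Hypothesis sX : forall s, smooth (X s).
Hypothesis XPsi : forall s p, X s (Psi (s, p)) = ddt Psi (s, p).

(** Differentiating X s (Psi (s, p)) = ddt Psi (s, p) in space and inverting the space derivative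
    of Psi expresses the derivatives of X s along Psi by jointly smooth functions; this is how
    bounds uniform in s arise. *)
Lemma field_derivatives (vs : seq E) : exists2 G : V -> E, smooth G &
  forall s p, iterD vs (X s) (Psi (s, p)) = G (s, p).
Proof.
elim: vs => [|v vs [G sG hG]].
  by exists (ddt Psi); [exact: smooth_derive|exact: XPsi].
exists (fun z => (tang G (z, (0, adj v z))).2) => [|s p].
  apply: (smooth_comp (@smooth_snd _ _ _) (G := fun z => tang G (z, (0, adj v z)))).
  apply: (smooth_comp (smooth_tang sG) (G := fun z => (z, (0, adj v z)))).
  apply: smooth_pair; first exact: smooth_id.
  by apply: (@smooth_pair _ V R E (fun=> 0)); [exact: smooth_cst|exact: smooth_adj].
by rewrite /tang /= (chain_slice _ _ (smooth_iterD vs (sX s)) (hG s)) derive_adj.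
Qed.

(** Liouville: the time derivative of the determinant, which is 0, equals the determinant times
    the divergence. *)
Lemma field_div_free s p : \sum_l ('D_(basis l) (X s) (Psi (s, p))) 0 l = 0.
Proof.
pose x (i k : 'I_2) := 'D_(basis k) (X s) (Psi (s, p)) 0 i.
have da i j : ddt (a i j) (s, p) = x i 0 * a 0 j (s, p) + x i 1 * a 1 j (s, p).
  rewrite derive_coord; last exact/smooth_diff/smooth_derive.
  rewrite (@Schwarz _ _ _ Psi (s, p) (0, basis j) (1, 0)); first last.
  - by apply/smooth_diff/smooth_derive.
  - by apply/smooth_diff/smooth_derive.
  - by move=> y; exact: smooth_diff.
  rewrite (chain_slice _ _ (sX s) (XPsi s)).
  have dX := smooth_diff (Psi (s, p)) (sX s).
  set d := 'D_((0, basis j) : V) Psi (s, p).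
  have aj k : a k j (s, p) = d 0 k by [].
  rewrite !aj; clearbody d; rewrite (deriveE _ dX) {1}(basis_sum d) linearD !linearZ /= -!(deriveE _ dX).
  rewrite /x; set u := 'D_(basis 0) _ _; set v := 'D_(basis 1) _ _; clearbody u v.
  by rewrite !mxE ![_ * d 0 _]mulrC.
have := congr1 (fun f => ddt f (s, p)) (funext detPsi).
rewrite derive_cst.
rewrite (derive_det _ _ (sa 0 0) (sa 1 1) (sa 0 1) (sa 1 0)) !da => h.
rewrite big_ord_recl big_ord1.
have -> : lift ord0 ord0 = 1 :> 'I_2 by exact/val_inj.
suff : x 0 0 + x 1 1 = 0 by [].
move: h (detPsi (s, p)).
move: (x 0 0) (x 0 1) (x 1 0) (x 1 1) (a 0 0 (s, p)) (a 0 1 (s, p)) (a 1 0 (s, p)) (a 1 1 (s, p)).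
move=> x00 x01 x10 x11 a00 a01 a10 a11 h d1.
by rewrite -[LHS]mulr1 -[X in _ * X]d1 -[RHS]h; ring.
Qed.

End VelocityField.

(** * Shears of the torus *)

Section TorusShears.
Variable R : realType.
Local Notation E := 'rV[R]_2.
Local Notation T := (torus R).

Lemma tproj_open (p : E) (B : set E) : nbhs p B -> nbhs (tproj p : T) (@tproj R @` B).
Proof.
rewrite nbhsE => -[V [oV Vp] VB]; rewrite nbhsE; exists (@tproj R @` V).
  split; last by exists p.
  change (open (@tproj R @^-1` (@tproj R @` V))).
  rewrite openE => q [b Vb /tproj_eq bq].
  have : nbhs q ((fun x => x + (b - q)) @^-1` V).
    have c : {for q, continuous (fun x : E => x + (b - q))}.
      by apply: continuousD => //; exact: cst_continuous.
    by apply: c; apply: open_nbhs_nbhs; split=> //; rewrite addrC subrK.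
  apply: filterS => x Vx; exists (x + (b - q)) => //.
  by apply/tproj_eq; rewrite addrAC subrr add0r.
by move=> _ [b Vb <-]; exists b => //; exact: VB.
Qed.

Lemma continuous_tproj : continuous (@tproj R).
Proof. exact: pi_continuous. Qed.

(** The projection is open, so a neighbourhood upstairs projects to one of the torus. *)
Lemma descent_continuous (F : R * E -> E) (f : R -> T -> T) : continuous F ->
  (forall t p, f t (tproj p) = tproj (F (t, p))) -> continuous (fun z : R * T => f z.1 z.2).
Proof.
move=> cF fF [t x] O /=; rewrite -(tlogK x) fF => nO.
have : nbhs (t, tlog x) (F @^-1` (@tproj R @^-1` O)) by apply: cF; exact: continuous_tproj.
move=> [[A B] /= [nA nB] AB].
exists (A, @tproj R @` B); first by split=> //=; exact: tproj_open.
move=> [t' _] /= [At' [b Bb <-]].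
by have := AB (t', b) (conj At' Bb); rewrite /= fF.
Qed.

Lemma lift_diffeo (f : T -> T) (F G : E -> E) : smooth F -> smooth G -> cancel F G -> cancel G F ->
  (forall p l, l \in lattice R -> F (p + l) = F p + l) ->
  (forall p, f (tproj p) = tproj (F p)) -> diffeo f.
Proof.
move=> sF sG FG GF Fl fF.
have Gl p l : l \in lattice R -> G (p + l) = G p + l.
  by move=> ll; apply: (can_inj FG); rewrite Fl // !GF.
have torus_smoothE (h : T -> T) (H : E -> E) : smooth H -> (forall p, h (tproj p) = tproj (H p)) ->
    torus_smooth setT (h \o @tproj R).
  move=> sH hH; rewrite (_ : h \o _ = fun p => tproj (H p)); first exact: lift_torus_smooth.
  by apply/funext => p; rewrite /= hH.
split; first exact: torus_smoothE sF fF.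
have gG p : tproj (G (tlog (tproj p : T))) = tproj (G p) :> T by exact: tproj_descent.
exists (fun x => tproj (G (tlog x))); split; last exact: torus_smoothE sG gG.
- by move=> x; rewrite -{1}(tlogK x) fF gG FG tlogK.
- by move=> x; rewrite fF GF tlogK.
Qed.

Definition shear_flow (u c : E) (t : R) (p : E) : E := p + t *: shear u c p.

(** The value of u.p does not change along the direction c; hence the flow is affine in time. *)
Lemma shear_flow_shear u c t p : dot u c = 0 -> shear u c (shear_flow u c t p) = shear u c p.
Proof.
move=> uc; rewrite /shear /shear_flow /shear.
have -> : dot u (p + t *: (sin (dot u p) *: c)) = dot u p.
  rewrite addrC scalerA (dot_linear u) uc.
  by rewrite scaler0 add0r.
by [].
Qed.

Lemma shear_flowK u c t : dot u c = 0 -> cancel (shear_flow u c t) (shear_flow u c (- t)).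
Proof. by move=> uc p; rewrite {1}/shear_flow shear_flow_shear // /shear_flow scaleNr addrK. Qed.

Lemma shear_flow_lattice (w : 'rV[int]_2) c t p l : l \in lattice R ->
  shear_flow (of_int R w) c t (p + l) = shear_flow (of_int R w) c t p + l.
Proof.
move=> ll; rewrite /shear_flow /shear; have [-> // _] := periodic_trig_dot R w.
by rewrite addrAC.
Qed.

Lemma shear_flow_opp u c t p : shear_flow u c t (- p) = - shear_flow u c t p.
Proof. by rewrite /shear_flow /shear dotNr sinN scaleNr scalerN opprD. Qed.

Lemma smooth_shear_flow u c : smooth (fun z : R * E => shear_flow u c z.1 z.2).
Proof.
apply: smooth_add; first exact: smooth_snd.
apply: smooth_mul; first exact: smooth_fst.
exact: (smooth_comp (smooth_shear u c) (@smooth_snd _ _ _)).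
Qed.

Lemma smooth_shear_flow_at u c t : smooth (shear_flow u c t).
Proof. exact: (smooth_slice t (smooth_shear_flow u c)). Qed.

Definition torus_shear (u c : E) (t : R) (x : T) : T := tproj (shear_flow u c t (tlog x)).

Section IntegralShear.
Variables (w : 'rV[int]_2) (c : E).
Local Notation u := (of_int R w).
Hypothesis uc : dot u c = 0.

Lemma torus_shear_lift t p : torus_shear u c t (tproj p) = tproj (shear_flow u c t p).
Proof. by apply: tproj_descent => q l; exact: shear_flow_lattice. Qed.

Lemma torus_shear_equivariant t : equivariant (torus_shear u c t).
Proof. by move=> x; rewrite -(tlogK x) -tprojN !torus_shear_lift shear_flow_opp tprojN. Qed.

Lemma torus_shear_diffeo t : diffeo (torus_shear u c t).
Proof.
apply: (@lift_diffeo _ (shear_flow u c t) (shear_flow u c (- t))).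
- exact: smooth_shear_flow_at.
- exact: smooth_shear_flow_at.
- exact: shear_flowK.
- by have := shear_flowK (- t) uc; rewrite opprK.
- by move=> p l; exact: shear_flow_lattice.
- exact: torus_shear_lift.
Qed.

Lemma derive_in_chart (f : T -> T) (F : E -> E) p v : smooth F -> (forall p, f (tproj p) = tproj (F p)) ->
  differentiable (in_chart (f \o @tproj R) p) p /\ 'D_v (in_chart (f \o @tproj R) p) p = 'D_v F p.
Proof.
move=> sF fF; have dF := smooth_diff p sF.
have n : \forall x \near p, in_chart (f \o @tproj R) p x = F x - F p.
  rewrite (_ : f \o _ = fun p => tproj (F p)); last by apply/funext => q /=.
  exact: in_chart_lift (differentiable_continuous dF).
split.
  apply: (@near_eq_differentiable _ _ _ (fun x => F x - F p)); last by apply: differentiableB.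
  by apply: filterS n => x ->.
rewrite (near_eq_derive v n) deriveB; [|exact: diff_derivable|exact: derivable_cst].
by rewrite derive_cst subr0.
Qed.

Lemma jacobian_lift (f : T -> T) (F : E -> E) p i j : smooth F -> (forall p, f (tproj p) = tproj (F p)) ->
  'J (in_chart (f \o @tproj R) p) p i j = 'D_(delta_mx 0 i) F p 0 j.
Proof.
move=> sF fF; have [d D] := derive_in_chart p (delta_mx 0 i) sF fF.
by rewrite /jacobian /lin1_mx mxE -deriveE // D.
Qed.

(** The derivative of the lift is the identity plus a matrix of rank one whose trace is
    t cos(u.p) (u.c) = 0. *)
Lemma torus_shear_area t : area_preserving (torus_shear u c t).
Proof.
move=> p; rewrite det2 !(@jacobian_lift _ (shear_flow u c t)) //; try exact: smooth_shear_flow_at;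
  try exact: torus_shear_lift.
have D j : 'D_(delta_mx 0 j) (shear_flow u c t) p =
    delta_mx 0 j + (t * (u 0 j * cos (dot u p))) *: c.
  have ds : differentiable (shear u c) p by exact/smooth_diff/smooth_shear.
  rewrite /shear_flow deriveD; [|exact: derivable_id|by apply: diff_derivable; exact: differentiableZ].
  rewrite derive_id deriveZ; last exact: diff_derivable.
  congr (_ + _); rewrite -scalerA; congr (_ *: _).
  rewrite -dot_basis -derive_sin_dot /shear; apply/rowP => i.
  rewrite -derive_coord // mxE.
  rewrite -[RHS]mulrC -derive_scale_smooth; last exact: smooth_sin_dot.
  by apply: near_eq_derive; apply: (@nearW _ (nbhs p)) => x; rewrite mxE mulrC.
rewrite !D.
set k0 := t * _; set k1 := t * _.
have e0 : k0 = t * cos (dot u p) * u 0 0 by rewrite /k0; ring.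
have e1 : k1 = t * cos (dot u p) * u 0 1 by rewrite /k1; ring.
rewrite {}e0 {}e1; set C := t * cos _.
have := uc; rewrite dot2.
have mx (i j : 'I_2) a : (delta_mx 0 i + a *: c) 0 j = (i == j)%:R + a * c 0 j :> R.
  by rewrite !mxE eqxx eq_sym.
rewrite !mx.
move: (u 0 0) (u 0 1) (c 0 0) (c 0 1) => u0 u1 c0 c1 h.
transitivity (1 + C * (u0 * c0 + u1 * c1)); last by rewrite h mulr0 addr0.
by rewrite /=; ring.
Qed.

End IntegralShear.
End TorusShears.

(** * Shears as shearing isotopies *)

Section ShearingIsotopies.
Variable R : realType.
Local Notation E := 'rV[R]_2.
Local Notation T := (torus R).

Lemma smooth_scaled_flow (u c : E) (a : R) :
  smooth (fun z : R * E => shear_flow u c (a * z.1) z.2).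
Proof.
apply: (@smooth_comp _ _ _ _ (fun z : R * E => shear_flow u c z.1 z.2)
  (fun z : R * E => (a * z.1, z.2))); first exact: smooth_shear_flow.
apply: smooth_pair; last exact: smooth_snd.
by apply: (smooth_mul (F := fun=> a)); [exact: smooth_cst|exact: smooth_fst].
Qed.

Definition rot (w : 'rV[int]_2) : 'rV[int]_2 := \row_j (if j == 0 then - w 0 1 else w 0 0).

(** A shearing isotopy has an integral direction, whereas c is only orthogonal to w: it is a real
    multiple of the quarter turn of w, and the factor goes into the profile f. *)
Lemma orthogonal_rot (w : 'rV[int]_2) (c : E) : w != 0 -> dot (of_int R w) c = 0 ->
  exists al : R, c = al *: of_int R (rot w).
Proof.
move=> w0; rewrite dot2 !mxE; set a := (w 0 0)%:~R; set b := (w 0 1)%:~R => h.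
have n0 : a ^+ 2 + b ^+ 2 != 0.
  rewrite paddr_eq0 ?sqr_ge0 // !sqrf_eq0 !intr_eq0; apply: contra w0 => /andP[/eqP h0 /eqP h1].
  by apply/eqP/rowP => j; rewrite mxE; have [->|->] := ord2 j.
exists ((a * c 0 1 - b * c 0 0) / (a ^+ 2 + b ^+ 2)); apply/rowP => j; rewrite !mxE.
have [->|->] := ord2 j; rewrite /= ?mulrNz -/a -/b; apply: (mulIf n0); rewrite [RHS]mulrAC divfK //.
  transitivity (b ^+ 2 * c 0 0 + a * (a * c 0 0)); first ring.
  have -> : a * c 0 0 = - (b * c 0 1) by lra.
  ring.
transitivity (a ^+ 2 * c 0 1 + b * (b * c 0 1)); first ring.
have -> : b * c 0 1 = - (a * c 0 0) by lra.
ring.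
Qed.

Lemma torus_shear_isotopy (w : 'rV[int]_2) (c : E) (a : R) : dot (of_int R w) c = 0 ->
  shearing_isotopy (fun s => torus_shear (of_int R w) c (a * s)).
Proof.
move=> wc; have sF := smooth_scaled_flow (of_int R w) c a.
split.
- split; first split.
  + by apply/funext => x; rewrite /torus_shear /shear_flow mulr0 scale0r addr0 tlogK.
  + by move=> t _; exact: torus_shear_diffeo.
  + apply: continuous_subspaceT.
    apply: (@descent_continuous _ (fun z => shear_flow (of_int R w) c (a * z.1) z.2)
      (fun s => torus_shear (of_int R w) c (a * s))).
      by move=> z; exact/differentiable_continuous/smooth_diff.
    by move=> t p; exact: torus_shear_lift.
- rewrite /= (_ : (fun z : R * E => torus_shear (of_int R w) c (a * z.1) (tproj z.2)) =
      fun z => tproj (shear_flow (of_int R w) c (a * z.1) z.2)); first exact: lift_torus_smooth.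
  by apply/funext => z; exact: torus_shear_lift.
- by move=> t _; exact: torus_shear_area.
(* for w = 0 the isotopy is constant: any nonzero frequency serves, with profile 0 *)
have [w0|w0] := eqVneq w 0.
  exists 0, (delta_mx 0 0), (fun=> 0); split.
  - by rewrite dot2 !mxE !mul0r.
  - by apply/eqP => /rowP/(_ 0); rewrite !mxE.
  - by apply: tame_smooth => // k; exact: smooth_cst.
  - by [].
  move=> s p _; rewrite torus_shear_lift // /shear_flow /shear w0.
  rewrite (_ : of_int R 0 = 0); last by apply/rowP => i; rewrite !mxE.
  by rewrite dot0l sin0 mulr0 !scale0r scaler0.
have [al cE] := orthogonal_rot w0 wc.
exists (rot w), w, (fun x => a * al * sin x); split=> //.
- by rewrite dot2 !mxE /=; ring.
- apply: tame_smooth => // k.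
  by move: k; apply: (smooth_mul (F := fun=> a * al)); [exact: smooth_cst|exact: smooth_sin].
- by move=> x; rewrite mulr_natl sinD2pi.
move=> s p _; rewrite torus_shear_lift // /shear_flow /shear {1}cE !scalerA.
by congr (tproj (_ + _ *: _)); ring.
Qed.
End ShearingIsotopies.

(** * The C^r distance through lifts *)

Section CrDistance.
Variable R : realType.
Local Notation E := 'rV[R]_2.
Local Notation T := (torus R).

Lemma iterD_near (V W : normedModType R) (f g : V -> W) (vs : seq V) (a : V) :
  (\forall x \near a, f x = g x) -> \forall x \near a, iterD vs f x = iterD vs g x.
Proof.
move=> fg; elim: vs => [//|v vs IH] /=.
by have := near_join IH; apply: filterS => x; exact: near_eq_derive.
Qed.

Lemma iterD_subr_cst (V W : normedModType R) (F : V -> W) c v vs : smooth F ->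
  iterD (rcons vs v) (fun x => F x - c) = iterD (rcons vs v) F.
Proof.
move=> sF; elim: vs => [|u vs /= -> //] /=; apply/funext => x.
by rewrite deriveB ?derive_cst ?subr0 //; exact/diff_derivable/smooth_diff.
Qed.

(** In the chart centred at f p the map f reads F - F p near p, and a derivative of positive order
    ignores the constant. *)
Lemma Dtorus_lift (f : T -> T) (F : E -> E) p v vs : smooth F ->
  (forall p, f (tproj p) = tproj (F p)) -> Dtorus f p (rcons vs v) = iterD (rcons vs v) F p.
Proof.
move=> sF fF; rewrite /Dtorus -(iterD_subr_cst (F p) v vs sF).
rewrite (_ : f \o _ = fun p => tproj (F p)); last by apply/funext => q /=.
have n := in_chart_lift (differentiable_continuous (smooth_diff p sF)).
exact: (nbhs_singleton (iterD_near (rcons vs v) n)).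
Qed.

Lemma periodic_iterD_lift (F : E -> E) v vs : smooth F ->
  (forall p l, l \in lattice R -> F (p + l) = F p + l) -> lattice_periodic (iterD (rcons vs v) F).
Proof.
move=> sF Fl; elim: vs => [|u vs IH] /=; last exact: periodic_derive.
move=> p l ll; have fE : F \o (fun x => x + l) = fun x => F x - (- l).
  by apply/funext => x /=; rewrite Fl // opprK.
have /= E0 := iterD_subr_cst (- l) v [::] sF; rewrite -[RHS](congr1 (@^~ p) E0) -fE.
by rewrite (@derive_line _ _ _ _ F (fun x => x + l) p v v) // => h; rewrite addrA.
Qed.

Lemma enorm_ge (v : E) : `|v| <= enorm v.
Proof.
apply: norm_rV_le => [|i]; first exact: sqrtr_ge0.
rewrite -sqrtr_sqr ler_wsqrtr // dot2.
by have [->|->] := ord2 i; rewrite -!expr2 ?lerDl ?lerDr sqr_ge0.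
Qed.

Lemma enorm_le (v : E) : enorm v <= 2 * `|v|.
Proof.
rewrite -[leRHS]ger0_norm ?mulr_ge0 // -sqrtr_sqr ler_wsqrtr //.
apply: le_trans (ler_norm _) _; apply: le_trans (dot_le _ _) _.
have := normr_ge0 v; nra.
Qed.

Lemma tdist_le (x y : T) (u : E) : tproj u = x - y -> tdist x y <= enorm u.
Proof.
move=> ux; apply: ge_inf; last by exists u.
by exists 0 => _ [v _ <-]; exact: sqrtr_ge0.
Qed.

(** By periodicity, base points may be taken in the ball of radius pi, which contains the unit
    vectors as well. The factor 2 compares the Euclidean norm with the maximum norm, and there are
    r + 1 orders of derivation. *)
Lemma Crdist_lift r (f g : T -> T) (F G : E -> E) (e : R) : smooth F -> smooth G ->
  (forall p, f (tproj p) = tproj (F p)) -> (forall p, g (tproj p) = tproj (G p)) ->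
  (forall p l, l \in lattice R -> F (p + l) = F p + l) ->
  (forall p l, l \in lattice R -> G (p + l) = G p + l) -> 
  (forall z : TE r E, `|z| <= pi -> `|itang F z - itang G z| <= e) ->
  (Crdist r f g <= (2 * e * r.+1%:R)%:E)%E.
Proof.
move=> sF sG fF gG Fl Gl FG; have close := iterD_itang (sF r) (sG r) FG.
rewrite /Crdist -[r.+1%:R]natr1 mulrDr mulr1 [X in X%:E]addrC EFinD; apply: leeD.
  apply: ge_ereal_sup => _ [x _ <-]; rewrite lee_fin -(tlogK x) fF gG.
  apply: le_trans (tdist_le (tprojB _ _)) _; apply: le_trans (enorm_le _) _.
  by rewrite ler_pM2l //; apply: (close [::]) => //; exact: tlog_norm.
have -> : (2 * e * r%:R)%:E = (\sum_(1 <= l < r.+1) (2 * e)%:E)%E.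
  by rewrite sumEFin sumr_const_nat subSS subn0 mulr_natr.
rewrite !big_nat; apply: lee_sum => l /andP[l0 lr].
apply: ge_ereal_sup => _ [p _ <-]; apply: ge_ereal_sup => _ [vs vs1 <-].
have vsz : size vs = l := size_tuple vs.
have vB v : v \in (vs : seq E) -> `|v| <= pi.
  move=> /tnthP[i ->]; apply: le_trans (enorm_ge _) _; apply: le_trans (vs1 i) _.
  by apply: le_trans (pi_ge2 R); rewrite ler1n.
have [q ql pq] := lattice_reduce_norm p.
move: vsz vB; rewrite lee_fin; case/lastP: (vs : seq E) => [|us u] vsz vB; first by rewrite -vsz in l0.
rewrite (Dtorus_lift p u us sF fF) (Dtorus_lift p u us sG gG).
rewrite -(subrK q p) (periodic_iterD_lift u us sF Fl) // (periodic_iterD_lift u us sG Gl) //.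
apply: le_trans (enorm_le _) _; rewrite ler_pM2l //; apply: close => //.
by rewrite vsz.
Qed.
End CrDistance.

(** * The field of an equivariant area-preserving isotopy *)

Section IsotopyField.
Variable R : realType.
Local Notation E := 'rV[R]_2.
Local Notation T := (torus R).
Local Notation basis j := (delta_mx 0 j : E).
Local Notation V := (R * E)%type.
Local Notation ddt f := ('D_((1, 0) : V) f).

Variable psi : R -> T -> T.
Hypothesis psi_isotopy : smooth_isotopy psi.
Hypothesis psi_area : forall t : R, 0 <= t <= 1 -> area_preserving (psi t).
Hypothesis psi_equiv : forall t : R, 0 <= t <= 1 -> equivariant (psi t).

(** With W s p the time derivative of the lift, X s is W s composed with the inverse of the time
    chi s map of the isotopy; as W s is periodic, it makes sense on the torus. On a compact
    set of (s, p) the images Psi (s, p) reach all points of the torus, which transfers properties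
    known along Psi to all of the plane. *)
Theorem isotopy_field : exists (Psi : V -> E) (X : R -> E -> E),
  [/\ smooth Psi, forall p, Psi (0, p) = p,
      forall s p, tproj (Psi (s, p)) = psi (chi s) (tproj p),
      forall s p l, l \in lattice R -> Psi (s, p + l) = Psi (s, p) + l &
      forall s p, X s (Psi (s, p)) = ddt Psi (s, p)] /\
  [/\ forall s, smooth (X s), forall s, lattice_periodic (X s),
      forall s y, X s (- y) = - X s y,
      forall s y, \sum_l ('D_(basis l) (X s) y) 0 l = 0 &
      forall js : seq 'I_2, exists C : R, forall s y, 0 <= s <= pi ->
        `|iterD [seq basis j | j <- js] (X s) y| <= C].
Proof.
have [[psi0 psi_diffeo _] psi_smooth] := psi_isotopy.
have [Psi [sPsi Psi0 psiE Psil Psiopp]] := lift_isotopy psi0 psi_smooth.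
have {}Psiopp := Psiopp psi_equiv.
have /choice[g hg] : forall s, exists g, [/\ cancel (psi (chi s)) g, cancel g (psi (chi s)) &
    torus_smooth setT (g \o @tproj R)].
  by move=> s; have [_] := psi_diffeo _ (chi01 s).
pose W s p := ddt Psi (s, p).
have sW s : smooth (W s) by exact/smooth_slice/smooth_derive.
have Wl s : lattice_periodic (W s).
  move=> p l ll; rewrite /W.
  have /= E0 := iterD_subr_cst (- l) ((1, 0) : V) [::] sPsi.
  rewrite -[RHS](congr1 (@^~ (s, p)) E0).
  have -> : (fun z => Psi z - - l) = Psi \o (fun z => (z.1, z.2 + l)).
    by apply/funext => -[s' p'] /=; rewrite Psil // opprK.
  rewrite (@derive_line _ _ _ _ Psi (fun z : V => (z.1, z.2 + l)) (s, p) (1, 0) (1, 0)) // => h.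
  by rewrite -[RHS]/(h * 1 + s, h *: 0 + (p + l)) /= !scaler0 !add0r.
have Wopp s p : W s (- p) = - W s p.
  rewrite /W -deriveN; last exact/diff_derivable/smooth_diff.
  have -> : - Psi = Psi \o (fun z => (z.1, - z.2)).
    by apply/funext => -[s' p'] /=; rewrite Psiopp.
  rewrite (@derive_line _ _ _ _ Psi (fun z : V => (z.1, - z.2)) (s, p) (1, 0) (1, 0)) // => h.
  by rewrite -[RHS]/(h * 1 + s, h *: 0 + - p) /= !scaler0 !add0r.
pose X s y := W s (tlog (g s (tproj y))).
have XPsi s p : X s (Psi (s, p)) = ddt Psi (s, p).
  have [gK _ _] := hg s; rewrite /X psiE gK -/(W s p).
  by apply: periodic_tproj => //; rewrite tlogK.
have sX s : smooth (X s).
  apply: smooth_tlog_periodic => //; have [_ _ tg] := hg s.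
  exact: (tsmooth_comp (q := id) (@frame_rV R 2) tg (@smooth_id _ _)).
have Xl s : lattice_periodic (X s) by move=> p l ll; rewrite /X tproj_lattice.
have gopp s x : g s (- x) = - g s x.
  have [gK Kg _] := hg s; apply: (can_inj gK).
  by rewrite Kg (psi_equiv (chi01 s)) Kg.
have Xopp s y : X s (- y) = - X s y.
  rewrite /X tprojN gopp -Wopp; apply: periodic_tproj => //.
  by rewrite tlogK tprojN tlogK.
have detPsi z : 'D_((0, basis 0) : V) Psi z 0 0 * 'D_((0, basis 1) : V) Psi z 0 1 -
    'D_((0, basis 1) : V) Psi z 0 0 * 'D_((0, basis 0) : V) Psi z 0 1 = 1.
  case: z => s p; have := psi_area (chi01 s) p; rewrite det2.
  rewrite !(@jacobian_lift _ _ (fun p => Psi (s, p))) => //; try exact: smooth_slice.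
  by rewrite !slice_derive => <-; rewrite [X in _ - X]mulrC.
(* every point is Psi (s, p) up to the lattice, with p in a fixed ball *)
have reach s y : exists2 p, `|p| <= pi & tproj (Psi (s, p)) = tproj y :> T.
  have [_ Kg _] := hg s; exists (tlog (g s (tproj y))); first exact: tlog_norm.
  by rewrite psiE tlogK Kg.
exists Psi, X; split; split=> //.
- move=> s y; have [p _ py] := reach s y.
  rewrite -(@periodic_tproj _ _ (fun y => \sum_l ('D_(basis l) (X s) y) 0 l) _ _ _ py).
    exact: (field_div_free sPsi detPsi sX XPsi).
  by move=> q l ll; apply: eq_bigr => i _; rewrite periodic_derive.
- move=> js; have [G sG hG] := field_derivatives sPsi detPsi sX XPsi [seq basis j | j <- js].
  have cK := compact_setX (@segment_compact R 0 pi) (@proper_rV R 2 pi).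
  have [C hC] := compact_bound cK (fun x => smooth_diff x sG).
  exists C => s y s0; have [p pp py] := reach s y.
  rewrite -(periodic_tproj (periodic_iterD _ (Xl s)) py) hG; by apply: hC; split.
Qed.
End IsotopyField.

(** * Paths of shears *)

Section ShearPaths.
Variable R : realType.
Local Notation E := 'rV[R]_2.
Local Notation T := (torus R).

Lemma eq_shear_steps (A A' : nat -> E -> E) h i p : (forall j, (j < i)%N -> A j = A' j) ->
  shear_steps A h i p = shear_steps A' h i p.
Proof.
elim: i => [//|i IH] AA /=; rewrite IH ?AA //.
by move=> j ji; apply: AA; exact: ltnW.
Qed.

(** The two approximations combined; the shears are numbered consecutively, with one amplitude h
    for all of them. *)
Theorem shear_splitting (Psi : R * E -> E) (X : R -> E -> E) :
  smooth Psi -> (forall p, Psi (0, p) = p) ->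
  (forall s p, X s (Psi (s, p)) = 'D_(1, 0) Psi (s, p)) ->
  (forall s, smooth (X s)) -> (forall s, lattice_periodic (X s)) ->
  (forall s y, X s (- y) = - X s y) ->
  (forall s y, \sum_l ('D_(delta_mx 0 l) (X s) y) 0 l = 0) ->
  (forall js : seq 'I_2, exists C : R, forall s y, 0 <= s <= pi ->
     `|iterD [seq delta_mx 0 j | j <- js] (X s) y| <= C) ->
  forall k (B e : R), 0 < e -> exists (M : nat) (h : R) (w : nat -> 'rV[int]_2) (c : nat -> E),
    [/\ (0 < M)%N, 0 < h, forall i, dot (of_int R (w i)) (c i) = 0 &
     let A i := shear (of_int R (w i)) (c i) in
     forall i t s (z : TE k E), (i < M)%N -> 0 <= t <= h ->
       pi / M%:R * i%:R <= s <= pi / M%:R * i.+1%:R -> `|z| <= B ->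
       `|itang (fun p => shear_steps A h i p + t *: A i (shear_steps A h i p)) z
         - itang (fun p => Psi (s, p)) z| <= e].
Proof.
move=> sPsi Psi0 XPsi sX Xl Xopp Xdiv Xbound k B e e0.
pose P (u c : E) := exists2 w, u = of_int R w & dot u c = 0.
pose I := {s : R | 0 <= s <= pi}.
(* the coefficients, given for s in [0, pi], are extended to all s by clamping *)
have clampP s : 0 <= Num.max 0 (Num.min pi s) <= (pi : R).
  by rewrite le_max lexx ge_max pi_ge0 ge_min lexx.
pose cl s : I := exist (fun s => is_true (0 <= s <= pi)) _ (clampP s).
have clE s : 0 <= s <= pi -> sval (cl s) = s by move=> /andP[s0 s1]; rewrite /= min_r // max_r.
have apX k' (B' e' : R) : 0 < e' -> exists m (u : nat -> E) (c : R -> nat -> E) (C : R),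
    [/\ (0 < m)%N, forall s j, 0 <= s <= pi -> `|c s j| <= C,
        forall s j, 0 <= s <= pi -> P (u j) (c s j) &
        forall s (z : TE k' E), 0 <= s <= pi -> `|z| <= B' ->
          `|itang (fun p => \sum_(j < m) shear (u j) (c s j) p) z - itang (X s) z| <= e'].
  move=> e'0.
  have [//|||||m [w [c [C [m0 cC wc hc]]]]] := @field_approx R I (fun i => X (sval i)) _ _ _ _ _ k' B' e' e'0.
  - by move=> i; exact: Xl.
  - by move=> i; exact: Xopp.
  - by move=> i; exact: Xdiv.
  - by move=> js; have [C hC] := Xbound js; exists C => -[s s0] y; exact: hC.
  exists m, (fun j => of_int R (w j)), (fun s => c (cl s)), C; split=> //.
    by move=> s j _; exists (w j).
  by move=> s z s0 zB; have := hc (cl s) z zB; rewrite clE.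
have tX k' : tame true k' setT (fun i : I => X (sval i)).
  apply: (tame_frame (@frame_rV R 2)) => // [i js x _ _|js _ _ B'].
    by apply/smooth_diff/smooth_iterD.
  by have [C hC] := Xbound js; exists C => -[s s0] y _ _; exact: hC.
have XPsi' s p : 0 <= s <= pi -> 'D_(1, 0) Psi (s, p) = X s (Psi (s, p)) by rewrite XPsi.
have [N [m [u [c [N0 m0 uc close]]]]] :=
  splitting_approximation (pi_gt0 R) sPsi Psi0 XPsi' tX apX k B e0.
have N0' : 0 < N%:R :> R by rewrite ltr0n.
have m0' : 0 < m%:R :> R by rewrite ltr0n.
have /choice[wc hwc] : forall i, exists wc : 'rV[int]_2 * E, dot (of_int R wc.1) wc.2 = 0 /\
    ((i < N * m)%N -> split_field m N pi u c i = shear (of_int R wc.1) wc.2).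
  move=> i; have [iNm|_] := ltnP i (N * m); last by exists (0, 0); rewrite dot2 /= !mxE !mulr0 addr0.
  have s0 : 0 <= (pi : R) / N%:R * (i %/ m)%N%:R <= (pi : R).
    apply/andP; split; first by rewrite mulr_ge0 // divr_ge0 // pi_ge0.
    rewrite mulrAC ler_pdivrMr // ler_pM2l ?pi_gt0 //.
    by rewrite ler_nat ltnW // ltn_divLR.
  have [w uw wc] := uc _ (i %% m)%N s0.
  by exists (w, c (pi / N%:R * (i %/ m)%N%:R) (i %% m)%N); rewrite /= -uw.
have hE : pi / (N * m)%:R = pi / N%:R / m%:R :> R by rewrite natrM invfM mulrA.
exists (N * m)%N, (pi / N%:R), (fun i => (wc i).1), (fun i => (wc i).2).
split; [by rewrite muln_gt0 N0|by rewrite divr_gt0 ?pi_gt0|by move=> i; exact: (hwc i).1|].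
move=> A i t s z iM t0; rewrite hE => s0 zB.
have AE j : (j <= i)%N -> A j = split_field m N pi u c j.
  by move=> ji; rewrite (hwc j).2 // (leq_ltn_trans ji).
have stepsE p : shear_steps A (pi / N%:R) i p = shear_steps (split_field m N pi u c) (pi / N%:R) i p.
  by apply: eq_shear_steps => j ji; rewrite AE // ltnW.
under eq_fun do rewrite stepsE AE //.
exact: close.
Qed.

Section Path.
Variables (w : nat -> 'rV[int]_2) (c : nat -> E) (g : nat -> R -> R).
Local Notation u i := (of_int R (w i)).
Hypothesis uc : forall i, dot (u i) (c i) = 0.

Fixpoint shear_path (i : nat) (t : R) (p : E) : E :=
  if i is i'.+1 then shear_flow (u i') (c i') (g i' t) (shear_path i' t p) else p.

Lemma shear_path_lattice i t p l : l \in lattice R -> shear_path i t (p + l) = shear_path i t p + l.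
Proof. by move=> ll; elim: i => [//|i /= ->]; exact: shear_flow_lattice. Qed.

Lemma shear_path_opp i t p : shear_path i t (- p) = - shear_path i t p.
Proof. by elim: i => [//|i /= ->]; exact: shear_flow_opp. Qed.

Lemma smooth_shear_path i t : smooth (shear_path i t).
Proof.
elim: i => [|i IH] /=; first exact: smooth_id.
exact: smooth_comp (smooth_shear_flow_at _ _ _) IH.
Qed.

Lemma shear_path_inverse i t : exists G : E -> E,
  [/\ smooth G, cancel (shear_path i t) G & cancel G (shear_path i t)].
Proof.
elim: i => [|i [G [sG PG GP]]] /=; first by exists id; split=> //; exact: smooth_id.
exists (fun p => G (shear_flow (u i) (c i) (- g i t) p)); split.
- exact: smooth_comp sG (smooth_shear_flow_at _ _ _).
- by move=> p; rewrite shear_flowK.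
- by move=> p; rewrite GP -{1}(opprK (g i t)) shear_flowK.
Qed.

Lemma continuous_shear_path i : (forall j, continuous (g j)) ->
  continuous (fun z : R * E => shear_path i z.1 z.2).
Proof.
move=> cg; elim: i => [|i IH] z /=; first exact: cvg_snd.
apply: (@continuous_comp _ _ _ (fun z : R * E => (g i z.1, shear_path i z.1 z.2))
  (fun z : R * E => shear_flow (u i) (c i) z.1 z.2)).
  have c1 : (fun z : R * E => g i z.1) @ z --> g i z.1.
    by apply: (@continuous_comp _ _ _ (@fst R E) (g i)); [exact: cvg_fst|exact: cg].
  exact: cvg_pair c1 (IH z).
exact: differentiable_continuous (smooth_diff _ (smooth_shear_flow _ _)).
Qed.

Lemma shear_path_steps h i t p : (forall j, (j < i)%N -> g j t = h) ->
  shear_path i t p = shear_steps (fun j => shear (u j) (c j)) h i p.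
Proof.
elim: i => [//|i IH] gh /=; rewrite /shear_flow gh // IH // => j ji.
by apply: gh; exact: ltnW.
Qed.

Lemma shear_path_stop i k t p : (i <= k)%N -> (forall j, (i <= j < k)%N -> g j t = 0) ->
  shear_path k t p = shear_path i t p.
Proof.
elim: k => [|k IH]; first by rewrite leqn0 => /eqP ->.
rewrite leq_eqVlt => /orP[/eqP-> //|ik] gz /=.
have -> : g k t = 0 by apply: gz; rewrite -ltnS ik /=.
rewrite /shear_flow scale0r addr0 IH // => j /andP[ij jk].
by apply: gz; rewrite ij ltnW.
Qed.
End Path.
End ShearPaths.

(** * The piecewise shearing isotopy *)

Section PiecewiseShear.
Variable R : realType.
Local Notation E := 'rV[R]_2.
Local Notation T := (torus R).

Definition ramp (a d t : R) : R := Num.max 0 (Num.min 1 ((t - a) / d)).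

Lemma ramp01 a d t : 0 <= ramp a d t <= 1.
Proof. by rewrite /ramp le_max lexx ge_max ge_min ler01 lexx. Qed.

Lemma ramp_before a d t : 0 < d -> t <= a -> ramp a d t = 0.
Proof.
move=> d0 ta; have : (t - a) / d <= 0 by rewrite pmulr_lle0 ?invr_gt0 // subr_le0.
by move=> h; rewrite /ramp max_l // ge_min h orbT.
Qed.

Lemma ramp_after a d t : 0 < d -> a + d <= t -> ramp a d t = 1.
Proof.
move=> d0 ta; have : 1 <= (t - a) / d by rewrite ler_pdivlMr // mul1r lerBrDl.
by move=> h; rewrite /ramp min_l // max_r.
Qed.

Lemma ramp_during a d t : 0 < d -> a <= t <= a + d -> ramp a d t = (t - a) / d.
Proof.
move=> d0 /andP[a_t td]; rewrite /ramp min_r ?max_r //.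
  by rewrite divr_ge0 ?subr_ge0 // ltW.
by rewrite ler_pdivrMr // mul1r lerBlDl.
Qed.

Lemma continuous_ramp a d : continuous (ramp a d).
Proof.
move=> t; apply: (@continuous_max R R (fun=> 0) (fun t => Num.min 1 ((t - a) / d)) t); first exact: cvg_cst.
apply: (@continuous_min R R (fun=> 1) (fun t => (t - a) / d) t); first exact: cvg_cst.
by apply: cvgM; [apply: cvgB; [exact: cvg_id|exact: cvg_cst]|exact: cvg_cst].
Qed.

Lemma chi_lt (s s' : R) : 0 <= s -> s < s' -> s' <= pi -> chi s < chi s'.
Proof.
move=> s0 ss' s'pi; rewrite /chi ltr_pM2r ?invr_gt0 // ltrD2l ltrN2 ltr_cos // in_itv /=.
  by rewrite s0 (le_trans (ltW ss')).
by rewrite s'pi (le_trans s0 (ltW ss')).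
Qed.

Lemma chi_le (s s' : R) : 0 <= s -> s <= s' -> s' <= pi -> chi s <= chi s'.
Proof. by move=> s0; rewrite le_eqVlt => /orP[/eqP->//|h] h'; rewrite ltW // chi_lt. Qed.

Lemma chi_surj (t : R) : 0 <= t <= 1 -> exists2 s : R, 0 <= s <= pi & chi s = t.
Proof.
move=> /andP[t0 t1]; have h : -1 <= 1 - 2 * t <= 1 by apply/andP; split; lra.
have [h0 h1] := acos_def h; exists (acos (1 - 2 * t)) => //.
by rewrite /chi h1; field.
Qed.

Lemma find_step (d s : R) M : (0 < M)%N -> 0 <= s <= d * M%:R ->
  exists2 i, (i < M)%N & d * i%:R <= s <= d * i.+1%:R.
Proof.
elim: M => [//|[_ _ h|M IH _ /andP[s0 sM]]]; first by exists 0%N => //; rewrite mulr0.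
have [h|h] := leP s (d * M.+1%:R).
  by have [|i iM hi] := IH isT; [rewrite s0|exists i => //; exact: ltnW].
by exists M.+1 => //; rewrite (ltW h).
Qed.

Section Times.
Variables (M : nat) (h : R) (w : nat -> 'rV[int]_2) (c : nat -> E).
Hypotheses (M0 : (0 < M)%N) (h0 : 0 < h).
Local Notation u i := (of_int R (w i)).
Hypothesis uc : forall i, dot (u i) (c i) = 0.
Local Notation A i := (shear (u i) (c i)).

(** Equal steps in the parameter s of the lift, transported by chi. *)
Definition step_time (i : nat) : R := chi (pi / M%:R * i%:R).
Local Notation tau := step_time.
(** A shearing isotopy is linear in time, so the amplitude of the i-th shear grows linearly between
    two successive step times, and not as chi would have it; the approximation holds for all
    amplitudes in [0, h]. *)
Definition step_clock (i : nat) (t : R) : R := h * ramp (tau i) (tau i.+1 - tau i) t.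
Local Notation clock := step_clock.
Local Notation path := (shear_path w c clock).

Lemma step_arg i : (i <= M)%N -> 0 <= (pi : R) / M%:R * i%:R <= pi.
Proof.
move=> iM; apply/andP; split; first by rewrite mulr_ge0 // divr_ge0 // pi_ge0.
by rewrite mulrAC ler_pdivrMr ?ltr0n // ler_pM2l ?pi_gt0 // ler_nat.
Qed.

Lemma step_time0 : tau 0 = 0. Proof. by rewrite /tau mulr0 chi0. Qed.

Lemma step_timeM : tau M = 1.
Proof. by rewrite /tau divfK ?chipi // pnatr_eq0 -lt0n. Qed.

Lemma step_time_lt i : (i < M)%N -> tau i < tau i.+1.
Proof.
move=> iM; have /andP[a0 _] := step_arg (ltnW iM); have /andP[_ a1] := step_arg iM.
apply: chi_lt => //; rewrite ltr_pM2l ?divr_gt0 ?pi_gt0 ?ltr0n // ltr_nat //.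
Qed.

Lemma step_time_le i j : (i <= j)%N -> (j <= M)%N -> tau i <= tau j.
Proof.
move=> ij jM; have /andP[a0 _] := step_arg (leq_trans ij jM); have /andP[_ a1] := step_arg jM.
by apply: chi_le => //; rewrite ler_pM2l ?divr_gt0 ?pi_gt0 ?ltr0n // ler_nat.
Qed.

Lemma step_path i t p : (i < M)%N -> tau i <= t <= tau i.+1 ->
  path M t p = shear_steps (fun j => A j) h i p + clock i t *: A i (shear_steps (fun j => A j) h i p).
Proof.
move=> iM /andP[t0 t1].
have d0 j : (j < M)%N -> 0 < tau j.+1 - tau j by move=> jM; rewrite subr_gt0 step_time_lt.
rewrite (@shear_path_stop _ _ _ _ i.+1 M) //= => [|j /andP[ij jM]].
  rewrite (@shear_path_steps _ _ _ _ h) // => j ji; have jM := ltn_trans ji iM.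
  rewrite /step_clock ramp_after ?mulr1 ?d0 // addrC subrK (le_trans _ t0) //.
  by apply: step_time_le => //; exact: ltnW.
rewrite /step_clock ramp_before ?mulr0 ?d0 // (le_trans t1) //.
by apply: step_time_le => //; exact: ltnW.
Qed.

Lemma step_clock_during i t : (i < M)%N -> tau i <= t <= tau i.+1 ->
  clock i t = h / (tau i.+1 - tau i) * (t - tau i).
Proof.
move=> iM ht; rewrite /step_clock ramp_during ?subr_gt0 ?step_time_lt //.
  by rewrite mulrA mulrAC.
by rewrite addrC subrK.
Qed.

Lemma step_clock_bound i t : 0 <= clock i t <= h.
Proof.
have /andP[r0 r1] := ramp01 (tau i) (tau i.+1 - tau i) t.
by rewrite mulr_ge0 ?(ltW h0) //= ger_pMr.
Qed.

Definition step_isotopy (t : R) (x : T) : T := tproj (path M t (tlog x)).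

Lemma step_isotopy_lift t p : step_isotopy t (tproj p) = tproj (path M t p).
Proof. by apply: tproj_descent => q l; exact: shear_path_lattice. Qed.

Lemma step_isotopy_isotopy : isotopy step_isotopy.
Proof.
split.
- apply/funext => x; rewrite /step_isotopy (@shear_path_stop _ _ _ _ 0 M) // ?tlogK // => j jM.
  rewrite /step_clock ramp_before ?mulr0 ?subr_gt0 ?step_time_lt //.
  by rewrite -step_time0 step_time_le // ltnW.
- move=> t _; have [G [sG PG GP]] := shear_path_inverse clock uc M t.
  apply: (lift_diffeo _ sG PG GP) (step_isotopy_lift t); first exact: smooth_shear_path.
  by move=> p l; exact: shear_path_lattice.
- apply: continuous_subspaceT.
  apply: (@descent_continuous _ (fun z => path M z.1 z.2) step_isotopy); last exact: step_isotopy_lift.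
  apply: continuous_shear_path => j t; apply: cvgM; [exact: cvg_cst|exact: continuous_ramp].
Qed.

Lemma step_isotopy_equivariant t : equivariant (step_isotopy t).
Proof. by move=> x; rewrite -(tlogK x) -tprojN !step_isotopy_lift shear_path_opp tprojN. Qed.

Lemma step_isotopy_shear i t x : (i < M)%N -> tau i <= t <= tau i.+1 ->
  step_isotopy t x =
  torus_shear (u i) (c i) (h / (tau i.+1 - tau i) * (t - tau i)) (step_isotopy (tau i) x).
Proof.
move=> iM ht; have hi : tau i <= tau i <= tau i.+1 by rewrite lexx ltW ?step_time_lt.
rewrite -(tlogK x) !step_isotopy_lift torus_shear_lift // !(step_path _ iM) // !step_clock_during //.
by rewrite subrr mulr0 scale0r addr0.
Qed.
End Times.
End PiecewiseShear.

Theorem theorem4p5 (R : realType) (psi : R -> torus R -> torus R)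
    (psi_isotopy : smooth_isotopy psi)
    (psi_area : forall t : R, 0 <= t <= 1 -> area_preserving (psi t))
    (psi_equiv : forall t : R, 0 <= t <= 1 -> equivariant (psi t))
    (r : nat) (eps : R) (eps_gt0 : 0 < eps) :
  exists phi : R -> torus R -> torus R,
    [/\ isotopy phi,
        forall t : R, 0 <= t <= 1 -> equivariant (phi t),
        forall t : R, 0 <= t <= 1 -> (Crdist r (psi t) (phi t) < eps%:E)%E &
        exists (n : nat) (tau : nat -> R) (zeta : nat -> R -> torus R -> torus R),
          [/\ tau 0%N = 0,
              tau n.+1 = 1,
              forall i : nat, (i <= n)%N -> tau i < tau i.+1,
              forall i : nat, (i <= n)%N ->
                shearing_isotopy (zeta i) /\
                forall s : R, 0 <= s <= 1 -> equivariant (zeta i s) &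
              forall (i : nat) (t : R) (x : torus R), (i <= n)%N ->
                tau i <= t <= tau i.+1 ->
                phi t x = zeta i (t - tau i) (phi (tau i) x)]].
Proof.
have [Psi [X [[sPsi Psi0 psiE Psil XPsi] [sX Xl Xopp Xdiv Xbound]]]] :=
  isotopy_field psi_isotopy psi_area psi_equiv.
(* this makes the distance at most 2 e (r + 1) = eps / 2 *)
pose e := eps / (4 * r.+1%:R).
have e0 : 0 < e by rewrite divr_gt0 // mulr_gt0.
have [M [h [w [c [M0 h0 wc close]]]]] :=
  shear_splitting sPsi Psi0 XPsi sX Xl Xopp Xdiv Xbound r pi e0.
exists (step_isotopy M h w c); split.
- exact: step_isotopy_isotopy.
- by move=> t _; exact: step_isotopy_equivariant.
- move=> t t01; have [s s0 <-] := chi_surj t01.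
  have [i iM hi] : exists2 i, (i < M)%N & (pi : R) / M%:R * i%:R <= s <= pi / M%:R * i.+1%:R.
    by apply: find_step => //; rewrite divfK // pnatr_eq0 -lt0n.
  have ti : step_time R M i <= chi s <= step_time R M i.+1.
    have /andP[i0 _] := step_arg R M0 (ltnW iM); have /andP[_ i1] := step_arg R M0 iM.
    have /andP[s1 s2] := s0; have /andP[hi1 hi2] := hi.
    by rewrite !chi_le.
  apply: (@le_lt_trans _ _ (2 * e * r.+1%:R)%:E); last first.
    have k0 : r.+1%:R != 0 :> R by rewrite pnatr_eq0.
    have -> : 2 * e * r.+1%:R = eps / 2 by rewrite /e; move: k0; set k := _.+1%:R => k0; field.
    by rewrite lte_fin ltr_pdivrMr // ltr_pMr // ltr1n.
  apply: (Crdist_lift (F := fun p => Psi (s, p)) (G := shear_path w c (step_clock M h) M (chi s))).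
  + exact: smooth_slice.
  + exact: smooth_shear_path.
  + by move=> p; rewrite psiE.
  + by move=> p; exact: step_isotopy_lift.
  + by move=> p l; exact: Psil.
  + by move=> p l; exact: shear_path_lattice.
  + move=> z zpi; rewrite distrC; rewrite (@itang_ext _ _ _ _ _ _ (fun p => step_path h w c M0 p iM ti)).
    exact: close iM (step_clock_bound M h0 i _) hi zpi.
exists M.-1, (step_time R M), (fun i s => torus_shear (of_int R (w i)) (c i)
  (h / (step_time R M i.+1 - step_time R M i) * s)).
have Mn : M.-1.+1 = M := prednK M0.
have leM i : (i <= M.-1)%N -> (i < M)%N by rewrite -ltnS Mn.
split.
- exact: step_time0.
- by rewrite Mn; exact: step_timeM.
- by move=> i /leM iM; exact: step_time_lt.
- move=> i _; split; first exact: torus_shear_isotopy.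
  by move=> s _; exact: torus_shear_equivariant.
- by move=> i t x /leM iM; exact: step_isotopy_shear.
Qed.
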